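(* Let $(\varkappa_t)_{t\in\mathbb R}$ be the Gaussian process $$\varkappa_t=\frac1{\sqrt{2\pi}}e^{-\frac12t^2}\sum_{k=0}^\infty\mathbb E\big[Y_{\frac12}^k\big]\frac1{\sqrt{k!}}H_k(t)\cdot\zeta_k,$$ with $(\zeta_k)$ i.i.d. $N(0,1)$, whose covariance function is $\mathrm{Cov}(\varkappa_t,\varkappa_s)=\mathbb E[\mathfrak n(t,s;Y)]$. Define a complex Gaussian field by $\widehat\varkappa_\theta=\int_{\mathbb R}e^{i\theta t}\varkappa_t\,dt$, $\theta\in\mathbb R$. Then $(\widehat\varkappa_\theta)$ has a covariance matrix $$\mathrm{Cov}\big(\widehat\varkappa_\theta,\widehat\varkappa_\phi\big)=\mathbb E\big[\widehat\varkappa_\theta\overline{\widehat\varkappa}_\phi\big]=e^{-\frac12(\theta^2+\phi^2)}\,\mathbb E\big[e^{\theta\phi Y}\big].$$ Then $\widehat\varkappa_\theta$ is distributed as $U_\theta+iV_\theta$, where $U_\theta$ and $V_\theta$ are independent real Gaussian processes with $U_\theta=\int_{\mathbb R}e^{i\theta t}\varkappa_t^{\mathrm{even}}dt$, $V_\theta=i\int_{\mathbb R}e^{i\theta t}\varkappa_t^{\mathrm{odd}}dt$, and $$\mathrm{Cov}(U_\theta,U_\phi)=e^{-\frac12(\theta^2+\phi^2)}\mathbb E\big[\cosh(\theta\phi Y)\big],\qquad \mathrm{Cov}(V_\theta,V_\phi)=e^{-\frac12(\theta^2+\phi^2)}\mathbb E\big[\sinh(\theta\phi Y)\big].$$ Plancherel's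 theorem shows that $$\mathbb E\int_{\mathbb R}|\varkappa_s|^2ds=\mathbb E\int_{\mathbb R}|\widehat\varkappa_\theta|^2d\theta=\mathbb E\Big[\sqrt{\frac{\pi}{1-Y}}\Big],$$ assuming that the expectation on the right is finite.
   Context: $\nu_*^{[-1,1]}$ is a non-negative measure on $[-1,1]$. $Y$ and $Y_{\frac12}$ are random variables distributed respectively as the products of the points in point processes with probability generating functionals $G[f]=\big(1+\int_{[-1,1]}(1-f(\xi))\,\nu_*^{[-1,1]}(d\xi)\big)^{-1}$ and $G[f]^{1/2}$, where the probability generating functional of a point process with points $(\xi_j)$ is $\mathbb E[\prod_jf(\xi_j)]$ for suitable functions $f$; in particular $\mathbb E[Y^k]=\mathbb E[Y_{\frac12}^k]^2$. $\mathfrak n(t,s;\rho)$ is the standard bivariate normal density with correlation coefficient $\rho$. The Hermite–Chebycheff polynomials $H_k$, orthogonal on the standard normal distribution, have generating function $\sum_{k\ge0}\frac{w^k}{k!}H_k(t)=e^{wt-\frac12w^2}$. The even and odd parts are $\varkappa_t^{\mathrm{even}}=\frac12(\varkappa_t+\varkappa_{-t})$ and $\varkappa_t^{\mathrm{odd}}=\frac12(\varkappa_t-\varkappa_{-t})$.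
   Formalization: The last display is false as printed for this unnormalized transform (if Y=0 a.s. the sides are 1/(2√π) and √π); the formal statement multiplies E∫|ϰ_s|²ds by 2π. The series for ϰ_t is assumed to converge a.s. for each t, so that the process is defined. *)

(* Defs.v *)
From HB Require Import structures.
From mathcomp Require Import all_boot all_order all_algebra.
From mathcomp Require Import all_classical all_reals all_analysis.
From mathcomp Require Import complex.

Set Implicit Arguments.
Unset Strict Implicit.
Unset Printing Implicit Defensive.

Import Order.TTheory GRing.Theory Num.Theory.
Import numFieldNormedType.Exports.

Local Open Scope classical_set_scope.
Local Open Scope ring_scope.
Local Open Scope complex_scope.

(* A point process on [-1, 1] is given by an enumeration of its at most
   countably many points: the j-th point exists on the event [pres j] and is
   then located at [xi j].  Indices without a point contribute an empty factor
   to every product. *)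
Section PointProcess.
Context {R : realType} {d : measure_display} {T : measurableType d}.
Implicit Types (Q : probability T R) (pres : nat -> set T).
Implicit Types (xi : nat -> T -> R) (f : R -> R).

Definition point_process pres xi : Prop :=
  forall j, [/\ measurable (pres j),
               measurable_fun [set: T] (xi j)
             & forall w, xi j w \in `[-1, 1]].

Definition partial_product pres xi f (w : T) : R^nat :=
  fun n => \prod_(j < n) (if w \in pres j then f (xi j w) else 1).

Definition as_product_converges Q pres xi f : Prop :=
  {ae Q, forall w, cvgn (partial_product pres xi f w)}.

Definition points_product pres xi f (w : T) : R :=
  limn (partial_product pres xi f w).

(* The test functions are the measurable functions bounded by 1 for which the
   product over the points makes sense almost surely.  They need not be
   nonnegative, so that the powers of the points are allowed. *)
Definition has_pgfl Q pres xi (G : (R -> R) -> \bar R) : Prop :=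
  forall f : R -> R, measurable_fun (`[-1, 1]%classic : set R) f ->
    (forall x, x \in `[-1, 1] -> `|f x| <= 1) ->
    as_product_converges Q pres xi f ->
    'E_Q[points_product pres xi f]%E = G f.

End PointProcess.

Definition equal_in_law {R : realType} {d1 d2 : measure_display}
    {T1 : measurableType d1} {T2 : measurableType d2}
    (P1 : probability T1 R) (P2 : probability T2 R)
    (X1 : T1 -> R) (X2 : T2 -> R) : Prop :=
  forall A : set R, measurable A -> P1 (X1 @^-1` A) = P2 (X2 @^-1` A).

Definition law_of_product_of_points {R : realType} {d : measure_display}
    {T : measurableType d} (P : probability T R) (Y : T -> R)
    (G : (R -> R) -> \bar R) : Prop :=
  exists (d' : measure_display) (T' : measurableType d')
    (Q : probability T' R) (pres : nat -> set T') (xi : nat -> T' -> R),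
    [/\ point_process pres xi,
        has_pgfl Q pres xi G,
        as_product_converges Q pres xi id
      & equal_in_law P Q Y (points_product pres xi id)].

(* The inverse is taken in the extended reals, where 1 / +oo = 0. *)
Definition pgfl_nu {R : realType} (nu : {measure set R -> \bar R})
    (f : R -> R) : \bar R :=
  ((1 + \int[nu]_(x in `[(-1)%R, 1%R]) (1 - f x)%:E)^-1)%E.

Section Gaussian.
Context {R : realType} {d : measure_display} {T : measurableType d}.
Variable P : probability T R.

(* Degenerate (constant) variables are Gaussian; they are treated apart because
   [normal_prob m 0] is not the Dirac mass at [m]. *)
Definition gaussian_rv (X : T -> R) : Prop :=
  measurable_fun [set: T] X /\
  ((exists m : R, {ae P, forall w, X w = m}) \/
   (exists m s : R, 0 < s /\
      forall A : set R, measurable A -> P (X @^-1` A) = normal_prob m s A)).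

Definition gaussian_process (I : Type) (X : I -> T -> R) : Prop :=
  forall (n : nat) (i : 'I_n -> I) (c : 'I_n -> R),
    gaussian_rv (fun w => \sum_(k < n) c k * X (i k) w).

Definition complex_gaussian_field (I : Type) (Z : I -> T -> R[i]) : Prop :=
  gaussian_process
    (fun (p : I * bool) w =>
       if p.2 then complex.Re (Z p.1 w) else complex.Im (Z p.1 w)).

Definition mutually_independent (I : choiceType) (X : I -> T -> R) : Prop :=
  forall (s : seq I) (B : I -> set R), uniq s ->
    (forall i, measurable (B i)) ->
    P (\bigcap_(i in [set` s]) (X i @^-1` B i)) =
    (\prod_(i <- s) P (X i @^-1` B i))%E.

Definition iid_standard_normal (zeta : nat -> T -> R) : Prop :=
  mutually_independent zeta /\
  forall k, measurable_fun [set: T] (zeta k) /\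
    forall A : set R, measurable A -> P (zeta k @^-1` A) = normal_prob 0 1 A.

Definition sigma_of_process (I : Type) (X : I -> T -> R) : set (set T) :=
  <<s [set E | exists i (B : set R), measurable B /\ E = X i @^-1` B] >>.

Definition independent_processes (I J : Type)
    (X : I -> T -> R) (X' : J -> T -> R) : Prop :=
  forall E F : set T, sigma_of_process X E -> sigma_of_process X' F ->
    P (E `&` F) = (P E * P F)%E.

(* Equality of all finite-dimensional distributions, C being R x R. *)
Definition complex_fields_equal_in_law (I : Type)
    (Z Z' : I -> T -> R[i]) : Prop :=
  forall (n : nat) (i : 'I_n -> I) (A : set (n.-tuple (R * R)%type)),
    measurable A ->
    P [set w | A [tuple (complex.Re (Z (i k) w),
                         complex.Im (Z (i k) w)) | k < n]] =
    P [set w | A [tuple (complex.Re (Z' (i k) w),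
                         complex.Im (Z' (i k) w)) | k < n]].

End Gaussian.

Section ComplexIntegral.
Context {R : realType}.

Definition cintegral {d : measure_display} {T : measurableType d}
    (mu : {measure set T -> \bar R}) (f : T -> R[i]) : R[i] :=
  Rintegral mu [set: T] (fun x => complex.Re (f x)) +i*
  Rintegral mu [set: T] (fun x => complex.Im (f x)).

Definition ccovariance {d : measure_display} {T : measurableType d}
    (P : probability T R) (X Y : T -> R[i]) : R[i] :=
  cintegral P (fun w => (X w - cintegral P X) * (Y w - cintegral P Y)^*%C).

Definition cexpi (x : R) : R[i] := cos x +i* sin x.

Definition fourier (f : R -> R) (theta : R) : R[i] :=
  cintegral (@lebesgue_measure R) (fun t => cexpi (theta * t) * (f t)%:C).

End ComplexIntegral.

Section Process.
Context {R : realType}.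

Definition hermite_chebycheff (H : nat -> {poly R}) : Prop :=
  forall w t : R,
    series (fun k => w ^+ k / k`!%:R * (H k).[t]) @ \oo -->
    expR (w * t - w ^+ 2 / 2).

Definition binormal_pdf (t s rho : R) : R :=
  (2 * pi * Num.sqrt (1 - rho ^+ 2))^-1 *
  expR (- (t ^+ 2 - 2 * rho * t * s + s ^+ 2) / (2 * (1 - rho ^+ 2))).

Definition cosh (x : R) : R := (expR x + expR (- x)) / 2.
Definition sinh (x : R) : R := (expR x - expR (- x)) / 2.

Definition even_part (f : R -> R) (t : R) : R := (f t + f (- t)) / 2.
Definition odd_part (f : R -> R) (t : R) : R := (f t - f (- t)) / 2.

Definition moment {d : measure_display} {T : measurableType d}
    (P : probability T R) (X : T -> R) (k : nat) : R :=
  fine ('E_P[fun w => (X w ^+ k)%R])%E.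

(* [m k] stands for the k-th moment of Y_{1/2}. *)
Definition kappa_series (m : nat -> R) (H : nat -> {poly R}) {T : Type}
    (zeta : nat -> T -> R) (t : R) (w : T) : R^nat :=
  series (fun k => m k * (Num.sqrt k`!%:R)^-1 * (H k).[t] * zeta k w).

Definition kappa (m : nat -> R) (H : nat -> {poly R}) {T : Type}
    (zeta : nat -> T -> R) (t : R) (w : T) : R :=
  (Num.sqrt (2 * pi))^-1 * expR (- (t ^+ 2 / 2)) *
  limn (kappa_series m H zeta t w).

End Process.

(* Main.v *)
Require Import Defs.
From HB Require Import structures.
From mathcomp Require Import all_boot all_order all_algebra.
From mathcomp Require Import all_classical all_reals all_analysis.
From mathcomp Require Import measurable_realfun.
From mathcomp Require Import complex ring lra.

Set Implicit Arguments.
Unset Strict Implicit.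
Unset Printing Implicit Defensive.

Import Order.TTheory GRing.Theory Num.Theory.
Import numFieldNormedType.Exports.

Local Open Scope classical_set_scope.
Local Open Scope ring_scope.

(** All the covariances are power series in [E(Y ^ k)], and they are summed by
    two facts on the Hermite polynomials.  Mehler's formula ([mehler]) sums
    [x ^ k / k! * H_k(t) * H_k(s)] to the quotient of the bivariate normal
    density of correlation [x] by the two standard densities.  The Fourier
    transform of the Hermite function of index [k] is
    [i ^ k * a ^ k * exp(- a ^ 2 / 2)] ([hermite_transform_mul]); its cosine part
    only sees even [k] and its sine part only odd [k], which is how cosh and sinh
    arise.  Moments enter through [E(Y_half ^ k) ^ 2 = E(Y ^ k)]
    ([moment_half_sqr]), obtained by testing the two generating functionals on
    the powers, as a power of a product of points is the product of the powers.

    The values of the process, of its cosine and sine transforms, and all their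
    linear combinations are mean square sums of series in the [zeta k]
    ([zeta_series]).  For such variables, normality, centering and the formula of
    the covariance as the sum of the products of the coefficients are proved once
    ([zeta_series_scaled_normal], [zeta_series_mul]): finite sums are normal by
    convolution, and the law passes to mean square limits
    ([equal_in_law_limit]).

    The analytic difficulty is the singularity of Mehler's kernel at [|Y| = 1].
    It is excluded by the almost sure convergence of the series at the origin
    alone: normal variables that converge almost surely have bounded variances
    ([scaled_normal_ae_cvg_bounded]), and these variances sum to the mean of
    [(1 - Y ^ 2) ^ (- 1 / 2)], so that [|Y| < 1] almost surely and this mean is
    finite ([ae_norm_lt1], [integrable_inv_sqrt]).  It bounds the variance at
    [t] by a constant times [exp(- t ^ 2 / 2)], and with this decay a weighted
    Cauchy-Schwarz inequality allows to integrate the series term by term in [t]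
    ([kappa_int_zeta_series]).

    The even part of the process only involves the [zeta k] with [k] even and the
    odd part those with [k] odd, whence the independence of [U] and [V]
    ([masked_processes_independent]).  Almost surely the transform of the process
    is [U - i V]; changing the sign of the [zeta k] with [k] odd preserves their
    joint law and turns it into [U + i V] ([fourier_kappa_law]).  In Plancherel's
    identity both sides are computed by Tonelli's theorem, and each of them is
    the mean of [sqrt(pi / (1 - Y))]. *)

(** * Power series and the Hermite recurrence *)
Section PowerSeries.
Context {R : realType}.
Implicit Types (c : R^nat) (x z r : R).

(** The open disc of convergence, a notion stable under termwise
    differentiation, contrary to convergence at a point. *)
Definition converges_within c r := forall z, `|z| < r -> cvgn (pseries c z).

(** The coefficients of the series multiplied by its variable. *)
Definition pseries_shift c : R^nat := fun k => if k is j.+1 then c j else 0.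

Lemma pseries_shift_cvg c x l :
  pseries c x @ \oo --> l -> pseries (pseries_shift c) x @ \oo --> x * l.
Proof.
move=> cl; rewrite -(cvg_shiftS (pseries (pseries_shift c) x)).
have -> : (fun n => pseries (pseries_shift c) x n.+1) =
    (fun n => x * pseries c x n).
  apply/funext => n; rewrite /pseries /series /= big_nat_recl//= mul0r add0r.
  by rewrite mulr_sumr; apply: eq_bigr => i _; rewrite exprS mulrCA.
exact: cvgMr.
Qed.

Lemma pseriesZ_cvg c x l a :
  pseries c x @ \oo --> l -> pseries (fun k => a * c k) x @ \oo --> a * l.
Proof.
move=> cl; have -> : pseries (fun k => a * c k) x = (fun n => a * pseries c x n).
  apply/funext => n; rewrite /pseries /series /= mulr_sumr.
  by apply: eq_bigr => i _; rewrite mulrA.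
exact: cvgMr.
Qed.

Lemma pseriesD_cvg c c' x l l' :
  pseries c x @ \oo --> l -> pseries c' x @ \oo --> l' ->
  pseries (fun k => c k + c' k) x @ \oo --> l + l'.
Proof.
move=> cl cl'.
have -> : pseries (fun k => c k + c' k) x =
    (fun n => pseries c x n + pseries c' x n).
  apply/funext => n; rewrite /pseries /series /= -big_split.
  by apply: eq_bigr => i _; rewrite mulrDl.
exact: (cvgD cl cl').
Qed.

Lemma mulrS_geometric_le x k : 0 <= x < 1 -> k.+1%:R * x ^+ k <= (1 - x)^-1.
Proof.
move=> /andP[x0 x1]; have x1' : 0 < 1 - x by rewrite subr_gt0.
apply: (@le_trans _ _ (\sum_(0 <= i < k.+1) x ^+ i)).
  rewrite mulr_natl -[X in _ *+ X]subn0 -sumr_const_nat.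
  apply: ler_sum_nat => i /andP[_ ik]; rewrite ltnS in ik.
  by apply: ler_wiXn2l => //; apply: ltW.
rewrite -[leRHS]mul1r ler_pdivlMr// big_mkord mulrC.
by rewrite -opprB mulNr -subrX1 opprB gerBl exprn_ge0.
Qed.

(** The terms at [z] are compared with a geometric series, at a radius halfway
    between [|z|] and [r]. *)
Lemma bounded_converges_within c r :
  (forall q, 0 < q < r -> exists M, forall k, `|c k| * q ^+ k <= M) ->
  converges_within c r.
Proof.
move=> cb z zr.
have q0 : 0 < (`|z| + r) / 2 by have := normr_ge0 z; lra.
have qr : (`|z| + r) / 2 < r by lra.
have zq : `|z| < (`|z| + r) / 2 by lra.
have [M Mc] : exists M, forall k, `|c k| * ((`|z| + r) / 2) ^+ k <= M.
  by apply: cb; rewrite q0 qr.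
set q := (`|z| + r) / 2 in q0 qr zq Mc.
apply: normed_cvg; apply: (@series_le_cvg _ _ (geometric M (`|z| / q))).
- by move=> n /=; exact: normr_ge0.
- move=> n /=; apply: mulr_ge0.
    by apply: le_trans (Mc 0%N); rewrite mulr_ge0.
  by rewrite exprn_ge0// divr_ge0// ltW.
- move=> n /=; rewrite normrM normrX expr_div_n.
  have qn : 0 < q ^+ n by rewrite exprn_gt0.
  rewrite mulrA ler_pdivlMr// mulrAC; apply: ler_wpM2r (Mc n).
  exact: exprn_ge0.
- apply: is_cvg_geometric_series; rewrite normrM normr_id normfV.
  by rewrite (gtr0_norm q0) ltr_pdivrMr// mul1r.
Qed.

Lemma converges_within_bounded c r :
  converges_within c r ->
  forall q, 0 <= q < r -> exists M, forall k, `|c k| * q ^+ k <= M.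
Proof.
move=> cc q /andP[q0 qr].
have /cc/cvg_series_cvg_0/cvgP : `|q| < r by rewrite ger0_norm.
move=> /cvg_seq_bounded[M [_ MB]].
exists (M + 1) => k; have := MB (M + 1).
by rewrite ltrDl ltr01 => /(_ isT k I); rewrite /= normrM normrX (ger0_norm q0).
Qed.

(** The factor [k + 1] is absorbed by passing to a slightly larger radius. *)
Lemma converges_within_diffs c r :
  converges_within c r -> converges_within (pseries_diffs c) r.
Proof.
move=> cc; apply: bounded_converges_within => q /andP[q0 qr].
have [p qp pr] : exists2 p, q < p & p < r by exists ((q + r) / 2); lra.
have p0 : 0 < p by apply: lt_trans qp.
have [|M Mc] := @converges_within_bounded _ _ cc p; first by rewrite ltW.
have qp1 : 0 <= q / p < 1.
  by rewrite divr_ge0 ?ltW//= ltr_pdivrMr// mul1r.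
exists (M / p * (1 - q / p)^-1) => k.
rewrite /pseries_diffs normrM normr_nat.
have -> : k.+1%:R * `|c k.+1| * q ^+ k =
    (`|c k.+1| * p ^+ k.+1 / p) * (k.+1%:R * (q / p) ^+ k).
  have pk : p ^+ k != 0 by rewrite expf_neq0 ?gt_eqF.
  have pn : p != 0 by rewrite gt_eqF.
  by rewrite [(q / p) ^+ k]expr_div_n exprS; field; rewrite pk pn.
apply: ler_pM => //.
- apply: divr_ge0; last exact: ltW.
  by apply: mulr_ge0 => //; apply: exprn_ge0; exact: ltW.
- by rewrite mulr_ge0// exprn_ge0//; case/andP: qp1.
- by rewrite ler_pM2r ?invr_gt0.
- exact: mulrS_geometric_le.
Qed.

Lemma pseries_is_derive c r x : converges_within c r -> `|x| < r ->
  is_derive x 1 (fun y => limn (pseries c y)) (limn (pseries (pseries_diffs c) x)).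
Proof.
move=> cc xr; have K0 : 0 <= (`|x| + r) / 2 by have := normr_ge0 x; lra.
apply: (@pseries_snd_diffs _ _ ((`|x| + r) / 2)).
- by apply: cc; rewrite ger0_norm//; lra.
- by apply: converges_within_diffs cc _ _; rewrite ger0_norm//; lra.
- apply: converges_within_diffs (converges_within_diffs cc) _ _.
  by rewrite ger0_norm//; lra.
- by rewrite [ltRHS]ger0_norm//; lra.
Qed.

(** The value at the origin gives the first coefficient, and the derivative is
    again a power series with sum zero. *)
Lemma pseries0_coef c : (forall x, pseries c x @ \oo --> (0 : R)) ->
  forall n, c n = 0.
Proof.
move=> c0 n; elim: n c c0 => [|n IHn] c c0.
  have := c0 0; rewrite -(cvg_shiftS (pseries c 0)).
  have -> : (fun n => pseries c 0 n.+1) = cst (c 0%N).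
    apply/funext => n; rewrite /pseries /series /= big_nat_recl//= expr0 mulr1.
    by rewrite big1 ?addr0// => i _; rewrite expr0n/= mulr0.
  by move=> /(cvg_unique _ (cvg_cst _)) ->.
have cc r : converges_within c r by move=> z _; exact: cvgP (c0 z).
have dc0 x : pseries (pseries_diffs c) x @ \oo --> (0 : R).
  have xr : `|x| < `|x| + 1 by rewrite ltrDl.
  have := @pseries_is_derive c _ x (cc _) xr.
  rewrite (_ : (fun y => _) = cst 0); last first.
    by apply/funext => y; apply/cvg_lim => //; exact: c0.
  move=> /@derive_val; rewrite derive_cst => ->.
  exact: (converges_within_diffs (cc _) xr).
have := IHn _ dc0; rewrite /pseries_diffs => /eqP.
by rewrite mulf_eq0 pnatr_eq0 /= => /eqP.
Qed.

Lemma pseries_coef_unique c c' (f : R -> R) :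
  (forall x, pseries c x @ \oo --> f x) ->
  (forall x, pseries c' x @ \oo --> f x) -> c =1 c'.
Proof.
move=> cf c'f n; apply/eqP; rewrite -subr_eq0; apply/eqP.
apply: (@pseries0_coef (fun n => c n - c' n)) => x.
have := pseriesD_cvg (cf x) (pseriesZ_cvg (a := -1) (c'f x)).
rewrite mulN1r subrr.
by under eq_fun do rewrite mulN1r.
Qed.

End PowerSeries.

Section Hermite.
Context {R : realType}.
Variable H : nat -> {poly R}.
Hypothesis hH : hermite_chebycheff H.

Lemma hermite_pseries t w :
  pseries (fun k => (H k).[t] / k`!%:R) w @ \oo --> expR (w * t - w ^+ 2 / 2).
Proof.
rewrite (_ : pseries _ w = series (fun k => w ^+ k / k`!%:R * (H k).[t])).
  exact: hH.
by apply/funext => n; apply: eq_bigr => i _; rewrite mulrC mulrA mulrAC.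
Qed.

Lemma is_derive_gauss_exp (t w : R) :
  is_derive w 1 (fun w : R => expR (w * t - w ^+ 2 / 2))
            ((t - w) * expR (w * t - w ^+ 2 / 2)).
Proof.
apply: is_derive_eq. rewrite /GRing.scale /=.
by rewrite !(mulr0, mulr1, add0r); field.
Qed.

Lemma hermite0 t : (H 0).[t] = 1.
Proof.
have := @hermite_pseries t 0.
rewrite -(cvg_shiftS (pseries _ 0)) mul0r expr0n/= mul0r subr0 expR0.
have -> : (fun n => pseries (fun k => (H k).[t] / k`!%:R) 0 n.+1) =
    cst (H 0).[t].
  apply/funext => n; rewrite /pseries /series /= big_nat_recl//= expr0 mulr1.
  by rewrite divr1 big1 ?addr0// => i _; rewrite expr0n/= mulr0.
by move=> /(cvg_unique _ (cvg_cst _)) ->.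
Qed.

Let cvg_hermite t r : converges_within (fun k => (H k).[t] / k`!%:R) r.
Proof. by move=> z _; exact: cvgP (@hermite_pseries t z). Qed.

(** The generating function [f] satisfies [f' = (t - w) f] in the variable [w];
    the coefficients of both sides agree. *)
Lemma hermite_rec_fact t k :
  (H k.+1).[t] / k`!%:R =
  t * ((H k).[t] / k`!%:R) - pseries_shift (fun k => (H k).[t] / k`!%:R) k.
Proof.
pose c : R^nat := fun k => (H k).[t] / k`!%:R.
pose f w := expR (w * t - w ^+ 2 / 2).
have -> : (H k.+1).[t] / k`!%:R = pseries_diffs c k.
  rewrite /pseries_diffs /c factS natrM invfM mulrCA mulrA mulrA.
  by rewrite mulfK// pnatr_eq0.
move: k; suff E : pseries_diffs c =1 (fun k => t * c k - pseries_shift c k).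
  by move=> k; rewrite E.
apply: (@pseries_coef_unique _ _ _ (fun w => (t - w) * f w)) => w.
  have wr : `|w| < `|w| + 1 by rewrite ltrDl.
  have := pseries_is_derive (@cvg_hermite t (`|w| + 1)) wr.
  rewrite (_ : (fun y => _) = f); last first.
    by apply/funext => y; apply/cvg_lim => //; exact: hermite_pseries.
  move=> /@derive_val.
  have /@derive_val -> := is_derive_gauss_exp t w.
  move=> ->; exact: (converges_within_diffs (@cvg_hermite t _) wr).
have tc := pseriesZ_cvg (a := t) (@hermite_pseries t w).
have sc := pseriesZ_cvg (a := -1) (pseries_shift_cvg (@hermite_pseries t w)).
have := pseriesD_cvg tc sc.
rewrite mulN1r -mulrBl.
by under eq_fun do rewrite mulN1r.
Qed.

Lemma hermite1 t : (H 1).[t] = t.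
Proof.
by have := hermite_rec_fact t 0; rewrite /= divr1 hermite0 divr1 mulr1 subr0.
Qed.

Lemma hermiteSS t k :
  (H k.+2).[t] = t * (H k.+1).[t] - k.+1%:R * (H k).[t].
Proof.
have k1 : k.+1%:R != 0 :> R by rewrite pnatr_eq0.
have kf : k`!%:R != 0 :> R by rewrite pnatr_eq0 -lt0n fact_gt0.
have /(congr1 (fun x => x * k.+1`!%:R)) := hermite_rec_fact t k.+1.
rewrite /= mulfVK; last by rewrite pnatr_eq0 -lt0n fact_gt0.
move=> ->; rewrite factS natrM; field.
by rewrite kf addrC natr1.
Qed.

Lemma hermiteN t k : (H k).[- t] = (- 1) ^+ k * (H k).[t].
Proof.
suff [] : (H k).[- t] = (- 1) ^+ k * (H k).[t] /\
          (H k.+1).[- t] = (- 1) ^+ k.+1 * (H k.+1).[t] by [].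
elim: k => [|k [IH1 IH2]].
  by rewrite !hermite0 !hermite1 expr0 expr1 mul1r mulN1r.
split=> //; rewrite !hermiteSS IH1 IH2 !exprS; ring.
Qed.

Lemma is_derive_hermite (t : R) k :
  is_derive t 1 (fun t : R => (H k).[t]) (k%:R * (H k.-1).[t]).
Proof.
suff [] : is_derive t 1 (fun t : R => (H k).[t]) (k%:R * (H k.-1).[t]) /\
          is_derive t 1 (fun t : R => (H k.+1).[t]) (k.+1%:R * (H k).[t]) by [].
elim: k => [|k [IH1 IH2]].
  split.
    rewrite (_ : (fun t => _) = cst 1) ?mul0r; last first.
      by apply/funext => x; rewrite hermite0.
    exact: is_derive_cst.
  rewrite (_ : (fun t => _) = id) ?hermite0 ?mulr1; last first.
    by apply/funext => x; rewrite hermite1.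
  exact: is_derive_id.
split=> //.
rewrite (_ : (fun t => _) =
  (fun t => t * (H k.+1).[t] - k.+1%:R * (H k).[t])); last first.
  by apply/funext => x; rewrite hermiteSS.
apply: is_derive_eq; rewrite /GRing.scale /=.
case: k {IH1 IH2} => [|k]; first by rewrite hermite0 hermite1; ring.
by rewrite [(H k.+2).[t]]hermiteSS /= -!natr1; ring.
Qed.

End Hermite.

(** * Mehler's formula *)
Section PowerSeriesMore.
Context {R : realType}.
Implicit Types (c : R^nat) (x z r : R).

Lemma converges_within_le c c' r : (forall k, `|c k| <= c' k) ->
  converges_within c' r -> converges_within c r.
Proof.
move=> cc' c'r; apply: bounded_converges_within => q /andP[q0 qr].
have [|M Mc] := @converges_within_bounded _ _ _ c'r q; first by rewrite ltW.
exists M => k; apply: le_trans (Mc k); apply: ler_wpM2r.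
  by apply: exprn_ge0; exact: ltW.
by apply: le_trans (cc' k) _; exact: ler_norm.
Qed.

Lemma eq_pseries_cvg c c' x (l : R) : c =1 c' ->
  pseries c x @ \oo --> l -> pseries c' x @ \oo --> l.
Proof. by move=> /funext ->. Qed.

Lemma converges_withinD c c' r : converges_within c r ->
  converges_within c' r -> converges_within (fun k => c k + c' k) r.
Proof.
by move=> cr c'r z zr; apply: (cvgP _ (pseriesD_cvg (cr _ zr) (c'r _ zr))).
Qed.

Lemma converges_withinZ c r a : converges_within c r ->
  converges_within (fun k => a * c k) r.
Proof. by move=> cr z zr; apply: (cvgP _ (pseriesZ_cvg (cr _ zr))). Qed.

Lemma onem_sqr_gt0 (x : R) : `|x| < 1 -> 0 < 1 - x ^+ 2.
Proof.
move=> x1; rewrite subr_gt0 -real_normK ?num_real// expr_lt1//.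
Qed.

Lemma is_derive_0_itv (f : R -> R) (r : R) :
  (forall y : R, `|y| < 1 -> is_derive y 1 f 0) -> `|r| < 1 -> f r = f 0.
Proof.
move=> f0 r1.
have E : (f \o (fun y => r * sin y)) (pi / 2) = (f \o (fun y => r * sin y)) 0.
  apply: is_derive_0_is_cst => y.
  rewrite -[X in is_derive _ _ _ X](mul0r (r * cos y)).
  apply: is_derive1_comp.
  apply: f0; rewrite normrM; apply: le_lt_trans r1.
  by rewrite ler_piMr// ler_norml sin_geN1 sin_le1.
by move: E => /=; rewrite sin_pihalf sin0 mulr1 mulr0.
Qed.
End PowerSeriesMore.

Section Mehler.
Context {R : realType}.
Variable H : nat -> {poly R}.
Hypothesis hH : hermite_chebycheff H.

(** Cauchy-Schwarz with the weights [1 - q] and [q]. *)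
Lemma sqrB_le_convex (x y q : R) : 0 < q < 1 ->
  (x - y) ^+ 2 <= x ^+ 2 / (1 - q) + y ^+ 2 / q.
Proof.
move=> /andP[q0 q1]; have p0 : 0 < 1 - q by rewrite subr_gt0.
rewrite -subr_ge0.
have -> : x ^+ 2 / (1 - q) + y ^+ 2 / q - (x - y) ^+ 2 =
    (q * x + (1 - q) * y) ^+ 2 / (q * (1 - q)).
  by field; rewrite !gt_eqF.
by rewrite divr_ge0 ?sqr_ge0// mulr_ge0// ltW.
Qed.

(** The weight of the last term is [1 / q], just small enough for a geometric
    bound of ratio [1 / q]. *)
Lemma hermite_sq_rec t q k : 0 < q < 1 ->
  (H k.+2).[t] ^+ 2 / k.+2`!%:R <=
  t ^+ 2 / (1 - q) / k.+2%:R * ((H k.+1).[t] ^+ 2 / k.+1`!%:R)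
  + q^-1 * ((H k).[t] ^+ 2 / k`!%:R).
Proof.
move=> q01; have /andP[q0 q1] := q01.
rewrite hermiteSS//; apply: le_trans.
  by apply: ler_wpM2r; [rewrite invr_ge0|exact: sqrB_le_convex q01].
rewrite mulrDl lerD//.
  rewrite le_eqVlt; apply/orP; left; apply/eqP.
  rewrite factS natrM invfM exprMn; ring.
have -> : (k.+1%:R * (H k).[t]) ^+ 2 / q / k.+2`!%:R =
   (k.+1%:R / k.+2%:R) * (q^-1 * ((H k).[t] ^+ 2 / k`!%:R)).
  rewrite !factS !natrM !invfM exprMn.
  have k1 : k.+1%:R != 0 :> R by rewrite pnatr_eq0.
  have k2 : k.+2%:R != 0 :> R by rewrite pnatr_eq0.
  have kf : k`!%:R != 0 :> R by rewrite pnatr_eq0 -lt0n fact_gt0.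
  have qn : q != 0 by rewrite gt_eqF.
  move: (k.+1%:R) (k.+2%:R) k1 k2 => a b a0 b0.
  by field; rewrite ?a0 ?b0 ?kf ?qn.
rewrite ler_piMl//.
  by rewrite mulr_ge0 ?divr_ge0 ?sqr_ge0// invr_ge0 ltW.
by rewrite ler_pdivrMr// mul1r ler_nat.
Qed.

(** For large [k] the recurrence bounds a weighted term by a convex combination
    of the two previous ones, so that the maximum of the first terms is a bound. *)
Lemma hermite_sq_bounded t q : 0 < q < 1 ->
  exists M, forall k, (H k).[t] ^+ 2 / k`!%:R * q ^+ k <= M.
Proof.
move=> q01; have /andP[q0 q1] := q01; have p0 : 0 < 1 - q by rewrite subr_gt0.
pose w k := (H k).[t] ^+ 2 / k`!%:R * q ^+ k.
have w0 k : 0 <= w k by rewrite mulr_ge0 ?divr_ge0 ?sqr_ge0// exprn_ge0// ltW.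
have [N tN] : exists N : nat, t ^+ 2 / (1 - q) ^+ 2 <= N%:R.
  exists (Num.bound (t ^+ 2 / (1 - q) ^+ 2)); apply: ltW; apply: archi_boundP.
  by rewrite divr_ge0 ?sqr_ge0.
pose M := \sum_(j < N.+2) w j.
have wM k : (k < N.+2)%N -> w k <= M.
  move=> kN; rewrite /M (bigD1 (Ordinal kN))//= lerDl sumr_ge0//.
have rec k : w k.+2 <= q * (t ^+ 2 / (1 - q) / k.+2%:R) * w k.+1 + q * w k.
  rewrite /w; apply: le_trans.
    by apply: ler_wpM2r (hermite_sq_rec t k q01); rewrite exprn_ge0// ltW.
  rewrite le_eqVlt; apply/orP; left; apply/eqP.
  rewrite mulrDl; congr (_ + _); first by rewrite [q ^+ k.+2]exprS; ring.
  rewrite [q ^+ k.+2]exprS [q ^+ k.+1]exprS.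
  have kf : k`!%:R != 0 :> R by rewrite pnatr_eq0 -lt0n fact_gt0.
  have qn : q != 0 by rewrite gt_eqF.
  by field; rewrite ?kf ?qn.
exists M => k; rewrite -/(w k).
suff [] : w k <= M /\ w k.+1 <= M by [].
elim: k => [|k [IH1 IH2]]; first by split; exact: wM.
split=> //; have [kN|Nk] := ltnP k N; first exact: wM.
apply: le_trans (rec k) _.
have -> : M = (1 - q) * M + q * M by ring.
rewrite lerD//; last by rewrite ler_wpM2l// ltW.
apply: ler_pM => //.
  apply: mulr_ge0; first exact: ltW.
  by do 2 apply: divr_ge0 => //; [exact: sqr_ge0|exact: ltW].
rewrite mulrA ler_pdivrMr// mulrA ler_pdivrMr//.
apply: (@le_trans _ _ (t ^+ 2)).
  by rewrite ler_piMl ?sqr_ge0// ltW.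
move: tN; rewrite ler_pdivrMr ?exprn_gt0// => /le_trans; apply.
rewrite mulrAC -expr2 mulrC; apply: ler_wpM2l; first exact: sqr_ge0.
by rewrite ler_nat; do 2 apply: leqW.
Qed.

Lemma hermite_sq_converges t :
  converges_within (fun k => (H k).[t] ^+ 2 / k`!%:R) 1.
Proof.
apply: bounded_converges_within => q q01.
have [M HM] := hermite_sq_bounded t q01; exists M => k.
by rewrite ger0_norm// divr_ge0// sqr_ge0.
Qed.

Lemma normM_le_sqr (a b : R) : `|a * b| <= 2^-1 * (a ^+ 2 + b ^+ 2).
Proof.
rewrite normrM -[a ^+ 2]real_normK ?num_real// -[b ^+ 2]real_normK ?num_real//.
have := sqr_ge0 (`|a| - `|b|); rewrite sqrrB; move: (`|a|) (`|b|) => x y; lra.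
Qed.

Lemma hermite_mul_converges t s :
  converges_within (fun k => (H k).[t] * (H k).[s] / k`!%:R) 1.
Proof.
apply: (@converges_within_le _ _ (fun k => 2^-1 *
   ((H k).[t] ^+ 2 / k`!%:R + (H k).[s] ^+ 2 / k`!%:R))).
  move=> k; rewrite normrM normfV normr_nat -mulrDl mulrA.
  by apply: ler_wpM2r => //; exact: normM_le_sqr.
by apply: converges_withinZ; apply: converges_withinD;
  exact: hermite_sq_converges.
Qed.

Lemma hermite_mulS_converges t s :
  converges_within (fun k => (H k).[t] * (H k.+1).[s] / k`!%:R) 1.
Proof.
apply: (@converges_within_le _ _ (fun k => 2^-1 * ((H k).[t] ^+ 2 / k`!%:R +
   pseries_diffs (fun k => (H k).[s] ^+ 2 / k`!%:R) k))).
  move=> k; rewrite normrM normfV normr_nat.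
  have -> : pseries_diffs (fun k => (H k).[s] ^+ 2 / k`!%:R) k =
     (H k.+1).[s] ^+ 2 / k`!%:R.
    rewrite /pseries_diffs factS natrM invfM mulrCA; congr (_ * _).
    by rewrite mulrA mulfV ?mul1r// pnatr_eq0.
  rewrite -mulrDl mulrA; apply: ler_wpM2r => //.
  exact: normM_le_sqr.
apply: converges_withinZ; apply: converges_withinD.
  exact: hermite_sq_converges.
by apply: converges_within_diffs; exact: hermite_sq_converges.
Qed.

Variables t s : R.
Let c k := (H k).[t] * (H k).[s] / k`!%:R.
Let e k := (H k).[t] * (H k.+1).[s] / k`!%:R.
Let A x := limn (pseries c x).
Let C x := limn (pseries e x).

(** With [A] the sum of [H_k(t) H_k(s) x ^ k / k!] and [C] the sum of
    [H_k(t) H_{k+1}(s) x ^ k / k!], the recurrence gives the linear relations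
    [E1] and [E2] between [A], its derivative and [C]; eliminating [C] leaves a
    differential equation of the first order for [A]. *)
Let mehler_ode x : `|x| < 1 ->
  (1 - x ^+ 2) * limn (pseries (pseries_diffs c) x) =
  ((t - x * s) * (s - x * t) / (1 - x ^+ 2) + x) * A x.
Proof.
move=> x1.
have cA : pseries c x @ \oo --> A x by exact: hermite_mul_converges.
have eC : pseries e x @ \oo --> C x by exact: hermite_mulS_converges.
have dA : pseries (pseries_diffs c) x @ \oo --> limn (pseries (pseries_diffs c) x).
  by apply: converges_within_diffs x1; exact: hermite_mul_converges.
move: dA; set A' := limn (pseries (pseries_diffs c) x) => dA.
(* [pB], [eC'], [D] and [dA'] are series whose coefficients agree with those of
   [C] and of the derivative of [A] by the recurrence *)
have pB := pseriesD_cvg (pseriesZ_cvg (a := t) cA)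
                        (pseriesZ_cvg (a := -1) (pseries_shift_cvg eC)).
have eC' := pseriesD_cvg (pseriesZ_cvg (a := s) cA)
                        (pseriesZ_cvg (a := -1) (pseries_shift_cvg pB)).
have D := pseriesD_cvg (pseriesD_cvg (pseriesZ_cvg (a := s) eC)
             (pseriesZ_cvg (a := -1) cA))
             (pseriesZ_cvg (a := -1) (pseries_shift_cvg dA)).
have dA' := pseriesD_cvg (pseriesZ_cvg (a := t) eC)
                        (pseriesZ_cvg (a := -1) (pseries_shift_cvg D)).
have kf k : k`!%:R != 0 :> R by rewrite pnatr_eq0 -lt0n fact_gt0.
have k1 k : k.+1%:R != 0 :> R by rewrite pnatr_eq0.
have E1 : C x = s * A x - x * (t * A x - x * C x).
  rewrite -[X in s * A x - x * X](_ : t * A x + -1 * (x * C x) = _); last by ring.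
  rewrite -[RHS](_ : s * A x + -1 * (x * (t * A x + -1 * (x * C x))) = _); last by ring.
  suff eE : (fun k => s * c k + -1 * pseries_shift
      (fun k => t * c k + -1 * pseries_shift e k) k) =1 e.
    exact: cvg_unique _ eC (eq_pseries_cvg eE eC').
  move=> -[|k]; rewrite /e /c /=.
    by rewrite !hermite0// hermite1//; ring.
  case: k => [|k].
    by rewrite /= !hermiteSS// !hermite1// !hermite0// !factS fact0; field.
  rewrite /= [(H k.+3).[s]]hermiteSS// [(H k.+2).[t]]hermiteSS// !factS !natrM.
  move: (k.+1%:R) (k.+2%:R) (k`!%:R) (k1 k) (k1 k.+1) (kf k).
  by move=> a b f a0 b0 f0; field; rewrite ?a0 ?b0 ?f0.
have E2 : A' = t * C x - x * (s * C x - A x - x * A').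
  rewrite -[RHS](_ : t * C x + -1 * (x * (s * C x + -1 * A x + -1 * (x * A'))) = _); last by ring.
  suff eE : (fun k => t * e k + -1 * pseries_shift (fun k =>
      s * e k + -1 * c k + -1 * pseries_shift (pseries_diffs c) k) k)
      =1 pseries_diffs c.
    exact: cvg_unique _ dA (eq_pseries_cvg eE dA').
  move=> -[|k]; rewrite /e /c /pseries_diffs /=.
    by rewrite hermite0// !hermite1//; field.
  case: k => [|k].
    by rewrite /= !hermiteSS// !hermite1// !hermite0// !factS fact0; field.
  rewrite /= [(H k.+3).[s]]hermiteSS// [(H k.+3).[t]]hermiteSS//.
  rewrite [(H k.+2).[t]]hermiteSS// [(H k.+2).[s]]hermiteSS// !factS !natrM.
  have := kf k; have := k1 k; have := k1 k.+1; have := k1 k.+2.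
  rewrite -(natr1 k.+2) -(natr1 k.+1); move: (k.+1%:R) (k`!%:R) => a f.
  by move=> a2 a1 a0 f0; field; rewrite ?[1 + _]addrC ?a0 ?f0 ?a1 ?a2.
have x2 : 1 - x ^+ 2 != 0.
  by rewrite gt_eqF// onem_sqr_gt0.
have E1' : (1 - x ^+ 2) * C x = (s - x * t) * A x by move: E1; lra.
have E1'' : C x = (s - x * t) * A x / (1 - x ^+ 2).
  by rewrite -E1' mulrAC mulfV ?mul1r.
have E2' : (1 - x ^+ 2) * A' = (t - x * s) * C x + x * A x by move: E2; lra.
by rewrite E2' E1''; field.
Qed.

Definition mehler_kernel (x : R) :=
  (Num.sqrt (1 - x ^+ 2))^-1 *
  expR ((t * s * x - (t ^+ 2 + s ^+ 2) / 2 * x ^+ 2) * (1 - x ^+ 2)^-1).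

Let psi x := (t * s * x - (t ^+ 2 + s ^+ 2) / 2 * x ^+ 2) * (1 - x ^+ 2)^-1.

Let is_derive_psi (x : R) : `|x| < 1 ->
  is_derive x 1 psi ((t - x * s) * (s - x * t) / (1 - x ^+ 2) ^+ 2).
Proof.
move=> x1; have x2 : 1 - x ^+ 2 != 0 by rewrite gt_eqF// onem_sqr_gt0.
have dV : is_derive x 1 (fun x : R => (1 - x ^+ 2)^-1)
    (- (1 - x ^+ 2) ^- 2 *: (0 - (x *: 1 + x *: 1))).
  by apply: is_deriveV => //; apply: is_derive_eq; rewrite /GRing.scale/=; ring.
by rewrite /psi; apply: is_derive_eq; rewrite /GRing.scale /=; field.
Qed.

(** Both sides solve the same linear differential equation, hence their quotient
    is constant, with value 1 at the origin. *)
Lemma mehler x : `|x| < 1 ->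
  pseries (fun k => (H k).[t] * (H k).[s] / k`!%:R) x @ \oo --> mehler_kernel x.
Proof.
move=> x1; have -> : mehler_kernel x = A x; last exact: hermite_mul_converges.
pose K y := A y * (Num.sqrt (1 - y ^+ 2) * expR (- psi y)).
have K1 : K x = K 0.
  apply: is_derive_0_itv x1 => y y1.
  have w0 := onem_sqr_gt0 y1.
  have S0 : Num.sqrt (1 - y ^+ 2) != 0 by rewrite gt_eqF// sqrtr_gt0.
  have SS : Num.sqrt (1 - y ^+ 2) ^+ 2 = 1 - y ^+ 2 by rewrite sqr_sqrtr// ltW.
  have dA := pseries_is_derive (@hermite_mul_converges t s) y1.
  have dS : is_derive y 1 (fun y : R => Num.sqrt (1 - y ^+ 2))
     ((2 * Num.sqrt (1 - y ^+ 2))^-1 * (- (y + y))).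
    apply: (@is_derive1_comp _ Num.sqrt (fun y : R => 1 - y ^+ 2)).
      exact: is_derive1_sqrt.
    by apply: is_derive_eq; rewrite /GRing.scale/=; ring.
  have dpsi := is_derive_psi y1.
  rewrite /K; apply: is_derive_eq; rewrite /GRing.scale /=.
  have ode : limn (pseries (pseries_diffs c) y) =
     ((t - y * s) * (s - y * t) / (1 - y ^+ 2) + y) * A y / (1 - y ^+ 2).
    by rewrite -(mehler_ode y1) mulrAC mulfV ?mul1r// gt_eqF.
  rewrite -/(A y) ode; move: (A y) (expR (- psi y)) => a b.
  move: SS S0; move: (Num.sqrt (1 - y ^+ 2)) => u.
  move: (1 - y ^+ 2) => w <- u0.
  by field.
have K0 : K 0 = 1.
  rewrite /K /psi expr0n/= !(mulr0, subr0, mul0r, oppr0) expR0 sqrtr1 !mulr1.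
  rewrite  /A; apply/cvg_lim => //.
  rewrite -(cvg_shiftS (pseries c 0)).
  have -> : (fun n => pseries c 0 n.+1) = cst (1 : R).
    apply/funext => n; rewrite /pseries /series /= big_nat_recl//= expr0 mulr1.
    rewrite /c !hermite0// fact0 divr1 mulr1 big1 ?addr0// => i _.
    by rewrite expr0n/= mulr0.
  exact: cvg_cst.
rewrite /mehler_kernel -/(psi x); move: K1; rewrite K0 /K expRN => K1.
rewrite -[LHS]mulr1 -[X in _ * X = _]K1 mulrCA.
have : Num.sqrt (1 - x ^+ 2) != 0 by rewrite gt_eqF// sqrtr_gt0 onem_sqr_gt0.
have : expR (psi x) != 0 by rewrite gt_eqF// expR_gt0.
by move: (Num.sqrt _) (expR _) => u v u0 v0; field; rewrite ?u0 ?v0.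
Qed.

End Mehler.

(** * Measurability of limits and real-valued integrals *)
Section MeasurableLimit.
Local Open Scope ereal_scope.
Context {d : measure_display} {T : measurableType d} {R : realType}.
Implicit Types (f : (T -> R)^nat) (u : R^nat).

(** Convergence in the reals, expressed by limits that always exist. *)
Lemma cvgn_esup_einf u :
  cvgn u <-> limn_esup (EFin \o u) = limn_einf (EFin \o u) /\
             limn_esup (EFin \o u) \is a fin_num.
Proof.
split=> [cu|[es fs]].
  have cE : EFin \o u @ \oo --> (limn u)%:E by apply/fine_cvgP; split=> //; near=> n.
  by have [-> ->] := cvg_limn_einf_sup cE.
have eE : EFin \o u @ \oo --> limn_esup (EFin \o u).
  apply: (@squeeze_cvge _ _ _ _ (einfs (EFin \o u)) _ (esups (EFin \o u))).
  - apply: nearW => n; apply/andP; split.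
      by apply: ereal_inf_lbound; exists n => //=.
    by apply: ereal_sup_ubound; exists n => //=.
  - by rewrite es limn_einf_lim; exact: is_cvg_einfs.
  - by rewrite limn_esup_lim; exact: is_cvg_esups.
apply/cvg_ex; exists (fine (limn_esup (EFin \o u))).
by move: eE; rewrite -{1}(fineK fs) => /fine_cvgP[].
Unshelve. all: by end_near. Qed.

Lemma measurable_limn_einf (h : (T -> \bar R)^nat) :
  (forall n, measurable_fun setT (h n)) ->
  measurable_fun setT (fun x => limn_einf (h ^~ x)).
Proof.
move=> mh; rewrite (_ : (fun x => _) = fun x => - limn_esup (fun n => (-%E \o h n) x)).
  apply: measurableT_comp => //; apply: measurable_fun_limn_esup => n.
  by have := @measurable_funeM _ _ _ setT _ (-1) (mh n); under eq_fun do rewrite mulN1e.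
apply/funext => x; rewrite -[RHS]/(- limn_esup (-%E \o (h ^~ x))).
by rewrite limn_esupN oppeK.
Qed.

Lemma measurable_cvgn f : (forall n, measurable_fun setT (f n)) ->
  measurable [set x | cvgn (f ^~ x)].
Proof.
move=> mf.
have mE n : measurable_fun setT (EFin \o f n) by apply/measurable_EFinP.
pose s x := limn_esup (fun n => (EFin \o f n) x).
pose i x := limn_einf (fun n => (EFin \o f n) x).
have ms : measurable_fun setT s by exact: measurable_fun_limn_esup.
have mi : measurable_fun setT i by exact: measurable_limn_einf.
have -> : [set x | cvgn (f ^~ x)] =
    [set x | s x = i x] `&` (s @^-1` [set y | y \is a fin_num]).
  by apply/seteqP; split => x /=; rewrite -/(s x);
    have := cvgn_esup_einf (f ^~ x) => -[h1 h2] h; [exact: h1|exact: h2].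
apply: measurableI.
  by rewrite -[X in measurable X]setTI; exact: emeasurable_fun_eq.
rewrite -[X in measurable X]setTI; exact: emeasurable_fin_num.
Qed.

(** Where the sequence diverges, the limit is a fixed default point. *)
Lemma measurable_fun_limn f : (forall n, measurable_fun setT (f n)) ->
  measurable_fun setT (fun x => limn (f ^~ x)).
Proof.
move=> mf; have mD := measurable_cvgn mf.
set D := [set x | _] in mD.
rewrite -(setUv D); apply/measurable_funU => //; first exact: measurableC.
split.
  apply: (@measurable_fun_cvg _ _ _ _ f) => [m|x Dx].
    exact: measurable_funS (mf m).
  exact: Dx.
apply: (eq_measurable_fun (cst (point : R))) => //.
move=> x; rewrite inE => /= nD; apply/esym.
by rewrite dvgP.
Qed.

End MeasurableLimit.

Section RealIntegral.
Context {d : measure_display} {T : measurableType d} {R : realType}.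
Variable mu : {measure set T -> \bar R}.
Implicit Types (f g h : T -> R).
Local Open Scope ring_scope.

Lemma le_integrableR f g : measurable_fun setT f -> (forall x, `|f x| <= g x) ->
  mu.-integrable setT (EFin \o g) -> mu.-integrable setT (EFin \o f).
Proof.
move=> mf fg; apply: le_integrable => //; first exact/measurable_EFinP.
move=> x _ /=; rewrite lee_fin; apply: le_trans (fg x) _; exact: ler_norm.
Qed.

Lemma integrable_boundedM (C : R) f g : measurable_fun setT g -> (forall x, `|g x| <= C) ->
  mu.-integrable setT (EFin \o f) -> mu.-integrable setT (EFin \o (fun x => g x * f x)).
Proof.
move=> mg gC iF; apply: (@le_integrableR _ (fun x => C * `|f x|)).
- apply: measurable_funM => //; apply/measurable_EFinP; exact: measurable_int iF.
- by move=> x; rewrite normrM ler_wpM2r.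
- have := integrableZl measurableT C (integrable_abse iF).
  by apply: eq_integrable => // x _ /=.
Qed.

Lemma integrableRD f g : mu.-integrable setT (EFin \o f) ->
  mu.-integrable setT (EFin \o g) -> mu.-integrable setT (EFin \o (fun x => f x + g x)).
Proof.
move=> iF ig; have := integrableD measurableT iF ig.
by apply: eq_integrable => // x _ /=; rewrite EFinD.
Qed.

Lemma integrableRZ (c : R) f : mu.-integrable setT (EFin \o f) ->
  mu.-integrable setT (EFin \o (fun x => c * f x)).
Proof.
move=> iF; have := integrableZl measurableT c iF.
by apply: eq_integrable => // x _ /=; rewrite EFinM.
Qed.

Lemma integrableRB f g : mu.-integrable setT (EFin \o f) ->
  mu.-integrable setT (EFin \o g) -> mu.-integrable setT (EFin \o (fun x => f x - g x)).
Proof.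
move=> iF ig; have := integrableB measurableT iF ig.
by apply: eq_integrable => // x _ /=; rewrite EFinB.
Qed.

Lemma integrableR_sum (F : nat -> T -> R) n :
  (forall k, mu.-integrable setT (EFin \o F k)) ->
  mu.-integrable setT (EFin \o (fun x => \sum_(k < n) F k x)).
Proof.
move=> iF; elim: n => [|n IH].
  apply: eq_integrable (integrable0 _ _) => // x _ /=; by rewrite big_ord0.
have := integrableRD IH (iF n); apply: eq_integrable => // x _ /=.
by rewrite big_ord_recr.
Qed.

Lemma Rintegral_sum (F : nat -> T -> R) n :
  (forall k, mu.-integrable setT (EFin \o F k)) ->
  \int[mu]_x (\sum_(k < n) F k x) = \sum_(k < n) \int[mu]_x (F k x).
Proof.
move=> iF; elim: n => [|n IH].
  rewrite big_ord0; under eq_Rintegral do rewrite big_ord0.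
  by rewrite /Rintegral integral0.
rewrite big_ord_recr/= -IH -RintegralD//; last exact: integrableR_sum.
by apply: eq_Rintegral => x _; rewrite big_ord_recr.
Qed.

Lemma EFin_Rintegral f : mu.-integrable setT (EFin \o f) ->
  (\int[mu]_x (f x)%:E)%E = (\int[mu]_x f x)%:E.
Proof. by move=> iF; rewrite /Rintegral fineK// integrable_fin_num. Qed.

Lemma dominated_Rintegral (f_ : (T -> R)^nat) f g :
  (forall n, measurable_fun setT (f_ n)) -> measurable_fun setT f ->
  {ae mu, forall x, f_ ^~ x @ \oo --> f x} ->
  mu.-integrable setT (EFin \o g) ->
  {ae mu, forall x, forall n, `|f_ n x| <= g x} ->
  mu.-integrable setT (EFin \o f) /\
  (fun n => \int[mu]_x f_ n x) @ \oo --> \int[mu]_x f x.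
Proof.
move=> mf_ mf cf ig fg.
have [] := @dominated_convergence _ _ _ mu setT measurableT
  (fun n => EFin \o f_ n) (EFin \o f) (EFin \o g).
- by move=> n; exact/measurable_EFinP.
- exact/measurable_EFinP.
- by apply: filterS cf => x cx _; apply: cvg_EFin => //; exact: nearW.
- exact: ig.
- by apply: filterS fg => x cx n _ /=; rewrite lee_fin.
move=> iF _ cI; split=> //.
move: cI; rewrite EFin_Rintegral// => /fine_cvgP[_]; apply: cvg_trans.
by apply: near_eq_cvg; apply: nearW => n.
Qed.

(** Fatou's lemma for real functions, with a bound uniform in [n]. *)
Lemma fatou_le (f_ : (T -> R)^nat) f (b : \bar R) :
  (forall n, measurable_fun setT (f_ n)) -> measurable_fun setT f ->
  (forall n x, 0 <= f_ n x) -> {ae mu, forall x, f_ ^~ x @ \oo --> f x} ->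
  (forall n, (\int[mu]_x (f_ n x)%:E <= b)%E) -> (\int[mu]_x (f x)%:E <= b)%E.
Proof.
move=> mf_ mf f0 cf fb.
have mE n : measurable_fun setT (EFin \o f_ n) by exact/measurable_EFinP.
have -> : (\int[mu]_x (f x)%:E = \int[mu]_x limn_einf (fun n => (EFin \o f_ n) x))%E.
  apply: ae_eq_integral => //; first exact/measurable_EFinP.
    exact: measurable_limn_einf.
  apply: filterS cf => x cx _.
  have cE : (fun n => (EFin \o f_ n) x) @ \oo --> (f x)%:E.
    by apply: cvg_EFin => //; exact: nearW.
  by have [-> _] := cvg_limn_einf_sup cE.
apply: le_trans (fatou _ _ mE _) _ => // [n x _|]; first by rewrite lee_fin.
rewrite limn_einf_lim; apply: lime_le; first exact: is_cvg_einfs.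
apply: nearW => n; apply: le_trans (fb n).
by apply: ereal_inf_lbound; exists n => //=.
Qed.

Lemma ae_eq_Rintegral f g : measurable_fun setT f -> measurable_fun setT g ->
  {ae mu, forall x, f x = g x} -> \int[mu]_x f x = \int[mu]_x g x.
Proof.
move=> mf mg fg; rewrite /Rintegral; congr fine; apply: ae_eq_integral => //.
- exact/measurable_EFinP.
- exact/measurable_EFinP.
- by apply: filterS fg => x /= -> _.
Qed.

Lemma ae_eq_integrable f g : measurable_fun setT f -> measurable_fun setT g ->
  {ae mu, forall x, f x = g x} ->
  mu.-integrable setT (EFin \o f) -> mu.-integrable setT (EFin \o g).
Proof.
move=> mf mg fg /integrableP[_ iF]; apply/integrableP; split.
  exact/measurable_EFinP.
suff <- : (\int[mu]_x `|(f x)%:E| = \int[mu]_x `|(g x)%:E|)%E by [].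
apply: ae_eq_integral => //.
- by apply: measurableT_comp => //; exact/measurable_EFinP.
- by apply: measurableT_comp => //; exact/measurable_EFinP.
- by apply: filterS fg => x /= -> _.
Qed.

End RealIntegral.

Section ParametricIntegral.
Local Open Scope ereal_scope.
Context {d1 d2 : measure_display} {T1 : measurableType d1}
  {T2 : measurableType d2} {R : realType}.
Variable m : {sigma_finite_measure set T2 -> \bar R}.

Lemma measurable_Rintegral (f : T1 * T2 -> R) : measurable_fun setT f ->
  measurable_fun setT (fun x => (\int[m]_y f (x, y))%R).
Proof.
move=> mf; apply: measurableT_comp => //.
have mE : measurable_fun setT (EFin \o f) by exact/measurable_EFinP.
under eq_fun do rewrite integralE.
apply: emeasurable_funB.
- have mp : measurable_fun setT (EFin \o f)^\+ by exact: measurable_funepos.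
  have := @measurable_fun_fubini_tonelli_F _ _ _ _ _ m _ mp.
  move=> /(_ (fun x => funepos_ge0 _ x)) h; apply: eq_measurable_fun h => x _.
  by rewrite /fubini_F; apply: eq_integral => y _; rewrite unlock.
- have mp : measurable_fun setT (EFin \o f)^\- by exact: measurable_funeneg.
  have := @measurable_fun_fubini_tonelli_F _ _ _ _ _ m _ mp.
  move=> /(_ (fun x => funeneg_ge0 _ x)) h; apply: eq_measurable_fun h => x _.
  by rewrite /fubini_F; apply: eq_integral => y _; rewrite unlock.
Qed.

End ParametricIntegral.

(** * Gaussian integrals and Fourier transforms of Hermite functions *)
Section Gauss.
Context {R : realType}.
Notation mu := (@lebesgue_measure R).

Definition std_gauss (t : R) : R :=
  (Num.sqrt (2 * pi))^-1 * expR (- (t ^+ 2 / 2)).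

Lemma normal_pdf0E (a x : R) : 0 < a ->
  normal_pdf 0 (Num.sqrt (2 * a))^-1 x =
  (Num.sqrt (pi / a))^-1 * expR (- (a * x ^+ 2)).
Proof.
move=> a0; have s0 : 0 < Num.sqrt (2 * a) by rewrite sqrtr_gt0 mulr_gt0.
rewrite normal_pdfE; last by rewrite gt_eqF// invr_gt0.
have E : (Num.sqrt (2 * a))^-1 ^+ 2 = (2 * a)^-1.
  by rewrite exprVn sqr_sqrtr// mulr_ge0// ltW.
rewrite /normal_peak /normal_fun E subr0.
have an : a != 0 by rewrite gt_eqF.
congr ((Num.sqrt _)^-1 * expR _); first by rewrite -mulr_natr; field.
by rewrite -mulr_natr; field.
Qed.

Lemma integrable_expRN_sqr (a : R) : 0 < a ->
  mu.-integrable setT (EFin \o (fun x : R => expR (- (a * x ^+ 2)))).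
Proof.
move=> a0; have := integrableRZ (Num.sqrt (pi / a))
  (integrable_normal_pdf 0 (Num.sqrt (2 * a))^-1).
apply: eq_integrable => // x _ /=.
rewrite normal_pdf0E// mulrA mulfV ?mul1r// gt_eqF// sqrtr_gt0 divr_gt0//.
exact: pi_gt0.
Qed.

(** The integrand is a multiple of the density of a centered normal law. *)
Lemma integral_expRN_sqr (a : R) : 0 < a ->
  (\int[mu]_x (expR (- (a * x ^+ 2)))%:E = (Num.sqrt (pi / a))%:E)%E.
Proof.
move=> a0; have P0 : 0 < Num.sqrt (pi / a).
  by rewrite sqrtr_gt0 divr_gt0// pi_gt0.
rewrite -[RHS]mule1 -(integral_normal_pdf 0 (Num.sqrt (2 * a))^-1).
rewrite -integralZl//; last exact: integrable_normal_pdf.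
apply: eq_integral => x _; rewrite -EFinM normal_pdf0E// mulVKf//.
by rewrite gt_eqF.
Qed.

Lemma normal_pdf01E (x : R) : normal_pdf 0 1 x = std_gauss x.
Proof.
have := @normal_pdf0E (2^-1) x; rewrite mulfV ?pnatr_eq0// sqrtr1 invr1 => ->//.
by rewrite /std_gauss invrK [pi * 2]mulrC [_^-1 * x ^+ 2]mulrC.
Qed.

Lemma continuous_measurable_funT (f : R -> R) : continuous f -> measurable_fun setT f.
Proof. by move=> cf; apply: continuous_measurable_fun. Qed.

Lemma is_derive_continuous (f df : R -> R) :
  (forall x : R, is_derive x 1 f (df x)) -> continuous f.
Proof.
move=> fd x; apply: differentiable_continuous; apply/derivable1_diffP.
by have [] := fd x.
Qed.

(** The fundamental theorem of calculus on [[- n, n]], and dominated convergence. *)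
Lemma Rintegral_derive_eq0 (F f : R -> R) :
  (forall x : R, is_derive x 1 F (f x)) -> continuous f ->
  mu.-integrable setT (EFin \o f) ->
  (fun n : nat => F n%:R) @ \oo --> (0 : R) ->
  (fun n : nat => F (- n%:R)) @ \oo --> (0 : R) ->
  \int[mu]_x f x = 0.
Proof.
move=> dF cf iF Fy FNy.
have cF := is_derive_continuous dF.
have mf := continuous_measurable_funT cf.
pose f_ (n : nat) (x : R) := (f \_ `[- n%:R, n%:R]%classic) x.
have mf_ n : measurable_fun setT (f_ n).
  by apply/measurable_restrict => //; apply: measurable_funS mf.
have [_ cI] : mu.-integrable setT (EFin \o f) /\
    (fun n => \int[mu]_x f_ n x) @ \oo --> \int[mu]_x f x.
  apply: (@dominated_Rintegral _ _ _ mu f_ f (fun x => `|f x|)) => //.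
  - apply/aeW => x; apply: cvg_near_cst.
    exists (Num.bound `|x|) => // n /= xn; rewrite /f_ patchE ifT//.
    rewrite inE /= in_itv /= -ler_norml; apply: ltW.
    apply: lt_le_trans (archi_boundP _) _ => //; by rewrite ler_nat.
  - by have := integrable_abse iF; apply: eq_integrable => // x _ /=.
  - apply/aeW => x n; rewrite /f_ patchE; case: ifP => // _.
    by rewrite normr0.
suff : (fun n => \int[mu]_x f_ n x) @ \oo --> (0 : R).
  by move=> /(cvg_unique _ cI) ->.
rewrite -(subrr (0 : R)); apply: cvg_trans (cvgB Fy FNy).
apply: near_eq_cvg; near=> n.
have n0 : (- n%:R : R) < n%:R.
  by rewrite gtrN// ltr0n; near: n; exact: nbhs_infty_gt.
rewrite /f_ -Rintegral_mkcond /Rintegral.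
rewrite (@continuous_FTC2 _ f F)//=.
- exact: continuous_subspaceT.
- split.
  + by move=> x _; have [] := dF x.
  + by apply: cvg_at_right_filter; exact: cF.
  + by apply: cvg_at_left_filter; exact: cF.
- by move=> x _; rewrite derive1E; have [_] := dF x.
Unshelve. all: by end_near. Qed.

(** A Gaussian bound on the primitive makes the boundary terms vanish. *)
Lemma Rintegral_derive_gauss_eq0 (F f : R -> R) (C a : R) : 0 < a ->
  (forall x : R, is_derive x 1 F (f x)) -> continuous f ->
  mu.-integrable setT (EFin \o f) ->
  (forall x, `|F x| <= C * expR (- (a * x ^+ 2))) ->
  \int[mu]_x f x = 0.
Proof.
move=> a0 dF cf iF FC; have C0 : 0 <= C.
  by have := le_trans (normr_ge0 _) (FC 0); rewrite pmulr_lge0 ?expR_gt0.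
have lim (u : nat -> R) : (forall n, `|u n| = n%:R) ->
    (fun n => F (u n)) @ \oo --> (0 : R).
  move=> un; apply/norm_cvg0P.
  apply: (@squeeze_cvgr _ _ _ _ (cst 0) (fun n => C * (1 + a^-1) * (n%:R + 1)^-1)).
  - apply: nearW => n /=; rewrite normr_ge0 /=; apply: le_trans (FC _) _.
    rewrite -mulrA; apply: ler_wpM2l => //.
    rewrite -[u n ^+ 2]real_normK ?num_real// un ler_pdivlMr ?ltr_wpDl//.
    rewrite expRN mulrC ler_pdivrMr ?expR_gt0//.
    apply: (@le_trans _ _ ((1 + a^-1) * (1 + a * n%:R ^+ 2))); last first.
      by apply: ler_wpM2l; [rewrite addr_ge0// invr_ge0 ltW|exact: expR_ge1Dx].
    have -> : (1 + a^-1) * (1 + a * n%:R ^+ 2) =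
        1 + n%:R ^+ 2 + (a^-1 + a * n%:R ^+ 2) by field; rewrite gt_eqF.
    rewrite -[leLHS]addr0; apply: lerD; last first.
      by rewrite addr_ge0 ?invr_ge0 ?mulr_ge0 ?sqr_ge0// ltW.
    rewrite addrC lerD2l; case: n => [|n]; first by rewrite expr0n.
    by rewrite expr2 ler_peMl// ler1n.
  - exact: cvg_cst.
  - rewrite -[X in _ --> X](mulr0 (C * (1 + a^-1))); apply: cvgMr.
    have := @cvg_harmonic R.
    by apply: cvg_trans; apply: near_eq_cvg; apply: nearW => n /=; rewrite natr1.
apply: (Rintegral_derive_eq0 dF cf iF); apply: lim => n.
  by rewrite normr_nat.
by rewrite normrN normr_nat.
Qed.

Lemma ge0_integral_oppr (g : R -> \bar R) :
  measurable_fun setT g -> (forall x, 0 <= g x)%E ->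
  (\int[mu]_x g (- x)%R = \int[mu]_x g x)%E.
Proof.
move=> mg g0.
transitivity (\int[pushforward mu (-%R : R -> measurableTypeR R)]_x g x)%E.
  by rewrite ge0_integral_pushforward.
by apply: eq_measure_integral => A mA _; exact: lebesgue_measureN.
Qed.

Lemma Rintegral_oppr (f : R -> R) : measurable_fun setT f ->
  (\int[mu]_x f (- x) = \int[mu]_x f x)%R.
Proof.
move=> mf; rewrite /Rintegral; congr fine.
have mE : measurable_fun setT (EFin \o f) by exact/measurable_EFinP.
rewrite integralE [RHS]integralE; congr (_ - _)%E.
  rewrite -[RHS]ge0_integral_oppr//; first by apply: eq_integral => x _; rewrite unlock.
  exact: measurable_funepos.
rewrite -[RHS]ge0_integral_oppr//; first by apply: eq_integral => x _; rewrite unlock.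
exact: measurable_funeneg.
Qed.

Lemma integrable_oppr (f : R -> R) : mu.-integrable setT (EFin \o f) ->
  mu.-integrable setT (EFin \o (fun t => f (- t))).
Proof.
move=> iF; have mf := measurable_int _ iF.
have mfR : measurable_fun setT f by exact/measurable_EFinP.
apply/integrableP; split.
  by apply/measurable_EFinP; exact: (measurableT_comp mfR).
have /integrableP[_] := iF.
rewrite -(@ge0_integral_oppr (fun t => `|(EFin \o f) t|%E))//.
exact: measurableT_comp.
Qed.

Lemma Rintegral_odd_eq0 (f : R -> R) :
  mu.-integrable setT (EFin \o f) -> (forall x, f (- x) = - f x) ->
  \int[mu]_x f x = 0.
Proof.
move=> iF fN; have mf : measurable_fun setT f.
  by apply/measurable_EFinP; exact: measurable_int iF.
have := Rintegral_oppr mf; under eq_Rintegral do rewrite fN -mulN1r.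
rewrite RintegralZl//; lra.
Qed.

End Gauss.

Section HermiteFunctions.
Context {R : realType}.
Variable H : nat -> {poly R}.
Hypothesis hH : hermite_chebycheff H.
Notation mu := (@lebesgue_measure R).

Definition hermite_fun k (t : R) := std_gauss t * (H k).[t].
Notation h := hermite_fun.

(** On the diagonal the terms of Mehler's series are nonnegative for [0 <= x]. *)
Lemma mehler_partial_le t x n : 0 <= x < 1 ->
  \sum_(k < n) x ^+ k * ((H k).[t] ^+ 2 / k`!%:R) <=
  (Num.sqrt (1 - x ^+ 2))^-1 * expR (t ^+ 2 * (x / (1 + x))).
Proof.
move=> /andP[x0 x1]; have xn : `|x| < 1 by rewrite ger0_norm.
have := mehler hH (t := t) (s := t) xn.
have -> : mehler_kernel t t x =
    (Num.sqrt (1 - x ^+ 2))^-1 * expR (t ^+ 2 * (x / (1 + x))).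
  have := onem_sqr_gt0 xn; rewrite /mehler_kernel => w0.
  congr (_ * expR _); have x1' : 1 + x != 0 by rewrite gt_eqF// ltr_wpDr.
  have x2' : 1 - x != 0 by rewrite gt_eqF// subr_gt0.
  have -> : 1 - x ^+ 2 = (1 - x) * (1 + x) by ring.
  by field; rewrite x1' x2'.
set l := _ * expR _ => cl.
have -> : \sum_(k < n) x ^+ k * ((H k).[t] ^+ 2 / k`!%:R) =
   pseries (fun k => (H k).[t] * (H k).[t] / k`!%:R) x n.
  rewrite /pseries /series /= big_mkord; apply: eq_bigr => i _.
  by rewrite mulrC expr2.
rewrite -(cvg_lim _ cl)//; apply: nondecreasing_cvgn_le.
  apply/nondecreasing_seqP => m; rewrite /pseries /series /=.
  rewrite big_nat_recr//= lerDl mulr_ge0 ?exprn_ge0// divr_ge0//.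
  by rewrite -expr2 sqr_ge0.
by apply/cvg_ex; exists l.
Qed.

Lemma std_gauss_gt0 (t : R) : 0 < std_gauss t.
Proof. by rewrite mulr_gt0 ?expR_gt0// invr_gt0 sqrtr_gt0 mulr_gt0// pi_gt0. Qed.

(** A single term of Mehler's series at [x = 1 / 2] is bounded by its sum. *)
Lemma hermite_fun_le k : exists C, 0 <= C /\ forall t, `|h k t| <= C * expR (- (3^-1 * t ^+ 2)).
Proof.
pose c : R := Num.sqrt (2 ^+ k * k`!%:R * (Num.sqrt (1 - 2^-1 ^+ 2))^-1).
exists ((Num.sqrt (2 * pi))^-1 * c); split; first by rewrite mulr_ge0 ?invr_ge0 ?sqrtr_ge0.
move=> t; rewrite normrM (gtr0_norm (std_gauss_gt0 t)) /std_gauss.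
have -> : (Num.sqrt (2 * pi))^-1 * c * expR (- (3^-1 * t ^+ 2)) =
   (Num.sqrt (2 * pi))^-1 * expR (- (t ^+ 2 / 2)) * (c * expR (6^-1 * t ^+ 2)).
  rewrite -[LHS]mulrA -[RHS]mulrA; congr (_ * _).
  by rewrite [RHS]mulrCA -expRD; congr (_ * expR _); field.
apply: ler_wpM2l; first by rewrite mulr_ge0 ?expR_ge0// invr_ge0.
have x01 : 0 <= (2^-1 : R) < 1 by apply/andP; split; lra.
have := mehler_partial_le t k.+1 x01; rewrite big_ord_recr /= => le1.
have le2 : (H k).[t] ^+ 2 <= (c * expR (6^-1 * t ^+ 2)) ^+ 2.
  rewrite exprMn sqr_sqrtr; last first.
    by rewrite !mulr_ge0 ?exprn_ge0// invr_ge0.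
  rewrite -expRM_natl.
  have -> : 2%:R * (6^-1 * t ^+ 2) = t ^+ 2 * (2^-1 / (1 + 2^-1)) by field.
  have pk : 0 < (2 ^+ k * k`!%:R : R).
    by rewrite mulr_gt0 ?exprn_gt0// ltr0n fact_gt0.
  set S := (Num.sqrt _)^-1; set e := expR _.
  have -> : 2 ^+ k * k`!%:R * S * e = (S * e) * (2 ^+ k * k`!%:R).
    by rewrite -[LHS]mulrA mulrC.
  rewrite -ler_pdivrMr//.
  have -> : (H k).[t] ^+ 2 / (2 ^+ k * k`!%:R) =
      2^-1 ^+ k * ((H k).[t] ^+ 2 / k`!%:R).
    by rewrite exprVn invfM; ring.
  apply: le_trans le1; rewrite lerDr sumr_ge0// => i _.
  by rewrite mulr_ge0 ?exprn_ge0 ?invr_ge0// divr_ge0// sqr_ge0.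
rewrite -(@ler_pXn2r _ 2)// ?nnegrE ?mulr_ge0 ?expR_ge0 ?sqrtr_ge0//.
by rewrite real_normK ?num_real.
Qed.

Lemma is_derive_std_gauss (t : R) :
  is_derive t 1 (@std_gauss R) (- t * std_gauss t).
Proof.
rewrite /std_gauss; apply: is_derive_eq; rewrite /GRing.scale /=.
rewrite !(mulr0, mulr1, addr0, add0r); move: ((Num.sqrt _)^-1) => q.
by field.
Qed.

Lemma is_derive_hermite_fun k (t : R) : is_derive t 1 (h k) (- h k.+1 t).
Proof.
have d1 := is_derive_std_gauss t; have d2 := is_derive_hermite hH t k.
rewrite /hermite_fun; apply: is_derive_eq; rewrite /GRing.scale /=.
case: k {d2} => [|k]; first by rewrite hermite0// hermite1//; ring.
by rewrite hermiteSS//=; ring.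
Qed.

Lemma continuous_hermite_fun k : continuous (h k).
Proof. exact: is_derive_continuous (is_derive_hermite_fun k). Qed.

Lemma measurable_hermite_fun k : measurable_fun setT (h k).
Proof. exact: continuous_measurable_funT (@continuous_hermite_fun k). Qed.

Lemma integrable_hermite_fun k : mu.-integrable setT (EFin \o h k).
Proof.
have [C [C0 hC]] := hermite_fun_le k.
apply: (@le_integrableR _ _ _ mu _ _ _ hC); first exact: measurable_hermite_fun.
by apply: integrableRZ; apply: integrable_expRN_sqr; rewrite invr_gt0.
Qed.

Lemma continuous_cosM (a : R) : continuous (fun t : R => cos (a * t)).
Proof.
apply: (@is_derive_continuous _ (fun t => cos (a * t)) (fun x => - sin (a * x) * a)) => x.
by apply: is_derive_eq; rewrite /GRing.scale /=; ring.
Qed.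

Lemma continuous_sinM (a : R) : continuous (fun t : R => sin (a * t)).
Proof.
apply: (@is_derive_continuous _ (fun t => sin (a * t)) (fun x => cos (a * x) * a)) => x.
by apply: is_derive_eq; rewrite /GRing.scale /=; ring.
Qed.

Lemma measurable_cosM (a : R) : measurable_fun setT (fun t : R => cos (a * t)).
Proof. by apply: continuous_measurable_funT; exact: continuous_cosM. Qed.

Lemma measurable_sinM (a : R) : measurable_fun setT (fun t : R => sin (a * t)).
Proof. by apply: continuous_measurable_funT; exact: continuous_sinM. Qed.

Lemma cos_norm_le1 (x : R) : `|cos x| <= 1.
Proof. by rewrite ler_norml cos_geN1 cos_le1. Qed.

Lemma sin_norm_le1 (x : R) : `|sin x| <= 1.
Proof. by rewrite ler_norml sin_geN1 sin_le1. Qed.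

Lemma integrable_cosM (f : R -> R) a : mu.-integrable setT (EFin \o f) ->
  mu.-integrable setT (EFin \o (fun t => cos (a * t) * f t)).
Proof.
move=> iF; apply: (integrable_boundedM _ _ iF); first exact: measurable_cosM.
by move=> x; exact: cos_norm_le1.
Qed.

Lemma integrable_sinM (f : R -> R) a : mu.-integrable setT (EFin \o f) ->
  mu.-integrable setT (EFin \o (fun t => sin (a * t) * f t)).
Proof.
move=> iF; apply: (integrable_boundedM _ _ iF); first exact: measurable_sinM.
by move=> x; exact: sin_norm_le1.
Qed.

Definition hermite_cos k (a : R) : R := \int[mu]_t (cos (a * t) * h k t).
Definition hermite_sin k (a : R) : R := \int[mu]_t (sin (a * t) * h k t).

Lemma hermite_cosS k a : hermite_cos k.+1 a = - a * hermite_sin k a.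
Proof.
have dF (x : R) : is_derive x 1 (fun t => cos (a * t) * h k t)
    (- a * (sin (a * x) * h k x) - cos (a * x) * h k.+1 x).
  have d1 := is_derive_hermite_fun k x.
  by apply: is_derive_eq; rewrite /GRing.scale /=; ring.
have iS := integrable_sinM a (integrable_hermite_fun k).
have iC := integrable_cosM a (integrable_hermite_fun k.+1).
have : \int[mu]_x (- a * (sin (a * x) * h k x) - cos (a * x) * h k.+1 x) = 0.
  have [C [C0 hC]] := hermite_fun_le k.
  apply: (@Rintegral_derive_gauss_eq0 _ _ _ C 3^-1 _ dF); first by rewrite invr_gt0.
  - move=> x; apply: cvgB.
      by apply: cvgMr; apply: cvgM;
        [exact: continuous_sinM|exact: continuous_hermite_fun].
    by apply: cvgM; [exact: continuous_cosM|exact: continuous_hermite_fun].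
  - by apply: integrableRB => //; exact: integrableRZ.
  - move=> x; rewrite normrM; apply: le_trans (hC x).
    by rewrite ler_piMl// cos_norm_le1.
rewrite RintegralB//; last exact: integrableRZ.
by rewrite RintegralZl// -/(hermite_sin k a) -/(hermite_cos k.+1 a); lra.
Qed.

Lemma hermite_sinS k a : hermite_sin k.+1 a = a * hermite_cos k a.
Proof.
have dF (x : R) : is_derive x 1 (fun t => sin (a * t) * h k t)
    (a * (cos (a * x) * h k x) - sin (a * x) * h k.+1 x).
  have d1 := is_derive_hermite_fun k x.
  by apply: is_derive_eq; rewrite /GRing.scale /=; ring.
have iC := integrable_cosM a (integrable_hermite_fun k).
have iS := integrable_sinM a (integrable_hermite_fun k.+1).
have : \int[mu]_x (a * (cos (a * x) * h k x) - sin (a * x) * h k.+1 x) = 0.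
  have [C [C0 hC]] := hermite_fun_le k.
  apply: (@Rintegral_derive_gauss_eq0 _ _ _ C 3^-1 _ dF); first by rewrite invr_gt0.
  - move=> x; apply: cvgB.
      by apply: cvgMr; apply: cvgM;
        [exact: continuous_cosM|exact: continuous_hermite_fun].
    by apply: cvgM; [exact: continuous_sinM|exact: continuous_hermite_fun].
  - by apply: integrableRB => //; exact: integrableRZ.
  - move=> x; rewrite normrM; apply: le_trans (hC x).
    by rewrite ler_piMl// sin_norm_le1.
rewrite RintegralB//; last exact: integrableRZ.
by rewrite RintegralZl// -/(hermite_sin k.+1 a) -/(hermite_cos k a); lra.
Qed.

Lemma hermite_sin0 a : hermite_sin 0 a = 0.
Proof.
apply: Rintegral_odd_eq0.
  exact: integrable_sinM (integrable_hermite_fun 0).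
by move=> x; rewrite mulrN sinN /hermite_fun !hermite0// /std_gauss sqrrN mulNr.
Qed.

(** The derivative in [a] under the integral sign is [- a] times the transform,
    by integration by parts; this equation determines the transform. *)
Lemma hermite_cos0 a : hermite_cos 0 a = expR (- (a ^+ 2 / 2)).
Proof.
have dI (b : R) : is_derive b 1 (hermite_cos 0) (- b * hermite_cos 0 b).
  have -> : - b * hermite_cos 0 b = - hermite_sin 1 b.
    by rewrite hermite_sinS mulNr.
  have [C [C0 hC]] := hermite_fun_le 1.
  have bI : `]b - 1, b + 1[%classic b by rewrite /= in_itv /=; apply/andP; split; lra.
  have dc (x y : R) : is_derive x 1 (fun x => cos (x * y) * h 0 y)
      (- sin (x * y) * h 1 y).
    rewrite /hermite_fun hermite0// hermite1//.
    by apply: is_derive_eq; rewrite /GRing.scale /=; ring.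
  have iC (x : R) : `]b - 1, b + 1[%classic x ->
      mu.-integrable setT (EFin \o (fun y => cos (x * y) * h 0 y)).
    by move=> _; exact: integrable_cosM (integrable_hermite_fun 0).
  have dC (x y : R) : `]b - 1, b + 1[%classic x -> [set: R] y ->
      derivable ((fun x y => cos (x * y) * h 0 y)^~ y) x 1.
    by move=> _ _; have [] := dc x y.
  have G0 (y : R) : 0 <= C * expR (- (3^-1 * y ^+ 2)).
    by rewrite mulr_ge0 ?expR_ge0.
  have iG : mu.-integrable setT (EFin \o (fun y => C * expR (- (3^-1 * y ^+ 2)))).
    by apply: integrableRZ; apply: integrable_expRN_sqr; rewrite invr_gt0.
  have Gub (x y : R) : `]b - 1, b + 1[%classic x -> [set: R] y ->
      `|partial1of2 (fun x y => cos (x * y) * h 0 y) x y| <=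
      C * expR (- (3^-1 * y ^+ 2)).
    move=> _ _; rewrite /partial1of2 derive1E; have [_ ->] := dc x y.
    rewrite normrM normrN; apply: le_trans (hC y).
    by rewrite ler_piMl// sin_norm_le1.
  have D := derivable_under_integral measurableT bI iC dC G0 iG Gub.
  have E := differentiation_under_integral measurableT bI iC dC G0 iG Gub.
  apply: DeriveDef => //; rewrite -derive1E /hermite_cos E.
  rewrite /hermite_sin -mulN1r -RintegralZl//; last first.
    exact: integrable_sinM (integrable_hermite_fun 1).
  apply: eq_Rintegral => y _; rewrite /partial1of2 derive1E.
  by have [_ ->] := dc b y; rewrite mulN1r mulNr.
have E : (hermite_cos 0 a) * expR (a ^+ 2 / 2) = hermite_cos 0 0 * expR (0 ^+ 2 / 2).
  apply: (@is_derive_0_is_cst _ (fun a => hermite_cos 0 a * expR (a ^+ 2 / 2))) => x.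
  have d1 := dI x.
  by apply: is_derive_eq; rewrite /GRing.scale /=; field.
have E0 : hermite_cos 0 0 = 1.
  rewrite /hermite_cos /Rintegral.
  under eq_integral do rewrite mul0r cos0 mul1r /hermite_fun hermite0// mulr1 -normal_pdf01E.
  by rewrite integral_normal_pdf.
have e0 : expR (a ^+ 2 / 2) != 0 by rewrite gt_eqF// expR_gt0.
rewrite expRN; apply: (mulIf e0); rewrite mulVf// E E0.
by rewrite expr0n/= mul0r expR0 mul1r.
Qed.

(** By [hermite_cosS] and [hermite_sinS] each step exchanges the cosine and the
    sine transforms and multiplies by [a] or [- a].  In products of two transforms
    of the same index the signs cancel. *)
Lemma hermite_transform_mul k a b :
  let E := expR (- ((a ^+ 2 + b ^+ 2) / 2)) in
  [/\ hermite_cos k a * hermite_cos k b = (if odd k then 0 else (a * b) ^+ k * E),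
      hermite_sin k a * hermite_sin k b = (if odd k then (a * b) ^+ k * E else 0)
    & hermite_cos k a * hermite_sin k b = 0].
Proof.
elim: k a b => [|k IH] a b E.
  rewrite !hermite_cos0 !hermite_sin0 !mulr0 expr0 mul1r; split => //.
  by rewrite -expRD /E; congr expR; field.
have [cc ss cs] := IH a b; have [_ _ cs'] := IH b a.
rewrite !hermite_cosS !hermite_sinS /= /E; split.
- rewrite mulrACA ss; case: (odd k) => /=; last by rewrite mulr0.
  by rewrite [(a * b) ^+ k.+1]exprS; move: ((a * b) ^+ k) (expR _) => p q; ring.
- rewrite mulrACA cc; case: (odd k) => /=; first by rewrite mulr0.
  by rewrite [(a * b) ^+ k.+1]exprS; move: ((a * b) ^+ k) (expR _) => p q; ring.
- by rewrite mulrACA [hermite_sin k a * _]mulrC cs' mulr0.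
Qed.

End HermiteFunctions.

(** * Laws of real random variables and the normal law *)
Section Laws.
Context {R : realType}.
Notation mu := (@lebesgue_measure R).

(** The half-lines form a pi-system that generates the Borel sets. *)
Lemma prob_eq_itvoy (P1 P2 : probability R R) :
  (forall a : R, P1 `]a, +oo[%classic = P2 `]a, +oo[%classic) ->
  forall A, measurable A -> P1 A = P2 A.
Proof.
move=> P12 A mA.
apply: (@measure_unique _ R R (@RGenOInfty.G R)
  (fun n => `](- n%:R)%R, +oo[%classic) _ _ _ _ P1 P2 _ _ A mA).
- exact: RGenOInfty.measurableE.
- move=> _ _ [x ->] [y ->]; exists (Num.max x y).
  apply/seteqP; split => z /=; rewrite !in_itv /= !andbT gt_max.
    by move=> [-> ->].
  by move=> /andP[].
- by move=> i; exists (- i%:R).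
- apply/seteqP; split=> // x _; exists (Num.bound `|x|) => //=.
  rewrite in_itv /= andbT ltrNl; apply: le_lt_trans (archi_boundP _) => //.
  by rewrite -normrN; exact: ler_norm.
- by move=> _ [x ->]; exact: P12.
- by move=> k; rewrite (le_lt_trans (probability_le1 _ _))// ltry.
Qed.

Section TwoSpaces.
Context {d1 d2 : measure_display} {T1 : measurableType d1}
  {T2 : measurableType d2}.
Variables (P1 : probability T1 R) (P2 : probability T2 R).
Implicit Types (X : T1 -> R) (Y : T2 -> R).

Lemma equal_in_law_itvoy X Y : measurable_fun setT X -> measurable_fun setT Y ->
  (forall a, P1 [set w | a < X w] = P2 [set w | a < Y w]) ->
  equal_in_law P1 P2 X Y.
Proof.
move=> mX mY XY A mA.
pose X' : {mfun T1 >-> R} := mfun_Sub (mem_set mX).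
pose Y' : {mfun T2 >-> R} := mfun_Sub (mem_set mY).
change (distribution P1 X' A = distribution P2 Y' A).
apply: prob_eq_itvoy => // a.
change (P1 (X @^-1` `]a, +oo[%classic) = P2 (Y @^-1` `]a, +oo[%classic)).
rewrite (_ : X @^-1` _ = [set w | a < X w]); last first.
  by apply/seteqP; split=> w /=; rewrite in_itv /= andbT.
rewrite XY; congr (P2 _).
by apply/seteqP; split=> w /=; rewrite in_itv /= andbT.
Qed.

Lemma equal_in_law_ge0_integral X Y (f : R -> \bar R) :
  measurable_fun setT X -> measurable_fun setT Y -> equal_in_law P1 P2 X Y ->
  measurable_fun setT f -> (forall x, (0 <= f x)%E) ->
  (\int[P1]_w f (X w) = \int[P2]_w f (Y w))%E.
Proof.
move=> mX mY XY mf f0.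
pose X' : {mfun T1 >-> R} := mfun_Sub (mem_set mX).
pose Y' : {mfun T2 >-> R} := mfun_Sub (mem_set mY).
transitivity (\int[distribution P1 X']_x f x)%E.
  by rewrite ge0_integral_distribution.
transitivity (\int[distribution P2 Y']_x f x)%E; last first.
  by rewrite ge0_integral_distribution.
by apply: eq_measure_integral => A mA _; exact: XY.
Qed.

Lemma equal_in_law_integral X Y (f : R -> R) :
  measurable_fun setT X -> measurable_fun setT Y -> equal_in_law P1 P2 X Y ->
  measurable_fun setT f ->
  (\int[P1]_w (f (X w))%:E = \int[P2]_w (f (Y w))%:E)%E.
Proof.
move=> mX mY XY mf; rewrite integralE [RHS]integralE; congr (_ - _)%E.
  have := @equal_in_law_ge0_integral _ _ (EFin \o f)^\+%E mX mY XY.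
  rewrite unlock; apply; first by have := measurable_funepos (proj2 (measurable_EFinP _ _) mf); rewrite unlock.
  by move=> x; rewrite le_max lexx orbT.
have := @equal_in_law_ge0_integral _ _ (EFin \o f)^\-%E mX mY XY.
rewrite unlock; apply; first by have := measurable_funeneg (proj2 (measurable_EFinP _ _) mf); rewrite unlock.
by move=> x; rewrite le_max lexx orbT.
Qed.

End TwoSpaces.

Lemma integral_normal_prob (m s : R) (f : R -> \bar R) : measurable_fun setT f ->
  (forall x, (0 <= f x)%E) ->
  (\int[normal_prob m s]_x f x = \int[mu]_x (f x * (normal_pdf m s x)%:E))%E.
Proof.
move=> mf f0; have dom := normal_prob_dominates m s.
rewrite -(Radon_Nikodym_SigmaFinite.change_of_variables dom)//.
have iRN := Radon_Nikodym_SigmaFinite.f_integrable dom.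
have mRN := measurable_int _ iRN.
have mpdf : measurable_fun setT (EFin \o normal_pdf m s).
  by apply/measurable_EFinP; exact: measurable_normal_pdf.
apply: ae_eq_integral => //.
- exact: emeasurable_funM.
- exact: emeasurable_funM.
- apply: ae_eqe_mul2l; apply: integral_ae_eq => // E _ mE.
  by rewrite -(Radon_Nikodym_SigmaFinite.f_integral dom).
Qed.

Lemma normal_pdf_affine (m c x : R) : 0 < c ->
  normal_pdf 0 1 ((x - m) / c) / c = normal_pdf m c x.
Proof.
move=> c0; rewrite !normal_pdfE ?gt_eqF// /normal_peak /normal_fun.
rewrite expr1n mul1r -mulrnAr sqrtrM ?sqr_ge0// sqrtr_sqr gtr0_norm// invfM.
rewrite subr0 mulrAC [c^-1 * _]mulrC; congr (_ * _ * expR _).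
by rewrite -mulr_natr -[c ^+ 2 *+ 2]mulr_natr; field; rewrite gt_eqF.
Qed.

(** The half-lines suffice, and there the statement is a substitution. *)
Lemma normal_prob_affine (m c : R) (A : set R) : 0 < c -> measurable A ->
  normal_prob 0 1 [set y | A (m + c * y)] = normal_prob m c A.
Proof.
move=> c0 mA.
have mF : measurable_fun setT (fun y : measurableTypeR R => m + c * y).
  by apply: measurable_funD => //; exact: measurable_funM.
have mI : measurable_fun setT (fun y : measurableTypeR R => (y : R)).
  exact: measurable_id.
apply: (equal_in_law_itvoy mF mI _ mA) => a.
rewrite (_ : [set _ | _] = `](a - m) / c, +oo[%classic); last first.
  apply/seteqP; split=> y /=; rewrite !in_itv /= !andbT ltr_pdivrMr// ltrBlDr addrC mulrC//.
rewrite [X in _ = _ X](_ : _ = `]a, +oo[%classic); last first.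
  by apply/seteqP; split=> y /=; rewrite in_itv /= andbT.
change (normal_prob 0 1 `](a - m) / c, +oo[%classic = normal_prob m c `]a, +oo[%classic).
rewrite /normal_prob integral_itv_obnd_cbnd; last first.
  by apply/measurable_EFinP; apply: measurable_funS (measurable_normal_pdf _ _).
rewrite [RHS]integral_itv_obnd_cbnd; last first.
  by apply/measurable_EFinP; apply: measurable_funS (measurable_normal_pdf _ _).
have dG (x : R) : is_derive x 1 (fun x : R => (x - m) / c) c^-1.
  by apply: is_derive_eq; rewrite /GRing.scale /= mulr0 add0r subr0 mulr1.
have dGE : (fun x : R => (x - m) / c)^`()%classic = cst c^-1.
  by apply/funext => x; rewrite derive1E; have [_ ->] := dG x.
rewrite (@increasing_ge0_integration_by_substitutiony _ (fun x => (x - m) / c)).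
- apply: eq_integral => x _; rewrite dGE /=.
  by rewrite -(normal_pdf_affine m x c0).
- by move=> x y _ _ xy; rewrite ltr_pM2r ?invr_gt0// ltrD2r.
- by rewrite dGE => x _; exact: cst_continuous.
- by rewrite dGE; exact: is_cvg_cst.
- by rewrite dGE; exact: is_cvg_cst.
- split; first by move=> x _; have [] := dG x.
  by apply: cvg_at_right_filter; apply: (is_derive_continuous dG).
- by apply/gt0_cvgMly; [rewrite invr_gt0|exact: cvg_addrr].
- by apply: continuous_subspaceT; exact: continuous_normal_pdf.
- by move=> x _; exact: normal_pdf_ge0.
Qed.

Lemma normal_prob_indic (m c : R) (A : set R) :
  normal_prob m c A = (\int[mu]_z (\1_A z * normal_pdf m c z)%:E)%E.
Proof.
rewrite /normal_prob integral_mkcond; apply: eq_integral => z _.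
by rewrite patchE indicE; case: ifP => _; rewrite ?mul1r ?mul0r.
Qed.

Lemma normal_prob_opp (A : set R) : measurable A ->
  normal_prob 0 1 [set y : R | A (- y)] = normal_prob 0 1 A.
Proof.
move=> mA; rewrite !normal_prob_indic -[RHS]ge0_integral_oppr.
- by apply: eq_integral => x _; rewrite !normal_pdf01E /std_gauss sqrrN.
- apply/measurable_EFinP; apply: measurable_funM; first exact: measurable_indic.
  exact: measurable_normal_pdf.
- by move=> x; rewrite lee_fin mulr_ge0 ?normal_pdf_ge0.
Qed.

Lemma normal_peakE (s : R) : 0 < s ->
  normal_peak s = s^-1 * (Num.sqrt (pi *+ 2))^-1.
Proof.
move=> s0; rewrite /normal_peak -[_ *+ 2]mulrnAr sqrtrM ?sqr_ge0//.
by rewrite sqrtr_sqr gtr0_norm// invfM.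
Qed.

(** Completion of the square: the joint density of [(X, s X + c Z)] factors into
    the density of the second coordinate and a normal conditional density of the
    first one. *)
Lemma normal_pdf_conv (s c x z : R) : 0 < c ->
  let r := Num.sqrt (s ^+ 2 + c ^+ 2) in
  normal_pdf 0 1 x * normal_pdf (s * x) c z =
  normal_pdf 0 r z * normal_pdf (z * s / r ^+ 2) (c / r) x.
Proof.
move=> c0 r.
have r2 : 0 < s ^+ 2 + c ^+ 2 by rewrite ltr_wpDl ?sqr_ge0// exprn_gt0.
have r0 : 0 < r by rewrite sqrtr_gt0.
have rE : r ^+ 2 = s ^+ 2 + c ^+ 2 by rewrite sqr_sqrtr// ltW.
have cr0 : 0 < c / r by rewrite divr_gt0.
have cn : c != 0 by rewrite gt_eqF.
have rn : r != 0 by rewrite gt_eqF.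
rewrite !normal_pdfE ?gt_eqF// !normal_peakE// /normal_fun; clearbody r.
move: ((Num.sqrt (pi *+ 2))^-1) => p.
rewrite mulrACA -expRD [RHS]mulrACA -expRD; congr (_ * expR _).
  by rewrite invr1; field; rewrite cn rn.
have E (u : R) : u ^+ 2 *+ 2 = 2 * u ^+ 2 by rewrite mulr2n; ring.
rewrite !E !subr0; apply/eqP; rewrite -subr_eq0; apply/eqP.
transitivity ((r ^+ 2 - (s ^+ 2 + c ^+ 2)) *
    (x ^+ 2 - z ^+ 2 / r ^+ 2) / (2 * c ^+ 2)).
  by field; rewrite cn rn.
by rewrite rE subrr !mul0r.
Qed.

End Laws.

(** * Sums of independent normal variables *)
Section GaussianLaw.
Context {R : realType}.
Notation mu := (@lebesgue_measure R).

Lemma measurable_normal_pdf_joint (s c : R) : 0 < c ->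
  measurable_fun setT (fun p : measurableTypeR R * measurableTypeR R =>
    normal_pdf (s * p.1) c p.2).
Proof.
move=> c0; rewrite (_ : (fun p => _) = fun p => normal_peak c *
  expR (- (p.2 - s * p.1) ^+ 2 / (c ^+ 2 *+ 2))); last first.
  by apply/funext => p; rewrite normal_pdfE// gt_eqF.
have mf : measurable_fun setT (fst : measurableTypeR R * measurableTypeR R -> R).
  exact: measurable_fst.
have ms : measurable_fun setT (snd : measurableTypeR R * measurableTypeR R -> R).
  exact: measurable_snd.
apply: measurable_funM => //; apply: measurableT_comp => //.
apply: measurable_funM => //; apply: measurable_funN.
apply: measurable_funX; apply: measurable_funB => //.
exact: measurable_funM.
Qed.

Lemma measurable_normal_prob_mean (s c : R) (A : set R) : 0 < c -> measurable A ->
  measurable_fun setT (fun x : measurableTypeR R => normal_prob (s * x) c A).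
Proof.
move=> c0 mA; under eq_fun do rewrite normal_prob_indic.
pose f (p : measurableTypeR R * measurableTypeR R) : \bar R :=
  (\1_A p.2 * normal_pdf (s * p.1) c p.2)%:E.
have mf : measurable_fun setT f.
  apply/measurable_EFinP; apply: measurable_funM.
    by apply: (@measurableT_comp _ _ _ _ _ _ (\1_A : R -> R)).
  exact: measurable_normal_pdf_joint.
apply: (@measurable_fun_fubini_tonelli_F _ _ _ _ _ mu f mf).
by move=> p; rewrite lee_fin mulr_ge0 ?normal_pdf_ge0// indicE.
Qed.

(** By Tonelli and [normal_pdf_conv], where the conditional density has
    integral 1. *)
Lemma normal_prob_conv (s c : R) (A : set R) : 0 < c -> measurable A ->
  (\int[normal_prob 0 1]_x normal_prob (s * x) c A =
   normal_prob 0 (Num.sqrt (s ^+ 2 + c ^+ 2)) A)%E.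
Proof.
move=> c0 mA; set r := Num.sqrt _.
have r0 : 0 < r by rewrite sqrtr_gt0 ltr_wpDl ?sqr_ge0// exprn_gt0.
rewrite integral_normal_prob; last 2 first.
- exact: measurable_normal_prob_mean.
- by move=> x; apply: integral_ge0 => z _; rewrite lee_fin normal_pdf_ge0.
pose f (p : measurableTypeR R * measurableTypeR R) : \bar R :=
  (\1_A p.2 * normal_pdf (s * p.1) c p.2 * normal_pdf 0 1 p.1)%:E.
have mf : measurable_fun setT f.
  apply/measurable_EFinP; apply: measurable_funM.
    apply: measurable_funM.
      by apply: (@measurableT_comp _ _ _ _ _ _ (\1_A : R -> R)).
    exact: measurable_normal_pdf_joint.
  apply: (@measurableT_comp _ _ _ _ _ _ (normal_pdf 0 1)) => //.
  exact: measurable_normal_pdf.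
have f0 p : (0 <= f p)%E.
  by rewrite lee_fin !mulr_ge0 ?normal_pdf_ge0// indicE.
transitivity (\int[mu]_x \int[mu]_z f (x, z))%E.
  apply: eq_integral => x _; rewrite normal_prob_indic -ge0_integralZr//.
  - apply/measurable_EFinP; apply: measurable_funM.
      exact: measurable_indic.
    exact: measurable_normal_pdf.
  - by move=> z _; rewrite lee_fin mulr_ge0 ?normal_pdf_ge0// indicE.
  - by rewrite lee_fin normal_pdf_ge0.
rewrite (fubini_tonelli (m1 := mu) (m2 := mu) f mf f0) normal_prob_indic.
apply: eq_integral => z _.
transitivity (\int[mu]_x ((\1_A z * normal_pdf 0 r z)%:E *
    (normal_pdf (z * s / r ^+ 2) (c / r) x)%:E))%E.
  apply: eq_integral => x _; rewrite /f /= -EFinM; congr EFin.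
  rewrite -[LHS]mulrA -[RHS]mulrA; congr (_ * _).
  by rewrite mulrC (normal_pdf_conv s x z c0).
rewrite ge0_integralZl//.
- by rewrite integral_normal_pdf mule1.
- by apply/measurable_EFinP; exact: measurable_normal_pdf.
- by move=> x _; rewrite lee_fin normal_pdf_ge0.
- by rewrite lee_fin mulr_ge0 ?normal_pdf_ge0// indicE.
Qed.

Context {d : measure_display} {T : measurableType d}.
Variable P : probability T R.
Implicit Types (X Z : T -> R) (s c : R).

(** [X] is distributed as [s] times a standard normal variable; unlike
    [normal_prob 0 s], this covers the degenerate case [s = 0]. *)
Definition scaled_normal X s : Prop :=
  equal_in_law P (normal_prob 0 1) X (fun x : measurableTypeR R => s * x).

Lemma scaled_normalN X s : scaled_normal X s -> scaled_normal (fun w => - X w) s.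
Proof.
move=> XS A mA; have mA' : measurable [set y : R | A (- y)].
  by rewrite -[X in measurable X]setTI; exact: measurable_funN.
have := XS _ mA'; rewrite /preimage /= => ->.
have mB : measurable [set y : R | A (s * y)].
  by rewrite -[X in measurable X]setTI; exact: measurable_funM.
rewrite -(normal_prob_opp mB); congr (normal_prob 0 1 _).
by apply/seteqP; split => y /=; rewrite mulrN.
Qed.

Definition independent_rv X Z := forall A B : set R, measurable A -> measurable B ->
  P (X @^-1` A `&` Z @^-1` B) = (P (X @^-1` A) * P (Z @^-1` B))%E.

Let scaled_normalD_gt0 X Z s c : measurable_fun setT X -> measurable_fun setT Z ->
  independent_rv X Z -> scaled_normal X s -> scaled_normal Z 1 -> 0 < c ->
  scaled_normal (fun w => X w + c * Z w) (Num.sqrt (s ^+ 2 + c ^+ 2)).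
Proof.
move=> mX mZ XZ lX lZ c0 A mA; set r := Num.sqrt _.
have r0 : 0 < r by rewrite sqrtr_gt0 ltr_wpDl ?sqr_ge0// exprn_gt0.
pose X' : {mfun T >-> R} := mfun_Sub (mem_set mX).
pose Z' : {mfun T >-> R} := mfun_Sub (mem_set mZ).
have mXZ : measurable_fun setT (fun w => (X w, Z w)) by exact: measurable_fun_pair.
pose XZ' : {mfun T >-> (R * R)%type} := mfun_Sub (mem_set mXZ).
have mg : measurable_fun setT (fun p : R * R => p.1 + c * p.2).
  apply: measurable_funD; first exact: measurable_fst.
  by apply: measurable_funM => //; exact: measurable_snd.
pose W := [set p : R * R | A (p.1 + c * p.2)].
have mW : measurable W by rewrite -[X in measurable X]setTI; exact: mg.
change (distribution P XZ' W = normal_prob 0 1 [set x : R | A (r * x)]).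
rewrite -(@product_measure_unique _ _ _ _ _ (distribution P X') (distribution P Z'))//.
rewrite /product_measure1.
have E x : (distribution P Z' \o xsection W) x = normal_prob (1 * x) c A.
  rewrite mul1r -(normal_prob_affine x c0 mA).
  have mAx : measurable [set z : R | A (x + c * z)].
    by rewrite -[X in measurable X]setTI; apply: measurable_funD => //; exact: measurable_funM.
  have := lZ _ mAx; rewrite /preimage /=.
  under [X in _ = normal_prob 0 1 X -> _]eq_set do rewrite mul1r.
  move=> <-; congr (P _); apply/seteqP; split=> w /=.
    by rewrite /xsection /= inE.
  by rewrite /xsection /= inE.
under eq_integral do rewrite E.
have mN : measurable_fun setT (fun x : R => normal_prob (1 * x) c A).
  exact: measurable_normal_prob_mean.
have N0 (x : R) : (0 <= normal_prob (1 * x) c A)%E.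
  by apply: integral_ge0 => z _; rewrite lee_fin normal_pdf_ge0.
have ms : measurable_fun setT (fun x : measurableTypeR R => s * x).
  exact: measurable_funM.
rewrite ge0_integral_distribution//.
transitivity (\int[normal_prob 0 1]_x normal_prob (1 * (s * x)) c A)%E.
  exact: (equal_in_law_ge0_integral mX ms lX mN N0).
under eq_integral do rewrite mul1r.
rewrite (normal_prob_conv _ c0 mA) -/r -(normal_prob_affine 0 r0 mA).
by congr (normal_prob 0 1 _); apply/seteqP; split => y /=; rewrite add0r.
Qed.

(** The law of the pair is a product measure, and the law of the sum is then the
    mixture computed by [normal_prob_conv]; the sign of [c] is immaterial by the
    symmetry of the normal law. *)
Lemma scaled_normalD X Z s c : measurable_fun setT X -> measurable_fun setT Z ->
  independent_rv X Z -> scaled_normal X s -> scaled_normal Z 1 -> 0 <= s ->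
  scaled_normal (fun w => X w + c * Z w) (Num.sqrt (s ^+ 2 + c ^+ 2)).
Proof.
move=> mX mZ XZ lX lZ s0; have [c0|c0|->] := ltgtP c 0.
- rewrite (_ : (fun w => _) = fun w => X w + - c * (- Z w)); last first.
    by apply/funext => w; rewrite mulrNN.
  rewrite -[c ^+ 2]sqrrN; apply: scaled_normalD_gt0 => //.
  + exact: measurable_funN.
  + move=> A B mA mB; have mB' : measurable [set y : R | B (- y)].
      by rewrite -[X in measurable X]setTI; exact: measurable_funN.
    exact: (XZ _ _ mA mB').
  + exact: scaled_normalN.
  + by rewrite oppr_gt0.
- exact: scaled_normalD_gt0.
- rewrite expr0n/= addr0 sqrtr_sqr ger0_norm//.
  by under eq_fun do rewrite mul0r addr0.
Qed.

Lemma scaled_normal_cst0 : scaled_normal (fun=> 0) 0.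
Proof.
move=> A mA; rewrite !preimage_cst; case: ifPn => A0.
  rewrite probability_setT (_ : _ @^-1` _ = setT) ?probability_setT//.
  by apply/seteqP; split => x //= _; rewrite mul0r; exact/set_mem.
rewrite measure0 (_ : _ @^-1` _ = set0) ?measure0//.
by apply/seteqP; split => x //=; rewrite mul0r; move=> Ax; move/negP: A0; apply; exact/mem_set.
Qed.

Lemma scaled_normal_gaussian_rv X s : measurable_fun setT X -> 0 <= s ->
  scaled_normal X s -> gaussian_rv P X.
Proof.
move=> mX; rewrite le_eqVlt => /predU1P[<- lX|s0 lX]; split => //.
  left; exists 0; exists (X @^-1` (~` [set 0])); split => //=.
  - by rewrite -[X in measurable X]setTI; apply: mX => //; exact: measurableC.
  - rewrite lX; last exact: measurableC.
    rewrite (_ : _ @^-1` _ = set0) ?measure0//.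
    by apply/seteqP; split => x //=; rewrite mul0r; apply.
right; exists 0, s; split=> [//|A mA]; rewrite (lX _ mA).
rewrite -(normal_prob_affine 0 s0 mA).
by congr (normal_prob 0 1 _); apply/seteqP; split => y /=; rewrite add0r.
Qed.

End GaussianLaw.

(** * Mean square limits of normal variables *)
Section Chebyshev.
Context {R : realType} {d : measure_display} {T : measurableType d}.
Variable Q : probability T R.

Lemma measurable_norm_ge (f : T -> R) e : measurable_fun setT f ->
  measurable [set w | e <= `|f w|].
Proof.
move=> mf; rewrite (_ : [set w | _] = (fun w => `|f w|) @^-1` `[e, +oo[%classic); last first.
  by apply/seteqP; split => w /=; rewrite in_itv /= andbT.
rewrite -[X in measurable X]setTI.
have mn : measurable_fun setT (fun w => `|f w|) by exact: measurableT_comp.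
exact: mn.
Qed.

Lemma measurable_gt (f : T -> R) e : measurable_fun setT f ->
  measurable [set w | e < f w].
Proof.
move=> mf; rewrite (_ : [set w | _] = f @^-1` `]e, +oo[%classic); last first.
  by apply/seteqP; split => w /=; rewrite in_itv /= andbT.
by rewrite -[X in measurable X]setTI; exact: mf.
Qed.

Lemma chebyshev_sqr_le (f : T -> R) e : measurable_fun setT f -> 0 < e ->
  ((e ^+ 2)%:E * Q [set w | (e <= `|f w|)%R] <= \int[Q]_w ((f w) ^+ 2)%:E)%E.
Proof.
move=> mf e0; have mE := measurable_norm_ge e mf.
have QE : Q [set w | e <= `|f w|] =
    (\int[Q]_x (\1_([set w | (e <= `|f w|)%R]) x)%:E)%E.
  by rewrite integral_indic// setIT.
have mI : measurable_fun setT (fun x => (\1_([set w | e <= `|f w|]) x : R)).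
  exact: measurable_indic.
rewrite QE -ge0_integralZl//; last 2 first.
- exact/measurable_EFinP.
- by rewrite lee_fin sqr_ge0.
apply: ge0_le_integral => //.
- by move=> x _; rewrite -EFinM lee_fin mulr_ge0 ?sqr_ge0// indicE.
- by apply: emeasurable_funM => //; exact/measurable_EFinP.
- by apply/measurable_EFinP; exact: measurable_funX.
- move=> x _; rewrite -EFinM lee_fin indicE.
  case: (boolP (x \in _)); last by rewrite mulr0 sqr_ge0.
  rewrite inE /= mulr1 -[f x ^+ 2]real_normK ?num_real// => ef.
  by rewrite ler_pXn2r// nnegrE ltW.
Qed.

(** The rate [r] consists of real numbers, so that the finiteness of the integrals
    is part of the notion. *)
Definition cvg_L2 (X_ : (T -> R)^nat) (X : T -> R) : Prop :=
  exists2 r : R^nat, r @ \oo --> (0 : R) &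
    forall n, (\int[Q]_w ((X w - X_ n w) ^+ 2)%:E <= (r n)%:E)%E.

End Chebyshev.

Section LimitInLaw.
Context {R : realType} {d1 d2 : measure_display} {T1 : measurableType d1}
  {T2 : measurableType d2}.

(** By Chebyshev, [X] exceeds [a + 2 e] only if [X_ n] exceeds [a + e], up to a
    small probability; that probability can be transported to [Y_ n], and again to
    [Y] with the level [a].  Then [e] tends to 0. *)
Lemma cvg_L2_tail_le (P1 : probability T1 R) (P2 : probability T2 R)
  (X_ : (T1 -> R)^nat) (X : T1 -> R) (Y_ : (T2 -> R)^nat) (Y : T2 -> R) :
  (forall n, measurable_fun setT (X_ n)) -> measurable_fun setT X ->
  (forall n, measurable_fun setT (Y_ n)) -> measurable_fun setT Y ->
  (forall n, equal_in_law P1 P2 (X_ n) (Y_ n)) ->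
  cvg_L2 P1 X_ X -> cvg_L2 P2 Y_ Y ->
  forall a, (P1 [set w | (a < X w)%R] <= P2 [set w | (a < Y w)%R])%E.
Proof.
move=> mX_ mX mY_ mY XY [r1 r10 X0] [r2 r20 Y0] a.
have shift e : 0 < e ->
    (P1 [set w | (a + 2 * e < X w)%R] <= P2 [set w | (a < Y w)%R])%E.
  move=> e0; apply/lee_addgt0Pr => eps eps0.
  have e20 : 0 < e ^+ 2 by rewrite exprn_gt0.
  have d0 : 0 < (eps / 2) * e ^+ 2 by rewrite mulr_gt0// divr_gt0.
  have [n []] : exists n, (\int[P1]_w ((X w - X_ n w) ^+ 2)%:E <= ((eps / 2) * e ^+ 2)%:E)%E /\
      (\int[P2]_w ((Y w - Y_ n w) ^+ 2)%:E <= ((eps / 2) * e ^+ 2)%:E)%E.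
    near \oo => n; exists n; split.
      apply: le_trans (X0 n) _; rewrite lee_fin; apply: ltW.
      by near: n; apply: cvgr_lt r10 _ d0.
    apply: le_trans (Y0 n) _; rewrite lee_fin; apply: ltW.
    by near: n; apply: cvgr_lt r20 _ d0.
  move=> D1 D2.
  have mXn : measurable_fun setT (fun w => X w - X_ n w) by exact: measurable_funB.
  have mYn : measurable_fun setT (fun w => Y w - Y_ n w) by exact: measurable_funB.
  have C1 : (P1 [set w | (e <= `|X w - X_ n w|)%R] <= (eps / 2)%:E)%E.
    have := le_trans (chebyshev_sqr_le P1 mXn e0) D1.
    by rewrite [leRHS]EFinM muleC lee_pmul2r// lte_fin.
  have C2 : (P2 [set w | (e <= `|Y w - Y_ n w|)%R] <= (eps / 2)%:E)%E.
    have := le_trans (chebyshev_sqr_le P2 mYn e0) D2.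
    by rewrite [leRHS]EFinM muleC lee_pmul2r// lte_fin.
  apply: (@le_trans _ _ (P1 ([set w | (a + e < X_ n w)%R] `|`
      [set w | (e <= `|X w - X_ n w|)%R]))).
    apply: le_measure; rewrite ?inE.
    - exact: measurable_gt.
    - by apply: measurableU; [exact: measurable_gt|exact: measurable_norm_ge].
    - move=> w /= aX; have [h|h] := leP e `|X w - X_ n w|; [by right|left].
      by move: h; rewrite ltr_norml => /andP[_]; lra.
  apply: (le_trans (measureU2 _ _ _)); [exact: measurable_gt|exact: measurable_norm_ge|].
  have E1 : P1 [set w | (a + e < X_ n w)%R] = P2 [set w | (a + e < Y_ n w)%R].
    have := XY n `]a + e, +oo[%classic (measurable_itv _).
    have E d (T : measurableType d) (f : T -> R) :
        f @^-1` `]a + e, +oo[%classic = [set w | a + e < f w].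
      by apply/seteqP; split => w /=; rewrite in_itv /= andbT.
    by rewrite !E.
  have -> : (P2 [set w | (a < Y w)%R] + eps%:E =
    (P2 [set w | (a < Y w)%R] + (eps / 2)%:E) + (eps / 2)%:E)%E.
    by rewrite -addeA -EFinD -splitr.
  apply: leeD; last exact: C1.
  rewrite [leLHS]E1.
  apply: (@le_trans _ _ (P2 ([set w | (a < Y w)%R] `|`
      [set w | (e <= `|Y w - Y_ n w|)%R]))).
    apply: le_measure; rewrite ?inE.
    - exact: measurable_gt.
    - by apply: measurableU; [exact: measurable_gt|exact: measurable_norm_ge].
    - move=> w /= aX; have [h|h] := leP e `|Y w - Y_ n w|; [by right|left].
      by move: h; rewrite ltr_norml => /andP[]; lra.
  apply: (le_trans (measureU2 _ _ _)); [exact: measurable_gt|exact: measurable_norm_ge|].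
  by apply: leeD; last exact: C2.
pose F (j : nat) := [set w | a + 2 * j.+1%:R^-1 < X w].
have UF : [set w | a < X w] = \bigcup_j F j.
  apply/seteqP; split => w /=; last first.
    move=> [j _]; rewrite /F /=; apply: le_lt_trans.
    by rewrite lerDl mulr_ge0.
  move=> aX; have e0 : 0 < (X w - a) / 2 by rewrite divr_gt0// subr_gt0.
  pose j := Num.bound ((X w - a) / 2)^-1.
  have h : j.+1%:R^-1 < (X w - a) / 2.
    rewrite invf_plt ?posrE//; apply: lt_le_trans (archi_boundP _) _.
      by rewrite invr_ge0 ltW.
    by rewrite ler_nat leqnSn.
  by exists j => //; rewrite /F /=; move: (j.+1%:R^-1) h => u; lra.
have cF : P1 \o F @ \oo --> P1 [set w | a < X w].
  rewrite UF; apply: nondecreasing_cvg_mu.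
  - by move=> j; exact: measurable_gt.
  - by apply: bigcup_measurable => j _; exact: measurable_gt.
  - move=> i j ij; apply/subsetPset => w; rewrite /F /=; apply: le_lt_trans.
    by rewrite lerD2l ler_wpM2l// lef_pV2 ?posrE// ler_nat.
rewrite -(cvg_lim _ cF)//; apply: lime_le; first by apply/cvg_ex; eexists; exact: cF.
by apply: nearW => j /=; apply: shift.
Unshelve. all: by end_near. Qed.

End LimitInLaw.

Lemma equal_in_law_limit {R : realType} {d1 d2 : measure_display}
  {T1 : measurableType d1} {T2 : measurableType d2}
  (P1 : probability T1 R) (P2 : probability T2 R)
  (X_ : (T1 -> R)^nat) (X : T1 -> R) (Y_ : (T2 -> R)^nat) (Y : T2 -> R) :
  (forall n, measurable_fun setT (X_ n)) -> measurable_fun setT X ->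
  (forall n, measurable_fun setT (Y_ n)) -> measurable_fun setT Y ->
  (forall n, equal_in_law P1 P2 (X_ n) (Y_ n)) ->
  cvg_L2 P1 X_ X -> cvg_L2 P2 Y_ Y -> equal_in_law P1 P2 X Y.
Proof.
move=> mX_ mX mY_ mY XY cX cY; apply: equal_in_law_itvoy => // a.
apply/eqP; rewrite eq_le; apply/andP; split.
  exact: cvg_L2_tail_le cX cY a.
apply: cvg_L2_tail_le cY cX a => // n A mA.
by rewrite XY.
Qed.

Section NormalMoments.
Context {R : realType}.
Notation mu := (@lebesgue_measure R).

(** The derivative of [- x g(x)] is [x ^ 2 g(x) - g(x)], for [g] the density. *)
Lemma std_normal_second_moment :
  (\int[normal_prob (0 : R) 1]_x (x ^+ 2)%:E = 1)%E.
Proof.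
have msq : measurable_fun setT (fun x : measurableTypeR R => x ^+ 2 : R).
  exact: measurable_funX.
rewrite integral_normal_prob; last 2 first.
- exact/measurable_EFinP.
- by move=> x; rewrite lee_fin sqr_ge0.
pose g (x : R) := std_gauss x.
have dg (x : R) : is_derive x 1 (fun x => - x * g x) (x ^+ 2 * g x - g x).
  have dG := is_derive_std_gauss x.
  by apply: is_derive_eq; rewrite /GRing.scale /= /g; ring.
have ig : mu.-integrable setT (EFin \o g).
  have := integrable_normal_pdf (0 : R) 1.
  by apply: eq_integrable => // x _; rewrite /= normal_pdf01E.
have sqg (x : R) : x ^+ 2 * g x <= 8 * ((Num.sqrt (2 * pi))^-1 * expR (- (4^-1 * x ^+ 2))).
  rewrite /g /std_gauss.
  have -> : - (x ^+ 2 / 2) = - (4^-1 * x ^+ 2) + - (4^-1 * x ^+ 2) by field.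
  rewrite expRD; set q := (Num.sqrt _)^-1; set e := expR _.
  have -> : x ^+ 2 * (q * (e * e)) = (q * e) * (x ^+ 2 * e) by ring.
  rewrite [leRHS]mulrC; apply: ler_wpM2l.
    by rewrite mulr_ge0 ?expR_ge0// invr_ge0 sqrtr_ge0.
  rewrite /e {q e}.
  rewrite expRN ler_pdivrMr ?expR_gt0//.
  have := expR_ge1Dx (4^-1 * x ^+ 2); have := sqr_ge0 x.
  by move: (x ^+ 2) (expR _) => u v; lra.
have g0 (x : R) : 0 <= g x by rewrite ltW// std_gauss_gt0.
have mg : measurable_fun setT g.
  by apply/measurable_EFinP; exact: measurable_int ig.
have isq : mu.-integrable setT (EFin \o (fun x => x ^+ 2 * g x)).
  apply: (@le_integrableR _ _ _ mu _ (fun x => 8 * ((Num.sqrt (2 * pi))^-1 * expR (- (4^-1 * x ^+ 2))))).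
  - by apply: measurable_funM.
  - by move=> x; rewrite ger0_norm ?sqg// mulr_ge0 ?sqr_ge0.
  - do 2 apply: integrableRZ; apply: integrable_expRN_sqr; by rewrite invr_gt0.
have E : \int[mu]_x (x ^+ 2 * g x - g x) = 0.
  apply: (@Rintegral_derive_gauss_eq0 _ _ _ (2 * (Num.sqrt (2 * pi))^-1) 4^-1 _ dg).
  - by rewrite invr_gt0.
  - have cg : continuous g by exact: is_derive_continuous is_derive_std_gauss.
    move=> x; apply: cvgB; last exact: cg.
    by apply: cvgM; [exact: sqr_continuous|exact: cg].
  - exact: integrableRB.
  - move=> x; rewrite normrM normrN (ger0_norm (g0 x)) /g /std_gauss.
    have -> : - (x ^+ 2 / 2) = - (4^-1 * x ^+ 2) + - (4^-1 * x ^+ 2) by field.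
    rewrite expRD; set q := (Num.sqrt _)^-1; set e := expR _.
    have -> : `|x| * (q * (e * e)) = `|x| * e * (q * e) by ring.
    rewrite -[leRHS]mulrA; apply: ler_wpM2r.
      by rewrite mulr_ge0 ?expR_ge0// invr_ge0 sqrtr_ge0.
    rewrite /e expRN ler_pdivrMr ?expR_gt0//.
    have := expR_ge1Dx (4^-1 * x ^+ 2); have := sqr_ge0 (`|x| - 1).
    rewrite sqrrB real_normK ?num_real//; have := sqr_ge0 x.
    by move: (`|x|) (x ^+ 2) (expR _) => v u w; lra.
transitivity (\int[mu]_x (x ^+ 2 * g x)%:E)%E.
  by apply: eq_integral => x _; rewrite normal_pdf01E EFinM.
rewrite EFin_Rintegral//; congr EFin.
have {E} : \int[mu]_x (x ^+ 2 * g x) = \int[mu]_x g x.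
  by move: E; rewrite RintegralB// => /eqP; rewrite subr_eq0 => /eqP.
move=> ->; rewrite /Rintegral.
under eq_integral do rewrite /g -normal_pdf01E.
by rewrite integral_normal_pdf.
Qed.

Context {d : measure_display} {T : measurableType d}.
Variable P : probability T R.
Implicit Types (X Z : T -> R) (s c : R).

Lemma scaled_normal_second_moment X s : measurable_fun setT X ->
  scaled_normal P X s -> (\int[P]_w ((X w) ^+ 2)%:E = (s ^+ 2)%:E)%E.
Proof.
move=> mX lX.
have msq : measurable_fun setT (fun x : R => (x ^+ 2)%:E).
  by apply/measurable_EFinP; exact: measurable_funX.
have ms : measurable_fun setT (fun x : measurableTypeR R => s * x).
  exact: measurable_funM.
rewrite (equal_in_law_ge0_integral mX ms lX msq); last first.
  by move=> x; rewrite lee_fin sqr_ge0.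
transitivity (\int[normal_prob (0 : R) 1]_x ((s ^+ 2)%:E * (x ^+ 2)%:E))%E.
  by apply: eq_integral => x _; rewrite exprMn EFinM.
rewrite ge0_integralZl//.
- by rewrite std_normal_second_moment mule1.
- by move=> x _; rewrite lee_fin sqr_ge0.
- by rewrite lee_fin sqr_ge0.
Qed.

Lemma integrable_of_sqr X : measurable_fun setT X ->
  (\int[P]_w ((X w) ^+ 2)%:E < +oo)%E -> P.-integrable setT (EFin \o X).
Proof.
move=> mX X2; have isq : P.-integrable setT (EFin \o (fun w => (X w) ^+ 2)).
  apply/integrableP; split; first by apply/measurable_EFinP; exact: measurable_funX.
  by under eq_integral do rewrite /= ger0_norm ?sqr_ge0//.
apply: (@le_integrableR _ _ _ P _ (fun w => 1 + (X w) ^+ 2)) => //.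
  move=> w; have := sqr_ge0 (`|X w| - 1); rewrite sqrrB real_normK ?num_real//.
  by have := normr_ge0 (X w); move: (`|X w|) (X w ^+ 2) => u v; lra.
by apply: integrableRD => //; exact: finite_measure_integrable_cst.
Qed.

(** A symmetric law has mean zero. *)
Lemma scaled_normal_mean X s : measurable_fun setT X -> scaled_normal P X s ->
  P.-integrable setT (EFin \o X) /\ (\int[P]_w (X w)%:E = 0)%E.
Proof.
move=> mX lX; have iX : P.-integrable setT (EFin \o X).
  by apply: integrable_of_sqr => //; rewrite (scaled_normal_second_moment mX lX) ltry.
split=> //.
have E : (\int[P]_w (X w)%:E = \int[P]_w (- X w)%:E)%E.
  have mN : measurable_fun setT (fun w => - X w) by exact: measurable_funN.
  apply: (@equal_in_law_integral _ _ _ _ _ P P X (fun w => - X w) id) => //.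
  by move=> A mA; rewrite (lX _ mA) (scaled_normalN lX).
have iN : P.-integrable setT (EFin \o (fun w => - X w)).
  have := integrableRZ (-1) iX.
  by apply: eq_integrable => // w _ /=; rewrite mulN1r.
move: E; rewrite !EFin_Rintegral// => -[].
under [X in _ = X -> _]eq_Rintegral do rewrite -mulN1r.
by rewrite RintegralZl// => E; congr EFin; lra.
Qed.

(** A sequence of centered Gaussian variables that converges almost surely is
    tight, so that its variances are bounded. *)
Lemma scaled_normal_ae_cvg_bounded (S_ : (T -> R)^nat) (s : R^nat) :
  (forall n, measurable_fun setT (S_ n)) -> (forall n, 0 <= s n) ->
  (forall n, scaled_normal P (S_ n) (s n)) ->
  {ae P, forall w, cvgn (S_ ^~ w)} -> exists B, forall n, s n <= B.
Proof.
move=> mS s0 lS cS; apply: contrapT => nB.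
have {}nB B : exists n, B < s n.
  apply: contrapT => h; apply: nB; exists B => n; rewrite leNgt; apply/negP => Bn.
  by apply: h; exists n.
pose E (M : nat) := \bigcap_n [set w | `|S_ n w| <= M%:R].
have mE1 M n : measurable [set w | `|S_ n w| <= M%:R].
  rewrite (_ : [set w | _] = (fun w => `|S_ n w|) @^-1` `]-oo, M%:R]%classic); last first.
    by apply/seteqP; split => w /=; rewrite in_itv /=.
  rewrite -[X in measurable X]setTI.
  have mn : measurable_fun setT (fun w => `|S_ n w|) by exact: measurableT_comp.
  exact: mn.
have mE M : measurable (E M) by apply: bigcap_measurable => // n _.
have P0 M : P (E M) = 0%E.
  apply/eqP; rewrite eq_le measure_ge0 andbT; apply/lee_addgt0Pr => e e0.
  rewrite add0e; have [n hn] := nB (2 * M%:R / e).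
  have sn : 0 < s n.
    by apply: le_lt_trans hn; rewrite divr_ge0 ?mulr_ge0// ltW.
  apply: (@le_trans _ _ (P [set w | `|S_ n w| <= M%:R])).
    by apply: le_measure; rewrite ?inE// => w; apply.
  have -> : P [set w | `|S_ n w| <= M%:R] = normal_prob 0 1 `[- (M%:R / s n), M%:R / s n]%classic.
    have mI : measurable (`[- M%:R, M%:R]%classic : set R) by exact: measurable_itv.
    have := lS n _ mI.
    rewrite (_ : S_ n @^-1` _ = [set w | `|S_ n w| <= M%:R]); last first.
      by apply/seteqP; split => w /=; rewrite in_itv /= ler_norml.
    move=> ->; congr (normal_prob 0 1 _); apply/seteqP; split => x /=; rewrite !in_itv /=.
      by rewrite -mulNr ler_pdivrMr// ler_pdivlMr// [x * _]mulrC.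
    by rewrite -mulNr ler_pdivrMr// ler_pdivlMr// [x * _]mulrC.
  rewrite /normal_prob; set D := `[_, _]%classic.
  apply: (@le_trans _ _ (\int[mu]_(x in D) (1%:E : \bar R)))%E.
    apply: ge0_le_integral => //.
    - exact: measurable_itv.
    - by move=> x _; rewrite lee_fin normal_pdf_ge0.
    - apply: measurable_funS (proj2 (measurable_EFinP _ _) (measurable_normal_pdf 0 1)) => //.
    - move=> x _; rewrite lee_fin.
      apply: le_trans (normal_pdf_ub 0 x (oner_neq0 _)) _.
      rewrite /normal_peak expr1n mul1r invf_le1; last first.
        by rewrite sqrtr_gt0 pmulrn_lgt0// pi_gt0.
      rewrite -[leLHS]sqrtr1 ler_wsqrtr//.
      by have := @pi_ge2 R; rewrite mulr2n; lra.
  rewrite integral_cst; last exact: measurable_itv.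
  have := @lebesgue_measure_itv R `[- (M%:R / s n), M%:R / s n]; rewrite -/D /= lte_fin => lD.
  rewrite mul1e; apply: le_trans (_ : (lebesgue_measure D <= _)%E) _; first exact: lexx.
  rewrite lD.
  case: ifP => _; last by rewrite lee_fin ltW.
  rewrite -EFinD lee_fin opprK.
  have h : M%:R / s n <= e / 2.
    move: hn; rewrite ltr_pdivrMr// ler_pdivrMr// => hn; lra.
  by apply: le_trans (lerD h h) _; rewrite -splitr.
have : P setT = 0%E.
  apply: measure_negligible => //.
  have nE : P.-negligible (\bigcup_M E M).
    apply: negligible_bigcup => M.
    by apply/negligibleP => //; exact: P0.
  case: cS => N [mN PN0 subN]; have nN : P.-negligible N.
    by exists N; split => //; exact: subset_refl.
  have := negligibleU nE nN; apply: negligibleS => w _ /=.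
  have [Nw|Nw] := pselect (N w); [by right|left].
  have cw : cvgn (S_ ^~ w).
    by apply: contrapT => h; apply: Nw; apply: subN.
  have [M [_ MB]] := cvg_seq_bounded cw.
  exists (Num.bound (`|M| + 1)) => // n _ /=.
  apply: (@le_trans _ _ (`|M| + 1)).
    by apply: MB => //; rewrite (le_lt_trans (ler_norm M))// ltrDl.
  by apply: ltW; apply: archi_boundP; rewrite addr_ge0.
by rewrite probability_setT => /eqP; rewrite onee_eq0.
Qed.

End NormalMoments.

(** * Sequences of independent standard normal variables *)
Section SequenceSpace.
Context {R : realType}.

(** The finite-dimensional cylinders with measurable sides, a base of the
    product sigma-algebra on the space of real sequences. *)
Definition cylinders : set (set (nat -> R)) :=
  [set C | exists n (B : nat -> set R), (forall i, measurable (B i)) /\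
     C = [set z | forall i, (i < n)%N -> B i (z i)]].

Definition seq_space := g_sigma_algebraType cylinders.

Lemma cylinders_setI_closed : setI_closed cylinders.
Proof.
move=> _ _ [n [B [mB ->]]] [m [D [mD ->]]].
exists (maxn n m), (fun i => (if (i < n)%N then B i else setT) `&`
   (if (i < m)%N then D i else setT)); split.
  by move=> i; apply: measurableI; case: ifP.
apply/seteqP; split => z /=.
  move=> [h1 h2] i _; split; case: ifP => //; [exact: h1|exact: h2].
move=> h; split => i im.
  by have [] := h i; rewrite ?leq_max ?im// => + _.
by have [] := h i; rewrite ?leq_max ?im ?orbT// => _ +.
Qed.

Lemma cylinders_setT : cylinders setT.
Proof.
exists 0%N, (fun=> setT); split => [//|].
by apply/seteqP; split.
Qed.

Lemma measurable_coord k : measurable_fun setT (fun z : seq_space => z k).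
Proof.
move=> _ B mB; rewrite setTI; apply: sub_sigma_algebra.
exists k.+1, (fun i => if i == k then B else setT); split.
  by move=> i; case: ifP.
apply/seteqP; split => z /=.
  by move=> Bz i _; case: eqP => [->|].
by move=> /(_ k (ltnSn k)); rewrite eqxx.
Qed.

Context {d : measure_display} {T : measurableType d}.

Lemma measurable_cylinder (X : nat -> T -> R) n (B : nat -> set R) :
  (forall k, measurable_fun setT (X k)) -> (forall i, measurable (B i)) ->
  measurable [set w | forall i, (i < n)%N -> B i (X i w)].
Proof.
move=> mX mB.
rewrite (_ : [set w | _] = \bigcap_i ([set w | (i < n)%N -> B i (X i w)])); last first.
  by apply/seteqP; split => w /= h i; [move=> _; exact: h|exact: (h i I)].
apply: bigcapT_measurable => i; have [lt_in|ge_in] := boolP (i < n)%N.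
  rewrite (_ : [set w | _] = setT `&` X i @^-1` B i); first exact: mX.
  by rewrite setTI; apply/seteqP; split => w /= h; [exact: h|].
by rewrite (_ : [set w | _] = setT)//; apply/seteqP; split.
Qed.

Lemma measurable_seq_space (X : nat -> T -> R) :
  (forall k, measurable_fun setT (X k)) ->
  measurable_fun setT (fun w => (fun k => X k w) : seq_space).
Proof.
move=> mX; apply: (@measurability _ _ T seq_space setT _ cylinders) => //.
move=> _ [_ [n [B [mB ->]]] <-]; rewrite setTI.
exact: measurable_cylinder.
Qed.

Variable P : probability T R.

Lemma seq_space_law_unique (X X' : T -> seq_space) :
  measurable_fun setT X -> measurable_fun setT X' ->
  (forall C, cylinders C -> P (X @^-1` C) = P (X' @^-1` C)) ->
  forall C, measurable C -> P (X @^-1` C) = P (X' @^-1` C).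
Proof.
move=> mX mX' XX' C mC.
pose mf : {mfun T >-> seq_space} := mfun_Sub (mem_set mX).
pose mf' : {mfun T >-> seq_space} := mfun_Sub (mem_set mX').
apply: (@measure_unique _ R seq_space cylinders (fun=> setT) _ _ _ _
  (distribution P mf) (distribution P mf') _ _ C mC) => //.
- exact: cylinders_setI_closed.
- by move=> _; exact: cylinders_setT.
- by apply/seteqP; split => // z _; exists 0%N.
- by move=> k; rewrite (le_lt_trans (probability_le1 _ _))// ltry.
Qed.

Let seq_space_indep1 (X : T -> seq_space) (A : set T) :
  measurable_fun setT X -> measurable A ->
  (forall C, cylinders C -> P (X @^-1` C `&` A) = (P (X @^-1` C) * P A)%E) ->
  forall C, measurable C -> P (X @^-1` C `&` A) = (P (X @^-1` C) * P A)%E.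
Proof.
move=> mX mA XA C mC.
pose mf : {mfun T >-> seq_space} := mfun_Sub (mem_set mX).
have fA : P A \is a fin_num by exact: fin_num_measure.
have rA : 0 <= fine (P A) by rewrite fine_ge0.
rewrite muleC -(fineK fA).
apply: (@measure_unique _ R seq_space cylinders (fun=> setT) _ _ _ _
  (pushforward (mrestr P mA) mf) (mscale (NngNum rA) (distribution P mf)) _ _ C mC) => //.
- exact: cylinders_setI_closed.
- by move=> _; exact: cylinders_setT.
- by apply/seteqP; split => // z _; exists 0%N.
- move=> D cD; change (P (X @^-1` D `&` A) = ((fine (P A))%:E * P (X @^-1` D))%E).
  by rewrite fineK// muleC; exact: XA.
- move=> k; change (P (X @^-1` setT `&` A) < +oo)%E.
  by rewrite preimage_setT setTI ltey_eq fA.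
Qed.

(** Independence of two random sequences is decided by the pi-system of the
    cylinders, once in each variable. *)
Lemma seq_space_independent (X X' : T -> seq_space) :
  measurable_fun setT X -> measurable_fun setT X' ->
  (forall C C', cylinders C -> cylinders C' ->
     P (X @^-1` C `&` X' @^-1` C') = (P (X @^-1` C) * P (X' @^-1` C'))%E) ->
  forall C C', measurable C -> measurable C' ->
    P (X @^-1` C `&` X' @^-1` C') = (P (X @^-1` C) * P (X' @^-1` C'))%E.
Proof.
move=> mX mX' XX' C C' mC mC'.
have mP (Y : T -> seq_space) (D : set seq_space) : measurable_fun setT Y ->
    measurable D -> measurable (Y @^-1` D).
  by move=> mY mD; rewrite -[X in measurable X]setTI; exact: mY.
apply: seq_space_indep1 => //; first exact: mP.
move=> D cD; rewrite setIC muleC; apply: seq_space_indep1 => //.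
  by apply: mP => //; exact: sub_sigma_algebra.
by move=> D' cD'; rewrite setIC muleC; exact: XX'.
Qed.

End SequenceSpace.
Arguments seq_space : clear implicits.

Section StandardNormalSequence.
Context {R : realType} {d : measure_display} {T : measurableType d}.
Variables (P : probability T R) (zeta : nat -> T -> R).
Hypothesis hzeta : iid_standard_normal P zeta.

Lemma measurable_zeta k : measurable_fun setT (zeta k).
Proof. by have [_ /(_ k) []] := hzeta. Qed.
#[local] Hint Resolve measurable_zeta : core.

Lemma zeta_cylinder n (B : nat -> set R) : (forall i, measurable (B i)) ->
  P [set w | forall i, (i < n)%N -> B i (zeta i w)] =
  (\prod_(0 <= i < n) P (zeta i @^-1` B i))%E.
Proof.
move=> mB; have [ind _] := hzeta.
rewrite /index_iota subn0 -(ind (iota 0 n) B (iota_uniq 0 n) mB).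
congr (P _); apply/seteqP; split => w /= h i.
  by rewrite /= mem_iota add0n => /andP[_]; exact: h.
by move=> lt_in; apply: h; rewrite /= mem_iota add0n.
Qed.

(** A block of variables is encoded as a full sequence, so that functions of
    disjoint blocks live on the same space. *)
Definition masked (M : pred nat) (w : T) : seq_space R :=
  fun k => if M k then zeta k w else 0.

Lemma measurable_masked M : measurable_fun setT (masked M).
Proof. by apply: measurable_seq_space => k; case: (M k). Qed.

(** Each variable [zeta k] enters at most one of the two masked sequences; the
    other one is constant there, and a constant is independent of everything. *)
Lemma masked_independent (M M' : pred nat) : (forall k, ~~ (M k && M' k)) ->
  forall C C', measurable C -> measurable C' ->
    P (masked M @^-1` C `&` masked M' @^-1` C') =
    (P (masked M @^-1` C) * P (masked M' @^-1` C'))%E.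
Proof.
move=> MM'; apply: seq_space_independent => [||C C' cC cC'].
- exact: measurable_masked.
- exact: measurable_masked.
have [N [B [mB ->]]] := cC; have [N' [B' [mB' ->]]] := cC'.
(* both cylinders are described with the same number of coordinates *)
pose n := maxn N N'.
pose D (L : pred nat) (m : nat) (A : nat -> set R) i : set R :=
  [set y | (i < m)%N -> A i (if L i then y else 0)].
have mD L m A i : (forall i, measurable (A i)) -> measurable (D L m A i).
  move=> mA; rewrite /D; case: (i < m)%N => /=; last first.
    by rewrite (_ : [set y | _] = setT)//; apply/seteqP; split.
  rewrite (_ : [set y | _] = setT `&` (fun y : R => if L i then y else 0) @^-1` A i).
    have : measurable_fun setT (fun y : R => if L i then y else 0) by case: (L i).
    exact.
  by rewrite setTI; apply/seteqP; split => y /= h; [exact: h|].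
have E L m A : (m <= n)%N -> masked L @^-1` [set z | forall i, (i < m)%N -> A i (z i)] =
    [set w | forall i, (i < n)%N -> D L m A i (zeta i w)].
  move=> mn; apply/seteqP; split => w /= h i.
    by move=> _ im; exact: h.
  by move=> im; apply: (h i) => //; exact: leq_trans mn.
rewrite !E ?leq_maxl ?leq_maxr//.
rewrite (_ : _ `&` _ = [set w | forall i, (i < n)%N ->
    (D M N B i `&` D M' N' B' i) (zeta i w)]); last first.
  apply/seteqP; split => w /=.
    by move=> [h1 h2] i lt_in; split; [exact: h1|exact: h2].
  by move=> h; split => i lt_in; have [] := h i lt_in.
have m1 i : measurable (D M N B i) by exact: mD.
have m2 i : measurable (D M' N' B' i) by exact: mD.
have m3 i : measurable (D M N B i `&` D M' N' B' i) by exact: measurableI.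
rewrite (zeta_cylinder n m1) (zeta_cylinder n m2) (zeta_cylinder n m3).
rewrite -big_split/=; apply: eq_bigr => i _.
  have cst L m A : L i = false -> D L m A i = setT \/ D L m A i = set0.
    move=> Li; rewrite /D Li; have [h|h] := pselect ((i < m)%N -> A i 0).
      by left; apply/seteqP; split.
    by right; apply/seteqP; split.
  have [Mi|Mi] := boolP (M i).
    have M'i : M' i = false by apply/negbTE; have := MM' i; rewrite Mi.
    have [->|->] := cst M' N' B' M'i.
      by rewrite setIT preimage_setT probability_setT mule1.
    by rewrite setI0 preimage_set0 measure0 mule0.
  have [->|->] := cst M N B (negbTE Mi).
    by rewrite setTI preimage_setT probability_setT mul1e.
  by rewrite set0I preimage_set0 measure0 mul0e.
Qed.

(** The standard normal law is symmetric, so that alternating the signs does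
    not change the law of the whole sequence. *)
Lemma alternating_law (C : set (seq_space R)) : measurable C ->
  P ((fun w => (fun k => (-1) ^+ k * zeta k w) : seq_space R) @^-1` C) =
  P ((fun w => (fun k => zeta k w) : seq_space R) @^-1` C).
Proof.
move: C; apply: seq_space_law_unique.
- by apply: measurable_seq_space => k; exact: measurable_funM.
- exact: measurable_seq_space.
move=> _ [n [B [mB ->]]].
pose D i : set R := [set y | B i ((-1) ^+ i * y)].
have mD i : measurable (D i).
  rewrite (_ : D i = setT `&` (fun y : R => (-1) ^+ i * y) @^-1` B i) ?setTI//.
  have : measurable_fun setT (fun y : R => (-1) ^+ i * y) by exact: measurable_funM.
  by move=> /(_ measurableT _ (mB i)); rewrite setTI.
rewrite -[LHS]/(P [set w | forall i, (i < n)%N -> D i (zeta i w)]).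
rewrite -[RHS]/(P [set w | forall i, (i < n)%N -> B i (zeta i w)]).
rewrite !zeta_cylinder//; apply: eq_bigr => i _.
have [_ /(_ i)[_ lz]] := hzeta; rewrite !lz// /D -signr_odd.
case: (odd i); rewrite ?expr1 ?expr0.
  rewrite -[RHS]normal_prob_opp//; congr (normal_prob 0 1 _).
  by apply/seteqP; split => y /=; rewrite mulN1r.
by congr (normal_prob 0 1 _); apply/seteqP; split => y /=; rewrite mul1r.
Qed.

Lemma zeta_scaled_normal k : scaled_normal P (zeta k) 1.
Proof.
move=> A mA; have [_ /(_ k)[_ ->//]] := hzeta.
by congr (normal_prob 0 1 _); apply/seteqP; split => y /=; rewrite mul1r.
Qed.

Definition zeta_sum (c : nat -> R) : (T -> R)^nat :=
  fun n w => \sum_(k < n) c k * zeta k w.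

Lemma measurable_zeta_sum c n : measurable_fun setT (zeta_sum c n).
Proof. by apply: measurable_sum => k; exact: measurable_funM. Qed.

Lemma zeta_sum_scaled_normal (c : nat -> R) n :
  scaled_normal P (zeta_sum c n) (Num.sqrt (\sum_(k < n) (c k) ^+ 2)).
Proof.
rewrite /zeta_sum; elim: n => [|n IH].
  rewrite big_ord0 sqrtr0; under eq_fun do rewrite big_ord0.
  exact: scaled_normal_cst0.
rewrite big_ord_recr/=; under eq_fun do rewrite big_ord_recr/=.
have s0 : 0 <= \sum_(k < n) (c k) ^+ 2 by apply: sumr_ge0 => k _; exact: sqr_ge0.
rewrite -[X in Num.sqrt (X + _)](sqr_sqrtr s0).
apply: (scaled_normalD _ _ _ _ IH (zeta_scaled_normal n)) => //.
  exact: measurable_zeta_sum.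
move=> A B mA mB.
pose f (z : seq_space R) := \sum_(k < n) c k * z k.
have mf : measurable_fun setT f.
  by apply: measurable_sum => k; apply: measurable_funM => //; exact: measurable_coord.
have mfA : measurable (f @^-1` A) by rewrite -[X in measurable X]setTI; exact: mf.
have mgB : measurable ((fun z : seq_space R => z n) @^-1` B).
  by rewrite -[X in measurable X]setTI; exact: measurable_coord.
have := @masked_independent (fun k => (k < n)%N) (pred1 n) _ _ _ mfA mgB.
rewrite (_ : masked _ @^-1` _ = (fun w => \sum_(k < n) c k * zeta k w) @^-1` A); last first.
  have fE w : f (masked (fun k => (k < n)%N) w) = \sum_(k < n) c k * zeta k w.
    by apply: eq_bigr => k _; rewrite /masked ltn_ord.
  by apply/seteqP; split => w; rewrite /preimage /= fE.
rewrite (_ : masked (pred1 n) @^-1` _ = zeta n @^-1` B); last first.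
  by apply/seteqP; split => w; rewrite /masked /= eqxx.
by apply => k /=; case: eqP => [->|_]; rewrite ?ltnn ?andbF.
Qed.

End StandardNormalSequence.

(** * Moments of products of points *)
Section ProductOfPoints.
Context {R : realType}.

Section Enumeration.
Context {d : measure_display} {T : measurableType d}.
Variables (pres : nat -> set T) (xi : nat -> T -> R).
Hypothesis hxi : point_process pres xi.

Lemma measurable_partial_product (f : R -> R) n : measurable_fun setT f ->
  measurable_fun setT (fun w => partial_product pres xi f w n).
Proof.
move=> mf; apply: measurable_prod => j _; have [mp mx _] := hxi j.
rewrite (_ : (fun w => _) = fun w => \1_(pres j) w * f (xi j w) + (1 - \1_(pres j) w)).
  apply: measurable_funD.
    by apply: measurable_funM; [exact: measurable_indic|exact: measurableT_comp].
  by apply: measurable_funB => //; exact: measurable_indic.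
apply/funext => w; rewrite indicE; case: (w \in pres j).
  by rewrite mul1r subrr addr0.
by rewrite mul0r add0r subr0.
Qed.

Lemma measurable_points_product (f : R -> R) : measurable_fun setT f ->
  measurable_fun setT (points_product pres xi f).
Proof.
move=> mf; apply: measurable_fun_limn => n; exact: measurable_partial_product.
Qed.

Lemma partial_product_exp k w :
  partial_product pres xi (fun x => x ^+ k) w =
  (fun n => partial_product pres xi id w n ^+ k).
Proof.
apply/funext => n; rewrite /partial_product -prodrXl.
by apply: eq_bigr => j _; case: ifP => // _; rewrite expr1n.
Qed.

Lemma partial_product_cvg_exp k w : cvgn (partial_product pres xi id w) ->
  partial_product pres xi (fun x => x ^+ k) w @ \oo -->
  points_product pres xi id w ^+ k.
Proof.
move=> cw; rewrite partial_product_exp.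
by apply: (cvg_comp _ (fun x : R => x ^+ k) cw); exact: exprn_continuous.
Qed.

Lemma points_product_le1 w : cvgn (partial_product pres xi id w) ->
  `|points_product pres xi id w| <= 1.
Proof.
move=> cw.
have cn : (fun n => `|partial_product pres xi id w n|) @ \oo -->
    `|points_product pres xi id w| by exact: cvg_norm.
rewrite -(cvg_lim _ cn)//; apply: limr_le; first by apply/cvg_ex; eexists; exact: cn.
apply: nearW => n; rewrite /= /partial_product normr_prod.
rewrite -[leRHS](@big1_eq R 1 *%R _ (index_enum 'I_n) xpredT); apply: ler_prod => j _.
rewrite normr_ge0 /=; case: ifP => _; last by rewrite normr1.
by have [_ _ /(_ w)] := hxi j; rewrite in_itv /= ler_norml.
Qed.

End Enumeration.

Context {d : measure_display} {T : measurableType d}.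
Variables (P : probability T R) (Y : {RV P >-> R}) (G : (R -> R) -> \bar R).
Hypothesis hY : law_of_product_of_points P Y G.

Let mY : measurable_fun setT (Y : T -> R).
Proof. by []. Qed.

Lemma product_of_points_le1 : {ae P, forall w, `|Y w| <= 1}.
Proof.
have [d' [T' [Q [pres [xi [hxi _ cxi lY]]]]]] := hY.
have mA : measurable (~` [set x : R | `|x| <= 1]).
  apply: measurableC; rewrite (_ : [set x | _] = `[-1, 1]%classic) //.
  by apply/seteqP; split => x /=; rewrite in_itv /= ler_norml.
exists (Y @^-1` (~` [set x : R | `|x| <= 1])); split => //.
  by rewrite -[X in measurable X]setTI; exact: mY.
rewrite lY//; apply: (measure_negligible (mu := Q)).
  rewrite -[X in measurable X]setTI.
  exact: (measurable_points_product hxi (f := id)).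
case: cxi => N [mN N0 sN]; exists N; split => // w /= h; apply: sN => /= cw.
by apply: h; apply: points_product_le1 cw.
Qed.

(** The powers are admissible test functions: they are bounded by 1, and the
    products of the powers of the points are the powers of the products. *)
Lemma product_of_points_moment k : 'E_P[fun w => (Y w ^+ k)%R]%E = G (fun x => x ^+ k).
Proof.
have [d' [T' [Q [pres [xi [hxi GQ cxi lY]]]]]] := hY.
have mX (n : nat) : measurable_fun setT (fun x : R => x ^+ n) by exact: measurable_funX.
have ck : as_product_converges Q pres xi (fun x => x ^+ k).
  apply: filterS cxi => w cw; apply/cvg_ex; eexists.
  exact: partial_product_cvg_exp cw.
rewrite -(GQ (fun x => x ^+ k))//; last first.
  by move=> x; rewrite in_itv /= -ler_norml normrX => x1; rewrite exprn_ile1.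
rewrite !unlock.
have mP : measurable_fun setT (points_product pres xi id).
  exact: (measurable_points_product hxi (f := id)).
transitivity (\int[Q]_w (points_product pres xi id w ^+ k)%:E)%E.
  exact: (@equal_in_law_integral _ _ _ _ _ P Q Y _ (fun x => x ^+ k)).
apply: ae_eq_integral => //.
- by apply/measurable_EFinP; exact: measurable_funX.
- by apply/measurable_EFinP; exact: measurable_points_product.
- apply: filterS cxi => w cw _ /=; congr EFin.
  by apply/esym/cvg_lim => //; exact: partial_product_cvg_exp.
Qed.

End ProductOfPoints.

Section Moments.
Context {R : realType} {d1 : measure_display} {T1 : measurableType d1}.
Variables (P1 : probability T1 R) (Y : T1 -> R).
Hypotheses (mY : measurable_fun setT Y) (Y1 : {ae P1, forall w, `|Y w| <= 1}).

Lemma integrable_exp_le1 k : P1.-integrable setT (EFin \o (fun w => Y w ^+ k)).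
Proof.
apply: (@ae_eq_integrable _ _ _ P1 (fun w => Num.max (-1) (Num.min (Y w ^+ k) 1))).
- by apply: measurable_maxr => //; apply: measurable_minr => //; exact: measurable_funX.
- exact: measurable_funX.
- apply: filterS Y1 => w Yw; have : `|Y w ^+ k| <= 1 by rewrite normrX exprn_ile1.
  by rewrite ler_norml => /andP[h1 h2]; rewrite min_l// max_r.
apply: (@le_integrableR _ _ _ P1 _ (cst 1)).
- by apply: measurable_maxr => //; apply: measurable_minr => //; exact: measurable_funX.
- by move=> w; rewrite /cst ler_norml le_max ge_max ge_min lexx /= lexx !orbT /= andbT; lra.
- exact: finite_measure_integrable_cst.
Qed.

End Moments.

Section HalfMoments.
Context {R : realType} (nu : {measure set R -> \bar R}).
Context {d1 : measure_display} {T1 : measurableType d1} {P1 : probability T1 R}.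
Variable Y : {RV P1 >-> R}.
Hypothesis hY : law_of_product_of_points P1 Y (pgfl_nu nu).
Context {d2 : measure_display} {T2 : measurableType d2} {P2 : probability T2 R}.
Variable Yhalf : {RV P2 >-> R}.
Hypothesis hYhalf : law_of_product_of_points P2 Yhalf
  (fun f => (pgfl_nu nu f `^ 2^-1)%E).

Lemma product_of_points_moment_ge0 k : 0 <= \int[P1]_w (Y w ^+ k).
Proof.
have := product_of_points_moment hY k; rewrite unlock /Rintegral => ->.
rewrite fine_ge0// /pgfl_nu inve_ge0 adde_ge0//; apply: integral_ge0 => x /=.
rewrite in_itv /= -ler_norml => x1; rewrite lee_fin subr_ge0.
by apply: le_trans (ler_norm _) _; rewrite normrX exprn_ile1.
Qed.

Lemma moment_half k : moment P2 Yhalf k = Num.sqrt (\int[P1]_w (Y w ^+ k)).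
Proof.
rewrite /moment (product_of_points_moment hYhalf k) /=.
rewrite -(product_of_points_moment hY k) unlock EFin_Rintegral; last first.
  exact: integrable_exp_le1 (product_of_points_le1 hY) k.
by rewrite poweR_EFin /= powR12_sqrt// product_of_points_moment_ge0.
Qed.

Lemma moment_half_sqr k : moment P2 Yhalf k ^+ 2 = \int[P1]_w (Y w ^+ k).
Proof. by rewrite moment_half sqr_sqrtr// product_of_points_moment_ge0. Qed.

End HalfMoments.

(** * Mean square sums of independent normal variables *)
Lemma sqrD_le {R : realDomainType} (x y : R) : (x + y) ^+ 2 <= 2 * x ^+ 2 + 2 * y ^+ 2.
Proof. by have := sqr_ge0 (x - y); rewrite sqrrB sqrrD; lra. Qed.

Section SquareIntegrable.
Context {R : realType} {d : measure_display} {T : measurableType d}.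
Variable P : probability T R.
Implicit Types (X Y : T -> R) (r s : R).

Lemma second_momentZ X r : measurable_fun setT X ->
  (\int[P]_w ((r * X w) ^+ 2)%:E = (r ^+ 2)%:E * \int[P]_w (X w ^+ 2)%:E)%E.
Proof.
move=> mX; rewrite -ge0_integralZl//.
- by apply: eq_integral => w _; rewrite exprMn EFinM.
- by apply/measurable_EFinP; exact: measurable_funX.
- by move=> w _; rewrite lee_fin sqr_ge0.
- by rewrite lee_fin sqr_ge0.
Qed.

Lemma second_momentD_le X Y r s : measurable_fun setT X -> measurable_fun setT Y ->
  (\int[P]_w (X w ^+ 2)%:E <= r%:E)%E -> (\int[P]_w (Y w ^+ 2)%:E <= s%:E)%E ->
  (\int[P]_w ((X w + Y w) ^+ 2)%:E <= (2 * r + 2 * s)%:E)%E.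
Proof.
move=> mX mY Xr Ys.
have mX2 : measurable_fun setT (fun w => X w ^+ 2) by exact: measurable_funX.
have mY2 : measurable_fun setT (fun w => Y w ^+ 2) by exact: measurable_funX.
apply: (@le_trans _ _ (\int[P]_w (2%:E * (X w ^+ 2)%:E + 2%:E * (Y w ^+ 2)%:E))%E).
  apply: ge0_le_integral => //.
  - by move=> w _; rewrite lee_fin sqr_ge0.
  - by apply/measurable_EFinP; apply: measurable_funX; exact: measurable_funD.
  - by apply: emeasurable_funD; apply: emeasurable_funM => //; exact/measurable_EFinP.
  - by move=> w _; rewrite -!EFinM -EFinD lee_fin sqrD_le.
have ZE (Z : T -> R) : measurable_fun setT (fun w => Z w ^+ 2) ->
    (\int[P]_w (2%:E * (Z w ^+ 2)%:E) = 2%:E * \int[P]_w (Z w ^+ 2)%:E)%E.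
  move=> mZ; rewrite ge0_integralZl//; first exact/measurable_EFinP.
  by move=> w _; rewrite lee_fin sqr_ge0.
rewrite ge0_integralD//.
- by rewrite !ZE// (_ : (2 * r + 2 * s)%:E = 2%:E * r%:E + 2%:E * s%:E)%E;
    [apply: leeD; apply: lee_wpmul2l|rewrite -!EFinM -EFinD].
- by move=> w _; rewrite -EFinM lee_fin mulr_ge0// sqr_ge0.
- by apply: emeasurable_funM => //; exact/measurable_EFinP.
- by move=> w _; rewrite -EFinM lee_fin mulr_ge0// sqr_ge0.
- by apply: emeasurable_funM => //; exact/measurable_EFinP.
Qed.

End SquareIntegrable.

Section LinearFunctional.
Context {R : realType} {d : measure_display} {T : measurableType d}.
Variables (P : probability T R) (zeta : nat -> T -> R).
Hypothesis hzeta : iid_standard_normal P zeta.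
Implicit Types (X Y : T -> R) (a b : nat -> R).

#[local] Hint Extern 0 (measurable_fun _ (zeta _)) => exact: measurable_zeta hzeta : core.

Notation zeta_sum := (zeta_sum zeta).

#[local] Hint Extern 0 (measurable_fun _ (zeta_sum _ _)) =>
  exact: measurable_zeta_sum hzeta _ _ : core.

Definition sum_sqr a : R^nat := fun n => \sum_(k < n) a k ^+ 2.

(** [X] is the mean square sum of the series of the [a k * zeta k].  The
    coefficients carry the whole covariance structure of such variables. *)
Definition zeta_series a X := measurable_fun setT X /\ cvg_L2 P (zeta_sum a) X.

Lemma sum_sqr_ge0 a n : 0 <= sum_sqr a n.
Proof. by apply: sumr_ge0 => k _; exact: sqr_ge0. Qed.

Lemma sum_sqr_nondecreasing a : {homo sum_sqr a : n m / (n <= m)%N >-> n <= m}.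
Proof.
apply/nondecreasing_seqP => n; rewrite /sum_sqr big_ord_recr /= lerDl; exact: sqr_ge0.
Qed.

Lemma zeta_sum_second_moment a n :
  (\int[P]_w (zeta_sum a n w ^+ 2)%:E = (sum_sqr a n)%:E)%E.
Proof.
rewrite (scaled_normal_second_moment _ (zeta_sum_scaled_normal hzeta a n)).
  by rewrite sqr_sqrtr// sum_sqr_ge0.
exact: measurable_zeta_sum hzeta a n.
Qed.

Lemma zeta_series_sqr_le a X : zeta_series a X ->
  exists B, (\int[P]_w (X w ^+ 2)%:E <= B%:E)%E.
Proof.
move=> [mX [r r0 Xr]]; exists (r 0%N); apply: le_trans (Xr 0%N).
by rewrite le_eqVlt; apply/orP; left; apply/eqP; apply: eq_integral => w _;
  rewrite /zeta_sum big_ord0 subr0.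
Qed.

Lemma sum_sqr_bounded_cvg a B : (forall n, sum_sqr a n <= B) -> cvgn (sum_sqr a).
Proof.
move=> aB; apply: nondecreasing_is_cvgn; first exact: sum_sqr_nondecreasing.
by exists B => _ [n _ <-].
Qed.

(** The variances of the partial sums are bounded, because the partial sums stay
    at a bounded distance from [X]. *)
Lemma zeta_series_sum_sqr_cvg a X : zeta_series a X -> cvgn (sum_sqr a).
Proof.
move=> zX; have [B XB] := zeta_series_sqr_le zX; have [mX [r r0 Xr]] := zX.
have cr : cvgn r by apply/cvg_ex; exists 0.
have [M [_ MB]] := cvg_seq_bounded cr.
apply: (@sum_sqr_bounded_cvg _ (2 * B + 2 * (M + 1))) => n.
rewrite -lee_fin -zeta_sum_second_moment.
have rn : (\int[P]_w ((- (X w - zeta_sum a n w)) ^+ 2)%:E <= (M + 1)%:E)%E.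
  under eq_integral do rewrite sqrrN.
  apply: le_trans (Xr n) _; rewrite lee_fin; apply: le_trans (ler_norm _) _.
  by apply: MB => //; rewrite ltrDl.
have mD : measurable_fun setT (fun w => - (X w - zeta_sum a n w)).
  by apply: measurable_funN; exact: measurable_funB.
have := second_momentD_le mX mD XB rn.
by under eq_integral do rewrite opprB addrC subrK.
Qed.

(** The partial sums have the law of [s_ n * N] for one normal variable [N], and
    these converge in mean square as well. *)
Lemma zeta_series_scaled_normal a X : zeta_series a X ->
  scaled_normal P X (Num.sqrt (limn (sum_sqr a))).
Proof.
move=> zX; have ca := zeta_series_sum_sqr_cvg zX; have [mX cX] := zX.
set s := Num.sqrt _.
pose s_ n := Num.sqrt (sum_sqr a n).
have cs : s_ @ \oo --> s by apply: (cvg_comp _ Num.sqrt ca); exact: sqrt_continuous.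
have mM c : measurable_fun setT (fun x : measurableTypeR R => c * x).
  exact: measurable_funM.
apply: (@equal_in_law_limit _ _ _ _ _ P (normal_prob 0 1) (zeta_sum a) X
  (fun n x => s_ n * x)) => //.
  by move=> n; exact: zeta_sum_scaled_normal.
exists (fun n => (s - s_ n) ^+ 2).
  have c0 : (fun n => s - s_ n) @ \oo --> (0 : R).
    by rewrite -[X in _ --> X](subrr s); apply: cvgB => //; exact: cvg_cst.
  rewrite -[X in _ --> X](mulr0 (0 : R)).
  by under eq_fun do rewrite expr2; apply: cvgM.
move=> n; under eq_integral do rewrite -mulrBl.
rewrite (@second_momentZ _ _ _ (normal_prob 0 1) (fun x => x))//.
by rewrite std_normal_second_moment mule1.
Qed.

Lemma zeta_series_second_moment a X : zeta_series a X ->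
  (\int[P]_w (X w ^+ 2)%:E = (limn (sum_sqr a))%:E)%E.
Proof.
move=> zX; have lX := zeta_series_scaled_normal zX.
rewrite (scaled_normal_second_moment zX.1 lX) sqr_sqrtr//.
apply: limr_ge; first exact: zeta_series_sum_sqr_cvg zX.
by apply: nearW => n; exact: sum_sqr_ge0.
Qed.

Lemma zeta_series_mean a X : zeta_series a X ->
  P.-integrable setT (EFin \o X) /\ \int[P]_w X w = 0.
Proof.
move=> zX; have [iX X0] := scaled_normal_mean zX.1 (zeta_series_scaled_normal zX).
by split => //; rewrite /Rintegral X0.
Qed.

Lemma zeta_series_sqr a X : zeta_series a X ->
  P.-integrable setT (EFin \o (fun w => X w ^+ 2)) /\
  sum_sqr a @ \oo --> \int[P]_w (X w ^+ 2).
Proof.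
move=> zX; have m2 := zeta_series_second_moment zX; split.
  apply/integrableP; split.
    by apply/measurable_EFinP; apply: measurable_funX; exact: zX.1.
  by under eq_integral do rewrite /= ger0_norm ?sqr_ge0//; rewrite m2 ltry.
by rewrite /Rintegral m2 /=; exact: zeta_series_sum_sqr_cvg zX.
Qed.

Lemma zeta_series0 : zeta_series (fun=> 0) (fun=> 0).
Proof.
split => //; exists (fun=> 0); first exact: cvg_cst.
move=> n; rewrite integral0_eq// => w _.
by rewrite /zeta_sum big1 ?subr0 ?expr0n// => k _; rewrite mul0r.
Qed.

Lemma zeta_seriesD a b X Y : zeta_series a X -> zeta_series b Y ->
  zeta_series (fun k => a k + b k) (fun w => X w + Y w).
Proof.
move=> [mX [r r0 Xr]] [mY [s s0 Ys]]; split; first exact: measurable_funD.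
exists (fun n => 2 * r n + 2 * s n).
  rewrite -[X in _ --> X](addr0 0) -[X in _ --> X + _](mulr0 2) -[X in _ --> _ + X](mulr0 2).
  by apply: cvgD; apply: cvgMr.
move=> n.
have mXn : measurable_fun setT (fun w => X w - zeta_sum a n w) by exact: measurable_funB.
have mYn : measurable_fun setT (fun w => Y w - zeta_sum b n w) by exact: measurable_funB.
have := second_momentD_le mXn mYn (Xr n) (Ys n).
rewrite (@eq_integral _ _ _ P _ (fun w => ((X w + Y w -
  zeta_sum (fun k => a k + b k) n w) ^+ 2)%:E))// => w _; congr (_ ^+ 2)%:E.
rewrite addrACA -opprD; congr (_ - _); rewrite -big_split; apply: eq_bigr => k _.
by rewrite /= mulrDl.
Qed.

Lemma zeta_seriesZ c a X : zeta_series a X ->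
  zeta_series (fun k => c * a k) (fun w => c * X w).
Proof.
move=> [mX [r r0 Xr]]; split; first exact: measurable_funM.
exists (fun n => c ^+ 2 * r n).
  by rewrite -[X in _ --> X](mulr0 (c ^+ 2)); apply: cvgMr.
move=> n.
have mXn : measurable_fun setT (fun w => X w - zeta_sum a n w) by exact: measurable_funB.
have := second_momentZ P c mXn.
rewrite (@eq_integral _ _ _ P _ (fun w => ((c * X w -
  zeta_sum (fun k => c * a k) n w) ^+ 2)%:E)) => [->|w _].
  by rewrite [leRHS]EFinM; apply: lee_wpmul2l; [rewrite lee_fin sqr_ge0|exact: Xr].
congr (_ ^+ 2)%:E; rewrite mulrBr; congr (_ - _).
by rewrite /zeta_sum mulr_sumr; apply: eq_bigr => k _; rewrite mulrA.
Qed.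

Lemma zeta_series_sum n (c : 'I_n -> R) (a : 'I_n -> nat -> R) (X : 'I_n -> T -> R) :
  (forall j, zeta_series (a j) (X j)) ->
  zeta_series (fun k => \sum_(j < n) c j * a j k) (fun w => \sum_(j < n) c j * X j w).
Proof.
elim: n c a X => [|n IH] c a X zX.
  under eq_fun do rewrite big_ord0.
  by under [X in zeta_series _ X]eq_fun do rewrite big_ord0; exact: zeta_series0.
under eq_fun do rewrite big_ord_recr.
under [X in zeta_series _ X]eq_fun do rewrite big_ord_recr.
apply: zeta_seriesD; last exact: zeta_seriesZ.
exact: (IH (fun j => c (widen_ord (leqnSn n) j)) (fun j => a (widen_ord (leqnSn n) j))).
Qed.

Lemma zeta_series_ae a X Y : zeta_series a X -> measurable_fun setT Y ->
  {ae P, forall w, Y w = X w} -> zeta_series a Y.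
Proof.
move=> [mX [r r0 Xr]] mY XY; split => //; exists r => // n; apply: le_trans (Xr n).
rewrite le_eqVlt; apply/orP; left; apply/eqP; apply: ae_eq_integral => //.
- by apply/measurable_EFinP; apply: measurable_funX; exact: measurable_funB.
- by apply/measurable_EFinP; apply: measurable_funX; exact: measurable_funB.
- by apply: filterS XY => w -> _.
Qed.

(** Polarization turns the formula for the variance into one for the
    covariance. *)
Lemma zeta_series_mul a b X Y : zeta_series a X -> zeta_series b Y ->
  P.-integrable setT (EFin \o (fun w => X w * Y w)) /\
  (fun n => \sum_(k < n) a k * b k) @ \oo --> \int[P]_w (X w * Y w).
Proof.
move=> zX zY.
have [i1 c1] := zeta_series_sqr (zeta_seriesD zX zY).
have [i2 c2] := zeta_series_sqr (zeta_seriesD zX (zeta_seriesZ (-1) zY)).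
have E w : X w * Y w = 4^-1 * ((X w + Y w) ^+ 2 - (X w + -1 * Y w) ^+ 2).
  by rewrite !sqrrD; field.
split.
  have := integrableRZ 4^-1 (integrableRB i1 i2).
  by apply: eq_integrable => // w _; rewrite /= E.
under eq_Rintegral do rewrite E.
rewrite RintegralZl//; last exact: integrableRB.
rewrite RintegralB//.
rewrite (_ : (fun n => _) = fun n => 4^-1 * (sum_sqr (fun k => a k + b k) n -
    sum_sqr (fun k => a k + -1 * b k) n)).
  by apply: cvgMr; exact: cvgB.
apply/funext => n; rewrite /sum_sqr -sumrB mulr_sumr; apply: eq_bigr => k _.
by rewrite !sqrrD; field.
Qed.

Lemma zeta_series_covariance a b X Y : zeta_series a X -> zeta_series b Y ->
  covariance P X Y = (\int[P]_w (X w * Y w))%:E.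
Proof.
move=> zX zY; have [iX X0] := zeta_series_mean zX; have [iY Y0] := zeta_series_mean zY.
have [iXY _] := zeta_series_mul zX zY.
rewrite unlock unlock -!/(Rintegral _ _ _) X0 Y0.
rewrite -EFin_Rintegral//; apply: eq_integral => w _.
by rewrite -[LHS]/(((X w - 0) * (Y w - 0))%:E) !subr0.
Qed.

Lemma zeta_series_gaussian_process (I : Type) (X : I -> T -> R) :
  (forall i, exists a, zeta_series a (X i)) -> gaussian_process P X.
Proof.
move=> /choice[a zX] n i c.
have zS := zeta_series_sum c (fun k => zX (i k)).
exact: scaled_normal_gaussian_rv zS.1 (sqrtr_ge0 _) (zeta_series_scaled_normal zS).
Qed.

(** By Fatou, the mean square distance of an almost sure limit to the n-th
    partial sum is at most the tail of the variances. *)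
Lemma zeta_sum_tail_le a X n : measurable_fun setT X -> cvgn (sum_sqr a) ->
  {ae P, forall w, zeta_sum a ^~ w @ \oo --> X w} ->
  (\int[P]_w ((X w - zeta_sum a n w) ^+ 2)%:E <=
   (limn (sum_sqr a) - sum_sqr a n)%:E)%E.
Proof.
move=> mX ca aX.
apply: (@fatou_le _ _ _ P (fun m w => (zeta_sum a (m + n) w - zeta_sum a n w) ^+ 2)).
- by move=> m; apply: measurable_funX; exact: measurable_funB.
- by apply: measurable_funX; exact: measurable_funB.
- by move=> m w; exact: sqr_ge0.
- apply: filterS aX => w aw; rewrite !expr2.
  have cD : (fun m => zeta_sum a (m + n) w - zeta_sum a n w) @ \oo -->
      X w - zeta_sum a n w.
    apply: cvgB; last exact: cvg_cst.
    by have := aw; rewrite -(cvg_shiftn n).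
  by apply: cvgM.
move=> m; pose b k := if (k < n)%N then 0 else a k.
have E (u v : nat -> R) : (\sum_(k < m + n) u k * v k - \sum_(k < n) u k * v k =
    \sum_(k < m + n) (if (k < n)%N then 0 else u k) * v k).
  rewrite addnC !big_split_ord /= [LHS]addrAC subrr add0r.
  rewrite [X in _ = X + _]big1 ?add0r => [|k _]; last by rewrite ltn_ord mul0r.
  by apply: eq_bigr => k _; rewrite ltnNge leq_addr.
have bE w : zeta_sum a (m + n) w - zeta_sum a n w = zeta_sum b (m + n) w.
  exact: (E a (zeta ^~ w)).
under eq_integral do rewrite bE.
rewrite zeta_sum_second_moment lee_fin.
have -> : sum_sqr b (m + n) = sum_sqr a (m + n) - sum_sqr a n.
  rewrite /sum_sqr (E a a); apply: eq_bigr => k _; rewrite /b.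
  by case: ifP => _; rewrite ?mul0r ?expr0n.
by rewrite lerD2r; apply: nondecreasing_cvgn_le => //; exact: sum_sqr_nondecreasing.
Qed.

Lemma zeta_series_ae_cvg a X : measurable_fun setT X -> cvgn (sum_sqr a) ->
  {ae P, forall w, zeta_sum a ^~ w @ \oo --> X w} -> zeta_series a X.
Proof.
move=> mX ca aX; split => //; exists (fun n => limn (sum_sqr a) - sum_sqr a n).
  by rewrite -[X in _ --> X](subrr (limn (sum_sqr a))); apply: cvgB => //; exact: cvg_cst.
by move=> n; exact: zeta_sum_tail_le.
Qed.

End LinearFunctional.

(** * Integrability of Mehler's kernel *)
Lemma measurable_invr {R : realType} : measurable_fun setT (fun x : R => x^-1).
Proof.
rewrite (_ : (fun x : R => x^-1) = fun x => x * (x ^+ 2) `^ (-1)).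
  apply: measurable_funM => //.
  have mp : measurable_fun setT (fun x : R => x `^ (-1)) by exact: measurable_powR.
  by apply: (measurableT_comp mp); exact: measurable_funX.
apply/funext => x; rewrite powR_inv1 ?sqr_ge0//.
by have [->|x0] := eqVneq x 0; [rewrite invr0 mul0r|field].
Qed.

Section SingularityAtOne.
Context {R : realType}.
Variable H : nat -> {poly R}.
Hypothesis hH : hermite_chebycheff H.

Definition hermite_sqr (t : R) k : R := (H k).[t] ^+ 2 / k`!%:R.

Lemma hermite_sqr_ge0 t k : 0 <= hermite_sqr t k.
Proof. by rewrite divr_ge0// sqr_ge0. Qed.

(** Only even powers occur, as the odd polynomials vanish at the origin. *)
Lemma hermite_sqr0_norm x k : x ^+ k * hermite_sqr 0 k = `|x| ^+ k * hermite_sqr 0 k.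
Proof.
have [ok|ek] := boolP (odd k).
  have H0 : (H k).[0] = 0.
    have := hermiteN hH 0 k; rewrite oppr0 -signr_odd ok expr1 mulN1r => h.
    by move: h; lra.
  by rewrite /hermite_sqr H0 expr0n mul0r !mulr0.
by rewrite -normrX ger0_norm// exprn_even_ge0.
Qed.

Lemma mehler_kernel00 (x : R) : mehler_kernel 0 0 x = (Num.sqrt (1 - x ^+ 2))^-1.
Proof.
rewrite /mehler_kernel [X in expR X](_ : _ = 0) ?expR0 ?mulr1//.
by rewrite !mul0r expr0n addr0 !mul0r subr0 mul0r.
Qed.

Lemma mehler_sum t s (x : R) : `|x| < 1 ->
  (fun n => \sum_(k < n) x ^+ k * ((H k).[t] * (H k).[s] / k`!%:R)) @ \oo -->
  mehler_kernel t s x.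
Proof.
move=> x1; have := mehler hH (t := t) (s := s) x1.
rewrite (_ : (fun n => \sum_(k < n) _) =
  pseries (fun k => (H k).[t] * (H k).[s] / k`!%:R) x)//.
apply/funext => n; rewrite /pseries /series /= big_mkord.
by apply: eq_bigr => i _; rewrite mulrC.
Qed.

(** The kernel at the origin has a pole at 1. *)
Lemma hermite_sqr0_sum_unbounded (b : R) : exists n, b < \sum_(k < n) hermite_sqr 0 k.
Proof.
apply: contrapT => nb.
have {}nb n : \sum_(k < n) hermite_sqr 0 k <= b.
  by rewrite leNgt; apply/negP => h; apply: nb; exists n.
pose c : R := (`|b| + 2)^-1.
have b0 : 0 < `|b| + 2 by rewrite ltr_wpDl.
have c0 : 0 < c by rewrite invr_gt0.
have c1 : c < 1.
  by rewrite /c invf_lt1//; have := normr_ge0 b; move: (`|b|) => u; lra.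
have c21 : c ^+ 2 < 1 by rewrite expr_lt1// ltW.
have x2 : Num.sqrt (1 - c ^+ 2) ^+ 2 = 1 - c ^+ 2.
  by rewrite sqr_sqrtr// subr_ge0 ltW.
have x1 : `|Num.sqrt (1 - c ^+ 2)| < 1.
  by rewrite ger0_norm ?sqrtr_ge0// -[ltRHS]sqrtr1 ltr_sqrt// gtrDl oppr_lt0 exprn_gt0.
have := mehler_sum (t := 0) (s := 0) x1.
rewrite mehler_kernel00 x2 subKr sqrtr_sqr gtr0_norm// invrK => cl.
have : `|b| + 2 <= b.
  rewrite -(cvg_lim _ cl)//; apply: limr_le; first by apply/cvg_ex; eexists; exact: cl.
  apply: nearW => n; apply: le_trans (nb n); apply: ler_sum => k _.
  rewrite -expr2 -/(hermite_sqr 0 k) -[leRHS]mul1r; apply: ler_wpM2r.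
    exact: hermite_sqr_ge0.
  by rewrite exprn_ile1// ?sqrtr_ge0//; apply: le_trans (ler_norm _) (ltW x1).
by have := ler_norm b; lra.
Qed.

Context {d : measure_display} {T : measurableType d}.
Variables (P : probability T R) (Y : T -> R).
Hypotheses (mY : measurable_fun setT Y) (Y1 : {ae P, forall w, `|Y w| <= 1}).

Lemma integrable_power_sum (c : nat -> R) n :
  P.-integrable setT (EFin \o (fun w => \sum_(k < n) Y w ^+ k * c k)).
Proof.
apply: (@integrableR_sum _ _ _ P (fun k w => Y w ^+ k * c k)) => k.
have := integrableRZ (c k) (integrable_exp_le1 mY Y1 k).
by apply: eq_integrable => // w _; rewrite /= mulrC.
Qed.

Lemma Rintegral_power_sum (c : nat -> R) n :
  \int[P]_w (\sum_(k < n) Y w ^+ k * c k) = \sum_(k < n) (\int[P]_w (Y w ^+ k)) * c k.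
Proof.
have iY k := integrable_exp_le1 mY Y1 k.
rewrite (@Rintegral_sum _ _ _ P (fun k w => Y w ^+ k * c k)); last first.
  move=> k; have := integrableRZ (c k) (iY k).
  by apply: eq_integrable => // w _; rewrite /= mulrC.
apply: eq_bigr => k _; rewrite mulrC -RintegralZl//.
by apply: eq_Rintegral => w _; rewrite mulrC.
Qed.

Lemma measurable_inv_sqrt :
  measurable_fun setT (fun w => (Num.sqrt (1 - Y w ^+ 2))^-1).
Proof.
apply: (measurableT_comp measurable_invr).
have mS : measurable_fun setT (@Num.sqrt R).
  by apply: continuous_measurable_funT; exact: sqrt_continuous.
by apply: (measurableT_comp mS); apply: measurable_funB => //; exact: measurable_funX.
Qed.

Variable B : R.
Hypothesis hB : forall n,
  \sum_(k < n) (\int[P]_w (Y w ^+ k)) * hermite_sqr 0 k <= B.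

Let q n w := \sum_(k < n) Y w ^+ k * hermite_sqr 0 k.

Let q_ge0 n w : 0 <= q n w.
Proof.
apply: sumr_ge0 => k _; rewrite hermite_sqr0_norm mulr_ge0//.
exact: hermite_sqr_ge0.
Qed.

Let mq n : measurable_fun setT (q n).
Proof. by apply/measurable_EFinP; exact: measurable_int (integrable_power_sum _ _). Qed.

Let q_le n : (\int[P]_w (q n w)%:E <= B%:E)%E.
Proof.
by rewrite EFin_Rintegral ?lee_fin ?Rintegral_power_sum//; exact: integrable_power_sum.
Qed.

(** The mean of the partial sums is bounded, while on [|Y| = 1] the partial sums
    exceed those of [hermite_sqr0_sum_unbounded]. *)
Lemma ae_norm_lt1 : {ae P, forall w, `|Y w| < 1}.
Proof.
pose D := [set w | 1 <= `|Y w|].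
have mD : measurable D by exact: measurable_norm_ge.
suff D0 : P D = 0%E.
  by exists D; split => // w /= /negP; rewrite -leNgt.
apply/eqP; rewrite eq_le measure_ge0 andbT leNgt; apply/negP => D0.
have fD : P D \is a fin_num by exact: fin_num_measure.
have pD : 0 < fine (P D) by rewrite fine_gt0// D0 ltey_eq fD.
have [n] := hermite_sqr0_sum_unbounded (B / fine (P D)).
rewrite ltNge => /negP; apply; rewrite ler_pdivlMr// -lee_fin EFinM fineK//.
set S := \sum_(k < n) _; apply: le_trans (q_le n).
have S0 : 0 <= S by apply: sumr_ge0 => k _; exact: hermite_sqr_ge0.
rewrite -(setIT D) -integral_indic// -ge0_integralZl//; last first.
  by apply/measurable_EFinP; exact: measurable_indic.
apply: ge0_le_integral => //.
- by move=> w _; rewrite -EFinM lee_fin mulr_ge0// indicE.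
- by apply: emeasurable_funM => //; apply/measurable_EFinP; exact: measurable_indic.
- exact/measurable_EFinP.
- move=> w _; rewrite -EFinM lee_fin indicE; case: (boolP (w \in D)) => [|_]; last first.
    by rewrite mulr0.
  rewrite inE /D /= mulr1 => Yw; apply: ler_sum => k _.
  rewrite hermite_sqr0_norm -[leLHS]mul1r; apply: ler_wpM2r; first exact: hermite_sqr_ge0.
  exact: exprn_ege1.
Qed.

(** Fatou's lemma applied to Mehler's series at the origin. *)
Lemma integrable_inv_sqrt :
  P.-integrable setT (EFin \o (fun w => (Num.sqrt (1 - Y w ^+ 2))^-1)).
Proof.
apply/integrableP; split; first by apply/measurable_EFinP; exact: measurable_inv_sqrt.
under eq_integral do rewrite /= ger0_norm ?invr_ge0 ?sqrtr_ge0//.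
apply: (@le_lt_trans _ _ B%:E); last exact: ltry.
apply: (@fatou_le _ _ _ P q) => //; first exact: measurable_inv_sqrt.
apply: filterS ae_norm_lt1 => w Yw; rewrite -mehler_kernel00.
exact: (mehler_sum (t := 0) (s := 0) Yw).
Qed.

End SingularityAtOne.

Section MehlerMean.
Context {R : realType}.
Variable H : nat -> {poly R}.
Hypothesis hH : hermite_chebycheff H.
Context {d : measure_display} {T : measurableType d}.
Variables (P : probability T R) (Y : T -> R).
Hypotheses (mY : measurable_fun setT Y) (Y1 : forall w, `|Y w| < 1).
Hypothesis iW : P.-integrable setT (EFin \o (fun w => (Num.sqrt (1 - Y w ^+ 2))^-1)).

Let Y1' : {ae P, forall w, `|Y w| <= 1}.
Proof. by apply: aeW => w; exact: ltW. Qed.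

Lemma mehler_partial_norm_le t n w :
  \sum_(k < n) `|Y w| ^+ k * hermite_sqr H t k <=
  (Num.sqrt (1 - Y w ^+ 2))^-1 * expR (t ^+ 2 / 2).
Proof.
have x1 : 0 <= `|Y w| < 1 by rewrite normr_ge0 Y1.
apply: le_trans (mehler_partial_le hH t n x1) _.
rewrite real_normK ?num_real//; apply: ler_wpM2l; first by rewrite invr_ge0 sqrtr_ge0.
rewrite ler_expR; apply: ler_wpM2l; first exact: sqr_ge0.
have x0 := normr_ge0 (Y w); have := Y1 w; move: `|Y w| x0 {x1} => x x0 x1.
by rewrite ler_pdivrMr ?ltr_wpDr//; lra.
Qed.

(** The partial sums are dominated: their absolute value is at most the mean of
    the diagonal series at [t] and at [s]. *)
Lemma mean_mehler t s :
  P.-integrable setT (EFin \o (fun w => mehler_kernel t s (Y w))) /\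
  (fun n => \sum_(k < n) (\int[P]_w (Y w ^+ k)) * ((H k).[t] * (H k).[s] / k`!%:R))
    @ \oo --> \int[P]_w mehler_kernel t s (Y w).
Proof.
pose c k := (H k).[t] * (H k).[s] / k`!%:R.
have mq n : measurable_fun setT (fun w => \sum_(k < n) Y w ^+ k * c k).
  by apply/measurable_EFinP; exact: measurable_int (integrable_power_sum mY Y1' c n).
have cq w : (fun n => \sum_(k < n) Y w ^+ k * c k) @ \oo --> mehler_kernel t s (Y w).
  exact: mehler_sum.
have mK : measurable_fun setT (fun w => mehler_kernel t s (Y w)).
  exact: (@measurable_fun_cvg _ _ _ _ (fun n w => \sum_(k < n) Y w ^+ k * c k)).
have [] := @dominated_Rintegral _ _ _ P (fun n w => \sum_(k < n) Y w ^+ k * c k)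
  (fun w => mehler_kernel t s (Y w))
  (fun w => (2^-1 * (expR (t ^+ 2 / 2) + expR (s ^+ 2 / 2))) *
     (Num.sqrt (1 - Y w ^+ 2))^-1) mq mK.
- exact: aeW.
- exact: integrableRZ.
- apply: aeW => w n; apply: le_trans (ler_norm_sum _ _ _) _.
  apply: (@le_trans _ _ (\sum_(k < n) 2^-1 * (`|Y w| ^+ k * hermite_sqr H t k +
      `|Y w| ^+ k * hermite_sqr H s k))).
    apply: ler_sum => k _; rewrite normrM normrX -mulrDr mulrCA; apply: ler_wpM2l.
      by rewrite exprn_ge0.
    rewrite /c /hermite_sqr -mulrDl normrM mulrA [`|k`!%:R^-1|]ger0_norm ?invr_ge0//.
    by apply: ler_wpM2r; [rewrite invr_ge0|exact: normM_le_sqr].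
  rewrite -mulr_sumr big_split /= -mulrA; apply: ler_wpM2l; first by rewrite invr_ge0.
  by rewrite mulrDl; apply: lerD; rewrite mulrC; exact: mehler_partial_norm_le.
move=> iK; under [X in X @ _ --> _]eq_fun do rewrite (Rintegral_power_sum mY Y1').
by split.
Qed.

Lemma moment_hermite_sqr_le t n :
  \sum_(k < n) (\int[P]_w (Y w ^+ k)) * hermite_sqr H t k <=
  (\int[P]_w (Num.sqrt (1 - Y w ^+ 2))^-1) * expR (t ^+ 2 / 2).
Proof.
rewrite -(Rintegral_power_sum mY Y1') mulrC -RintegralZl//.
apply: le_Rintegral => //.
- exact: integrable_power_sum.
- exact: integrableRZ.
move=> w _; rewrite [leRHS]mulrC; apply: le_trans (mehler_partial_norm_le t n w).
apply: ler_sum => k _; apply: ler_wpM2r; first exact: hermite_sqr_ge0.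
by apply: le_trans (ler_norm _) _; rewrite normrX.
Qed.

End MehlerMean.

(** * Integrals of the process against bounded functions *)
Section WeightedCauchySchwarz.
Context {R : realType} {d : measure_display} {T : measurableType d}.
Variable mu : {measure set T -> \bar R}.
Implicit Types f r : T -> R.

(** The integral of [(f - (A / M) r) ^ 2 / r] is nonnegative, where [A] and [M]
    are the integrals of [f] and [r]. *)
Lemma weighted_cauchy_schwarz f r : mu.-integrable setT (EFin \o f) ->
  mu.-integrable setT (EFin \o r) -> (forall t, 0 < r t) ->
  0 < \int[mu]_t r t -> measurable_fun setT (fun t => f t ^+ 2 / r t) ->
  (((\int[mu]_t f t) ^+ 2)%:E <=
   (\int[mu]_t r t)%:E * \int[mu]_t (f t ^+ 2 / r t)%:E)%E.
Proof.
move=> iF ir r0 M0 mq; set M := \int[mu]_t r t in M0 *; set A := \int[mu]_t f t.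
have q0 t : 0 <= f t ^+ 2 / r t by rewrite divr_ge0 ?sqr_ge0// ltW.
have [fin|] := ltP (\int[mu]_t (f t ^+ 2 / r t)%:E)%E +oo%E; last first.
  by rewrite leye_eq => /eqP ->; rewrite gt0_muley ?leey// lte_fin.
have iq : mu.-integrable setT (EFin \o (fun t => f t ^+ 2 / r t)).
  apply/integrableP; split; first exact/measurable_EFinP.
  by under eq_integral do rewrite /= ger0_norm//.
rewrite EFin_Rintegral// -EFinM lee_fin.
have : 0 <= \int[mu]_t (f t ^+ 2 / r t - (2 * (A / M)) * f t + (A / M) ^+ 2 * r t).
  apply: Rintegral_ge0 => t _.
  have -> : f t ^+ 2 / r t - (2 * (A / M)) * f t + (A / M) ^+ 2 * r t =
      (f t - A / M * r t) ^+ 2 / r t.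
    by field; rewrite !gt_eqF.
  by rewrite divr_ge0 ?sqr_ge0// ltW.
rewrite RintegralD//; [|apply: integrableRB => //|]; [|exact: integrableRZ..].
rewrite RintegralB//; last exact: integrableRZ.
rewrite !RintegralZl// -/A -/M; set J := Rintegral _ _ _.
have -> : J - 2 * (A / M) * A + (A / M) ^+ 2 * M = J - A ^+ 2 / M.
  by field; rewrite gt_eqF.
by rewrite subr_ge0 ler_pdivrMr// mulrC.
Qed.

End WeightedCauchySchwarz.

Section KappaMeasurability.
Context {R : realType} {d : measure_display} {T : measurableType d}.
Variables (m : nat -> R) (H : nat -> {poly R}) (zeta : nat -> T -> R).
Hypothesis mz : forall k, measurable_fun setT (zeta k).

Lemma measurable_horner (p : {poly R}) : measurable_fun setT (fun t : R => p.[t]).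
Proof. by apply: continuous_measurable_funT; exact: continuous_horner. Qed.

Lemma measurable_kappa_series d' (T' : measurableType d') (t : T' -> R) (w : T' -> T) n :
  measurable_fun setT t -> measurable_fun setT w ->
  measurable_fun setT (fun x => kappa_series m H zeta (t x) (w x) n).
Proof.
move=> mt mw; rewrite /kappa_series /series /=; apply: measurable_sum => k.
apply: measurable_funM; last exact: measurableT_comp.
by apply: measurable_funM => //; apply: (measurableT_comp (measurable_horner (H k))).
Qed.

Lemma measurable_std_gauss : measurable_fun setT (@std_gauss R).
Proof. by apply: continuous_measurable_funT; exact: is_derive_continuous is_derive_std_gauss. Qed.

Lemma measurable_kappa d' (T' : measurableType d') (t : T' -> R) (w : T' -> T) :
  measurable_fun setT t -> measurable_fun setT w ->
  measurable_fun setT (fun x => kappa m H zeta (t x) (w x)).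
Proof.
move=> mt mw; apply: measurable_funM.
  exact: (measurableT_comp measurable_std_gauss).
by apply: measurable_fun_limn => n; exact: measurable_kappa_series.
Qed.

Lemma measurable_kappa_w w : measurable_fun setT (fun t => kappa m H zeta t w).
Proof. exact: (@measurable_kappa _ (measurableTypeR R) id (fun=> w)). Qed.

Lemma measurable_kappa_Rintegral d' (T' : measurableType d') (w : T' -> T)
    (g : T' * measurableTypeR R -> R) :
  measurable_fun setT w -> measurable_fun setT g ->
  measurable_fun setT (fun x =>
    \int[@lebesgue_measure R]_t (g (x, t) * kappa m H zeta t (w x))).
Proof.
move=> mw mg; apply: (@measurable_Rintegral _ _ _ _ _ (@lebesgue_measure R)
  (fun p : T' * measurableTypeR R => g p * kappa m H zeta p.2 (w p.1))).
apply: measurable_funM => //; apply: measurable_kappa; first exact: measurable_snd.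
exact: (measurableT_comp mw measurable_fst).
Qed.

Definition kappa_int (g : R -> R) (w : T) : R :=
  \int[@lebesgue_measure R]_t (g t * kappa m H zeta t w).

Lemma measurable_kappa_int g : measurable_fun setT g -> measurable_fun setT (kappa_int g).
Proof.
move=> mg; apply: (@measurable_kappa_Rintegral _ T id (fun p => g p.2)) => //.
exact: (measurableT_comp mg measurable_snd).
Qed.

End KappaMeasurability.

Section Kappa.
Context {R : realType} {d : measure_display} {T : measurableType d}.
Notation mu := (@lebesgue_measure R).
Variables (m : nat -> R) (H : nat -> {poly R}) (P : probability T R).
Variable zeta : nat -> T -> R.
Hypotheses (hH : hermite_chebycheff H) (hzeta : iid_standard_normal P zeta).
Hypothesis hcvg :
  forall t, {ae P, forall w, cvgn (kappa_series m H zeta t w)}.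
Variable K : R.
Hypothesis hK : forall t n,
  \sum_(k < n) m k ^+ 2 * hermite_sqr H t k <= K * expR (t ^+ 2 / 2).

Notation ka := (kappa m H zeta).

Let mz k : measurable_fun setT (zeta k).
Proof. exact: measurable_zeta hzeta k. Qed.
#[local] Hint Resolve mz : core.

Definition kappa_coef t k := m k * (Num.sqrt k`!%:R)^-1 * hermite_fun H k t.

Lemma kappa_coef_mul t s k : kappa_coef t k * kappa_coef s k =
  std_gauss t * std_gauss s * (m k ^+ 2 * ((H k).[t] * (H k).[s] / k`!%:R)).
Proof.
rewrite /kappa_coef /hermite_fun.
have -> : (k`!%:R^-1 : R) = (Num.sqrt k`!%:R)^-1 * (Num.sqrt k`!%:R)^-1.
  by rewrite -invfM -expr2 sqr_sqrtr.
ring.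
Qed.

Lemma zeta_sum_kappa_coef t n w :
  zeta_sum zeta (kappa_coef t) n w = std_gauss t * kappa_series m H zeta t w n.
Proof.
rewrite /zeta_sum /kappa_series /series /= big_mkord mulr_sumr.
apply: eq_bigr => k _; rewrite /kappa_coef /hermite_fun; ring.
Qed.

Lemma kappa_ae_cvg t : {ae P, forall w, zeta_sum zeta (kappa_coef t) ^~ w @ \oo --> ka t w}.
Proof.
apply: filterS (hcvg t) => w cw.
under eq_fun do rewrite zeta_sum_kappa_coef.
exact: cvgMr.
Qed.

Let C := (2 * pi)^-1 * K.

Lemma std_gauss_sqr (t : R) : std_gauss t ^+ 2 = (2 * pi)^-1 * expR (- t ^+ 2).
Proof.
rewrite /std_gauss exprMn exprVn sqr_sqrtr; last by rewrite mulr_ge0// pi_ge0.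
by rewrite expr2 -expRD; congr (_ * expR _); field.
Qed.

Lemma sum_sqr_kappa_coef_le t n :
  sum_sqr (kappa_coef t) n <= C * expR (- (2^-1 * t ^+ 2)).
Proof.
rewrite /sum_sqr (eq_bigr (fun k : 'I_n => std_gauss t ^+ 2 *
    (m k ^+ 2 * hermite_sqr H t k))); last first.
  by move=> k _; rewrite expr2 kappa_coef_mul /hermite_sqr !expr2.
rewrite -mulr_sumr std_gauss_sqr.
have -> : C * expR (- (2^-1 * t ^+ 2)) =
    (2 * pi)^-1 * expR (- t ^+ 2) * (K * expR (t ^+ 2 / 2)).
  have -> : expR (- (2^-1 * t ^+ 2)) = expR (- t ^+ 2) * expR (t ^+ 2 / 2).
    by rewrite -expRD; congr expR; field.
  by rewrite /C; ring.
apply: ler_wpM2l; last exact: hK.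
by rewrite mulr_ge0 ?expR_ge0// invr_ge0 mulr_ge0// pi_ge0.
Qed.

Lemma sum_sqr_kappa_coef_cvg t : cvgn (sum_sqr (kappa_coef t)).
Proof. by apply: sum_sqr_bounded_cvg => n; exact: sum_sqr_kappa_coef_le. Qed.

Lemma measurable_kappa_t t : measurable_fun setT (ka t).
Proof. exact: (@measurable_kappa _ _ _ m H zeta mz _ _ (fun=> t) id). Qed.

Lemma kappa_zeta_series t : zeta_series P zeta (kappa_coef t) (ka t).
Proof.
apply: zeta_series_ae_cvg => //; first exact: measurable_kappa_t.
  exact: sum_sqr_kappa_coef_cvg.
exact: kappa_ae_cvg.
Qed.

(** The weight, which balances the Gaussian decay of the variance. *)
Let rho (t : R) := expR (- (4^-1 * t ^+ 2)).
Let err n (p : T * measurableTypeR R) :=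
  (ka p.2 p.1 - zeta_sum zeta (kappa_coef p.2) n p.1) ^+ 2 / rho p.2.
Let rate n := \int[mu]_t
  ((limn (sum_sqr (kappa_coef t)) - sum_sqr (kappa_coef t) n) / rho t).

Let rho_gt0 t : 0 < rho t. Proof. exact: expR_gt0. Qed.

Let irho : mu.-integrable setT (EFin \o rho).
Proof. by apply: integrable_expRN_sqr; rewrite invr_gt0. Qed.

Let M := \int[mu]_t rho t.

Let M_gt0 : 0 < M.
Proof.
have p4 : 0 < (4^-1 : R) by rewrite invr_gt0.
by rewrite /M /Rintegral (integral_expRN_sqr p4) /= sqrtr_gt0 divr_gt0 ?pi_gt0.
Qed.

Let mrho : measurable_fun setT rho.
Proof. by apply/measurable_EFinP; exact: measurable_int irho. Qed.

Let mrhoV : measurable_fun setT (fun t => (rho t)^-1).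
Proof. exact: (measurableT_comp measurable_invr). Qed.

Let mcoef k : measurable_fun setT (fun t => kappa_coef t k).
Proof. by apply: measurable_funM => //; exact: measurable_hermite_fun. Qed.

Let merr n : measurable_fun setT (err n).
Proof.
apply: measurable_funM; last exact: (measurableT_comp mrhoV measurable_snd).
apply: measurable_funX; apply: measurable_funB.
  by apply: measurable_kappa => //; exact: measurable_snd.
apply: measurable_sum => k; apply: measurable_funM.
  exact: (measurableT_comp (mcoef k) measurable_snd).
exact: (measurableT_comp (mz k) measurable_fst).
Qed.

Let err_ge0 n p : 0 <= err n p.
Proof. by rewrite divr_ge0 ?sqr_ge0// ltW. Qed.

Let mgap n : measurable_fun setT (fun t =>
  (limn (sum_sqr (kappa_coef t)) - sum_sqr (kappa_coef t) n) / rho t).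
Proof.
have ms j : measurable_fun setT (fun t => sum_sqr (kappa_coef t) j).
  by apply: measurable_sum => k; apply: measurable_funX.
apply: measurable_funM => //; apply: measurable_funB => //.
exact: measurable_fun_limn.
Qed.

Let gap_ge0 n t : 0 <= (limn (sum_sqr (kappa_coef t)) - sum_sqr (kappa_coef t) n) / rho t.
Proof.
rewrite divr_ge0 ?(ltW (rho_gt0 t))// subr_ge0; apply: nondecreasing_cvgn_le.
  exact: sum_sqr_nondecreasing.
exact: sum_sqr_kappa_coef_cvg.
Qed.

Let gap_le n t : (limn (sum_sqr (kappa_coef t)) - sum_sqr (kappa_coef t) n) / rho t <=
  C * rho t.
Proof.
rewrite ler_pdivrMr//; apply: (@le_trans _ _ (C * expR (- (2^-1 * t ^+ 2)))).
  apply: (@le_trans _ _ (limn (sum_sqr (kappa_coef t)))).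
    by rewrite gerBl sum_sqr_ge0.
  apply: limr_le; first exact: sum_sqr_kappa_coef_cvg.
  by apply: nearW => j; exact: sum_sqr_kappa_coef_le.
have -> : expR (- (2^-1 * t ^+ 2)) = rho t * rho t.
  by rewrite /rho -expRD; congr expR; field.
by rewrite mulrA.
Qed.

Let igap n : mu.-integrable setT (EFin \o (fun t =>
  (limn (sum_sqr (kappa_coef t)) - sum_sqr (kappa_coef t) n) / rho t)).
Proof.
apply: (@le_integrableR _ _ _ mu _ (fun t => C * rho t)).
- exact: mgap.
- by move=> t; rewrite ger0_norm ?gap_le ?gap_ge0.
- exact: integrableRZ.
Qed.

Let rate_cvg0 : rate @ \oo --> (0 : R).
Proof.
have [] := @dominated_Rintegral _ _ _ mu (fun n t =>
    (limn (sum_sqr (kappa_coef t)) - sum_sqr (kappa_coef t) n) / rho t) (cst 0)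
    (fun t => C * rho t) mgap.
- exact: measurable_cst.
- apply: aeW => t; rewrite /cst -[X in _ --> X](mul0r (rho t)^-1).
  apply: cvgMl; rewrite -[X in _ --> X](subrr (limn (sum_sqr (kappa_coef t)))).
  by apply: cvgB; [exact: cvg_cst|exact: sum_sqr_kappa_coef_cvg].
- exact: integrableRZ.
- by apply: aeW => t n; rewrite ger0_norm ?gap_le ?gap_ge0.
by move=> _; rewrite Rintegral_cst// mul0r.
Qed.

Let mean_err_le n : (\int[P]_w \int[mu]_t (err n (w, t))%:E <= (rate n)%:E)%E.
Proof.
rewrite (@fubini_tonelli _ _ _ _ _ P mu (EFin \o err n)); last 2 first.
- exact/measurable_EFinP.
- by move=> p; rewrite lee_fin.
rewrite -(EFin_Rintegral (igap n)); apply: ge0_le_integral => //.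
- by move=> t _; apply: integral_ge0 => w _; rewrite lee_fin.
- apply: (@measurable_fun_fubini_tonelli_G _ _ _ _ _ P (EFin \o err n)).
    exact/measurable_EFinP.
  by move=> p; rewrite lee_fin.
- exact: measurable_int (igap n).
move=> t _; rewrite /err /=.
under eq_integral do rewrite EFinM.
rewrite ge0_integralZr//.
- rewrite EFinM; apply: lee_wpmul2r; first by rewrite lee_fin invr_ge0 ltW.
  apply: zeta_sum_tail_le => //.
  + exact: measurable_kappa_t.
  + exact: sum_sqr_kappa_coef_cvg.
  + exact: kappa_ae_cvg.
- apply/measurable_EFinP; apply: measurable_funX; apply: measurable_funB.
    exact: measurable_kappa_t.
  exact: measurable_zeta_sum hzeta (kappa_coef t) n.
- by move=> w _; rewrite lee_fin sqr_ge0.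
- by rewrite lee_fin invr_ge0 ltW.
Qed.

(** Pathwise, [2 |x| <= rho + x ^ 2 / rho], and the last term has a finite mean
    integral. *)
Lemma kappa_ae_integrable : {ae P, forall w, mu.-integrable setT (EFin \o (ka ^~ w))}.
Proof.
have i0 : P.-integrable setT (fun w => \int[mu]_t (err 0 (w, t))%:E)%E.
  apply/integrableP; split.
    apply: (@measurable_fun_fubini_tonelli_F _ _ _ _ _ mu (EFin \o err 0)).
      exact/measurable_EFinP.
    by move=> p; rewrite lee_fin.
  under eq_integral.
    move=> w _; rewrite gee0_abs; last by apply: integral_ge0 => t _; rewrite lee_fin.
    over.
  exact: le_lt_trans (mean_err_le 0) (ltry _).
apply: filterS (integrable_ae measurableT i0) => w /(_ I) fin.
have ierr : mu.-integrable setT (EFin \o (fun t => ka t w ^+ 2 / rho t)).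
  apply/integrableP; split.
    apply/measurable_EFinP; apply: measurable_funM => //; apply: measurable_funX.
    exact: (measurable_kappa_w m H mz w).
  rewrite (@eq_integral _ _ _ mu _ (fun t => (err 0 (w, t))%:E)).
    by move: fin; rewrite fin_numElt => /andP[].
  move=> t _; rewrite /= ger0_norm ?divr_ge0 ?sqr_ge0 ?(ltW (rho_gt0 t))//.
  by rewrite /err /= /zeta_sum big_ord0 subr0.
apply: (@le_integrableR _ _ _ mu _ (fun t => 2^-1 * (rho t + ka t w ^+ 2 / rho t))).
- exact: (measurable_kappa_w m H mz w).
- move=> t; have rn : rho t != 0 by rewrite gt_eqF.
  rewrite -subr_ge0.
  have -> : 2^-1 * (rho t + ka t w ^+ 2 / rho t) - `|ka t w| =
      2^-1 * ((rho t - `|ka t w|) ^+ 2 / rho t).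
    rewrite -[ka t w ^+ 2]real_normK ?num_real//; move: `|ka t w| => x; field.
    exact: rn.
  by rewrite mulr_ge0 ?invr_ge0// divr_ge0 ?sqr_ge0// ltW.
- by apply: integrableRZ; exact: integrableRD.
Qed.

Section Transform.
Variable g : R -> R.
Hypotheses (mg : measurable_fun setT g) (g1 : forall t, `|g t| <= 1).

Notation kappa_int := (kappa_int m H zeta g).

Let kappa_int_zeta_series_coef :
  zeta_series P zeta (fun k => \int[mu]_t (g t * kappa_coef t k)) kappa_int.
Proof.
split; first exact: (measurable_kappa_int m H mz mg).
exists (fun n => M * rate n).
  by rewrite -[X in _ --> X](mulr0 M); apply: cvgMr; exact: rate_cvg0.
move=> n; rewrite EFinM; apply: le_trans (lee_wpmul2l _ (mean_err_le n)); last first.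
  by rewrite lee_fin ltW.
rewrite -ge0_integralZl//; last 3 first.
- apply: (@measurable_fun_fubini_tonelli_F _ _ _ _ _ mu (EFin \o err n)).
    exact/measurable_EFinP.
  by move=> p; rewrite lee_fin.
- by move=> w _; apply: integral_ge0 => t _; rewrite lee_fin.
- by rewrite lee_fin ltW.
have icoef k : mu.-integrable setT (EFin \o (fun t => kappa_coef t k)).
  by apply: integrableRZ; exact: integrable_hermite_fun.
have isum w : mu.-integrable setT (EFin \o (fun t => zeta_sum zeta (kappa_coef t) n w)).
  apply: (@integrableR_sum _ _ _ mu (fun k t => kappa_coef t k * zeta k w)) => k.
  have := integrableRZ (zeta k w) (icoef k).
  by apply: eq_integrable => // t _; rewrite /= mulrC.
have iG f : mu.-integrable setT (EFin \o f) ->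
    mu.-integrable setT (EFin \o (fun t => g t * f t)).
  exact: (@integrable_boundedM _ _ _ mu 1).
apply: ae_ge0_le_integral => //.
- by move=> w _; rewrite lee_fin sqr_ge0.
- apply/measurable_EFinP; apply: measurable_funX; apply: measurable_funB.
    exact: (measurable_kappa_int m H mz mg).
  exact: measurable_zeta_sum hzeta _ n.
- move=> w _; apply: mule_ge0; first by rewrite lee_fin ltW.
  by apply: integral_ge0 => t _; rewrite lee_fin.
- apply: emeasurable_funM => //.
  apply: (@measurable_fun_fubini_tonelli_F _ _ _ _ _ mu (EFin \o err n)).
    exact/measurable_EFinP.
  by move=> p; rewrite lee_fin.
apply: filterS kappa_ae_integrable => w iw _.
pose D t := ka t w - zeta_sum zeta (kappa_coef t) n w.
have iD : mu.-integrable setT (EFin \o D) by exact: integrableRB.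
have -> : kappa_int w - zeta_sum zeta (fun k => \int[mu]_t (g t * kappa_coef t k)) n w =
    \int[mu]_t (g t * D t).
  under [RHS]eq_Rintegral do rewrite /D mulrBr.
  rewrite (RintegralB measurableT (iG _ iw) (iG _ (isum w))).
  congr (_ - _); rewrite /zeta_sum.
  under [RHS]eq_Rintegral do rewrite mulr_sumr.
  rewrite (@Rintegral_sum _ _ _ mu (fun k t => g t * (kappa_coef t k * zeta k w))).
    apply: eq_bigr => k _; rewrite mulrC -RintegralZl//; last exact: iG.
    by apply: eq_Rintegral => t _; rewrite [RHS]mulrA mulrC.
  move=> k; apply: iG.
  have := integrableRZ (zeta k w) (icoef k).
  by apply: eq_integrable => // t _; rewrite /= mulrC.
have mDr : measurable_fun setT (fun t => (g t * D t) ^+ 2 / rho t).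
  apply: measurable_funM => //; apply: measurable_funX; apply: measurable_funM => //.
  by apply/measurable_EFinP; exact: measurable_int iD.
apply: le_trans (weighted_cauchy_schwarz (iG _ iD) irho rho_gt0 M_gt0 mDr) _.
apply: lee_wpmul2l; first by rewrite lee_fin ltW.
apply: ge0_le_integral => //.
- by move=> t _; rewrite lee_fin divr_ge0 ?sqr_ge0// ltW.
- exact/measurable_EFinP.
- apply/measurable_EFinP; apply: measurable_funM => //; apply: measurable_funX.
  by apply/measurable_EFinP; exact: measurable_int iD.
- move=> t _; rewrite lee_fin /err /= -/(D t).
  apply: ler_wpM2r; first by rewrite invr_ge0 ltW.
  by rewrite exprMn ler_piMl ?sqr_ge0// -real_normK ?num_real// exprn_ile1.
Qed.

(** Integration against a bounded function commutes with the series: by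
    Cauchy-Schwarz with the weight, the mean square error is dominated by the
    integral over [t] of the tails of the variances of the process. *)
Lemma kappa_int_zeta_series :
  zeta_series P zeta (fun k => m k * (Num.sqrt k`!%:R)^-1 *
    \int[mu]_t (g t * hermite_fun H k t)) kappa_int.
Proof.
have ih k : mu.-integrable setT (EFin \o hermite_fun H k) by exact: integrable_hermite_fun.
rewrite [X in zeta_series _ _ X](_ : _ = fun k => \int[mu]_t (g t * kappa_coef t k)).
  exact: kappa_int_zeta_series_coef.
apply/funext => k; rewrite -RintegralZl//; last exact: (@integrable_boundedM _ _ _ mu 1).
by apply: eq_Rintegral => t _; rewrite /kappa_coef mulrCA.
Qed.

End Transform.
End Kappa.

(** * Covariances of the process and of its transforms *)
Section ExponentialMoments.
Context {R : realType} {d : measure_display} {T : measurableType d}.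
Variables (P : probability T R) (Y : T -> R).
Hypotheses (mY : measurable_fun setT Y) (Y1 : forall w, `|Y w| < 1).

Lemma exp_partial_le (x : R) n : 0 <= x -> \sum_(k < n) x ^+ k / k`!%:R <= expR x.
Proof.
move=> x0; rewrite /expR.
have -> : \sum_(k < n) x ^+ k / k`!%:R = series (exp_coeff x) n.
  by rewrite /series /= big_mkord.
apply: nondecreasing_cvgn_le; last exact: is_cvg_series_exp_coeff.
apply/nondecreasing_seqP => k; rewrite /series /= big_nat_recr//= lerDl.
exact: exp_coeff_ge0.
Qed.

Lemma exp_partial_cvg (x : R) : (fun n => \sum_(k < n) x ^+ k / k`!%:R) @ \oo --> expR x.
Proof.
rewrite /expR (_ : (fun n => \sum_(k < n) _) = series (exp_coeff x)).
  exact: is_cvg_series_exp_coeff.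
by apply/funext => n; rewrite /series /= big_mkord.
Qed.

Lemma mean_expR a :
  P.-integrable setT (EFin \o (fun w => expR (a * Y w))) /\
  (fun n => \sum_(k < n) (\int[P]_w (Y w ^+ k)) * (a ^+ k / k`!%:R)) @ \oo -->
    \int[P]_w expR (a * Y w).
Proof.
have Y1' : {ae P, forall w, `|Y w| <= 1} by apply: aeW => w; exact: ltW.
pose c k := a ^+ k / k`!%:R.
have [] := @dominated_Rintegral _ _ _ P (fun n w => \sum_(k < n) Y w ^+ k * c k)
  (fun w => expR (a * Y w)) (cst (expR `|a|)).
- move=> n; apply/measurable_EFinP.
  exact: measurable_int (integrable_power_sum mY Y1' c n).
- by apply: measurableT_comp => //; exact: measurable_funM.
- apply: aeW => w; have := @exp_partial_cvg (a * Y w).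
  rewrite (_ : (fun n => \sum_(k < n) (a * Y w) ^+ k / k`!%:R) =
    fun n => \sum_(k < n) Y w ^+ k * c k)//.
  by apply/funext => n; apply: eq_bigr => k _; rewrite exprMn /c mulrCA mulrA.
- exact: finite_measure_integrable_cst.
- apply: aeW => w n; apply: le_trans (ler_norm_sum _ _ _) _.
  apply: le_trans (exp_partial_le n (normr_ge0 a)); apply: ler_sum => k _.
  rewrite normrM /c normrM !normrX [`|k`!%:R^-1|]ger0_norm ?invr_ge0//.
  by apply: ler_piMl; [rewrite divr_ge0// exprn_ge0|rewrite exprn_ile1// ltW].
move=> iE; under [X in X @ _ --> _]eq_fun do rewrite (Rintegral_power_sum mY Y1').
by split.
Qed.

(** The even part of the exponential series. *)
Lemma mean_cosh a :
  P.-integrable setT (EFin \o (fun w => cosh (a * Y w))) /\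
  (fun n => \sum_(k < n) (\int[P]_w (Y w ^+ k)) *
     ((if odd k then 0 else a ^+ k) / k`!%:R)) @ \oo --> \int[P]_w cosh (a * Y w).
Proof.
have [i1 c1] := mean_expR a; have [i2 c2] := mean_expR (- a).
have E w : cosh (a * Y w) = 2^-1 * (expR (a * Y w) + expR (- a * Y w)).
  by rewrite /cosh mulNr mulrC.
split.
  have := integrableRZ 2^-1 (integrableRD i1 i2).
  by apply: eq_integrable => // w _; rewrite /= E.
under eq_Rintegral do rewrite E.
rewrite RintegralZl//; last exact: integrableRD.
rewrite RintegralD//.
rewrite (_ : (fun n => _) = fun n => 2^-1 *
  (\sum_(k < n) (\int[P]_w (Y w ^+ k)) * (a ^+ k / k`!%:R) +
   \sum_(k < n) (\int[P]_w (Y w ^+ k)) * ((- a) ^+ k / k`!%:R))).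
  by apply: cvgMr; exact: cvgD.
apply/funext => n; rewrite -big_split /= mulr_sumr; apply: eq_bigr => k _.
rewrite -mulrDr [RHS]mulrCA; congr (_ * _); rewrite -mulrDl mulrA; congr (_ * _).
rewrite exprNn -signr_odd; case: (odd k); rewrite ?expr1 ?expr0; first by rewrite mulN1r subrr mulr0.
by rewrite mul1r; field.
Qed.

Lemma mean_sinh a :
  P.-integrable setT (EFin \o (fun w => sinh (a * Y w))) /\
  (fun n => \sum_(k < n) (\int[P]_w (Y w ^+ k)) *
     ((if odd k then a ^+ k else 0) / k`!%:R)) @ \oo --> \int[P]_w sinh (a * Y w).
Proof.
have [i1 c1] := mean_expR a; have [i2 c2] := mean_cosh a.
have E w : sinh (a * Y w) = expR (a * Y w) - cosh (a * Y w).
  by rewrite /cosh /sinh; field.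
split.
  have := integrableRB i1 i2.
  by apply: eq_integrable => // w _; rewrite /= E.
under eq_Rintegral do rewrite E.
rewrite RintegralB//.
rewrite (_ : (fun n => _) = fun n =>
  \sum_(k < n) (\int[P]_w (Y w ^+ k)) * (a ^+ k / k`!%:R) -
   \sum_(k < n) (\int[P]_w (Y w ^+ k)) * ((if odd k then 0 else a ^+ k) / k`!%:R)).
  exact: cvgB.
apply/funext => n; rewrite -sumrB; apply: eq_bigr => k _.
rewrite -mulrBr -mulrBl; congr (_ * (_ * _)).
by case: (odd k); rewrite ?subr0 ?subrr.
Qed.

End ExponentialMoments.

Section KappaCovariance.
Context {R : realType} {d : measure_display} {T : measurableType d}.
Notation mu := (@lebesgue_measure R).
Context {d1 : measure_display} {T1 : measurableType d1}.
Variables (P1 : probability T1 R) (Y : T1 -> R).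
Hypotheses (mY : measurable_fun setT Y) (Y1 : forall w, `|Y w| < 1).
Hypothesis iW : P1.-integrable setT (EFin \o (fun w => (Num.sqrt (1 - Y w ^+ 2))^-1)).
Variables (m : nat -> R) (H : nat -> {poly R}) (P : probability T R).
Variable zeta : nat -> T -> R.
Hypothesis hm : forall k, m k ^+ 2 = \int[P1]_w (Y w ^+ k).
Hypotheses (hH : hermite_chebycheff H) (hzeta : iid_standard_normal P zeta).
Hypothesis hcvg :
  forall t, {ae P, forall w, cvgn (kappa_series m H zeta t w)}.

Notation ka := (kappa m H zeta).

Lemma moment_sqr_hermite_le t n : \sum_(k < n) m k ^+ 2 * hermite_sqr H t k <=
  (\int[P1]_w (Num.sqrt (1 - Y w ^+ 2))^-1) * expR (t ^+ 2 / 2).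
Proof. by under eq_bigr do rewrite hm; exact: moment_hermite_sqr_le. Qed.

Lemma binormal_pdfE (t s x : R) : `|x| < 1 ->
  binormal_pdf t s x = std_gauss t * std_gauss s * mehler_kernel t s x.
Proof.
move=> x1; have x2 := onem_sqr_gt0 x1; have xn : 1 - x ^+ 2 != 0 by rewrite gt_eqF.
rewrite /binormal_pdf /std_gauss /mehler_kernel invfM.
have -> : ((2 * pi)^-1 : R) = (Num.sqrt (2 * pi))^-1 * (Num.sqrt (2 * pi))^-1.
  by rewrite -invfM -expr2 sqr_sqrtr// mulr_ge0// pi_ge0.
set p := (Num.sqrt (2 * pi))^-1; set q := (Num.sqrt (1 - _))^-1.
have -> : expR (- (t ^+ 2 - 2 * x * t * s + s ^+ 2) / (2 * (1 - x ^+ 2))) =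
  expR (- (t ^+ 2 / 2)) * expR (- (s ^+ 2 / 2)) *
  expR ((t * s * x - (t ^+ 2 + s ^+ 2) / 2 * x ^+ 2) * (1 - x ^+ 2)^-1).
  by rewrite -!expRD; congr expR; field.
ring.
Qed.

Lemma kappa_mean_mul t s :
  P1.-integrable setT (EFin \o (fun w => binormal_pdf t s (Y w))) /\
  \int[P]_w (ka t w * ka s w) = \int[P1]_w binormal_pdf t s (Y w).
Proof.
have [iK cK] := mean_mehler hH mY Y1 iW t s.
have E w : binormal_pdf t s (Y w) = std_gauss t * std_gauss s * mehler_kernel t s (Y w).
  exact: binormal_pdfE.
split.
  have := integrableRZ (std_gauss t * std_gauss s) iK.
  by apply: eq_integrable => // w _; rewrite /= E.
under [RHS]eq_Rintegral do rewrite E.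
rewrite RintegralZl//.
have zk u := kappa_zeta_series hzeta hcvg moment_sqr_hermite_le u.
have [_ c1] := zeta_series_mul hzeta (zk t) (zk s).
apply: (cvg_unique _ c1) => //.
rewrite (_ : (fun n => _) = fun n => std_gauss t * std_gauss s *
  \sum_(k < n) (\int[P1]_w (Y w ^+ k)) * ((H k).[t] * (H k).[s] / k`!%:R)).
  exact: cvgMr.
apply/funext => n; rewrite mulr_sumr; apply: eq_bigr => k _.
by rewrite kappa_coef_mul hm.
Qed.

Definition kappa_cos (theta : R) := kappa_int m H zeta (fun t => cos (theta * t)).
Definition kappa_sin (theta : R) := kappa_int m H zeta (fun t => sin (theta * t)).

Let c0 k := m k * (Num.sqrt k`!%:R)^-1.

Lemma kappa_cos_zeta_series theta :
  zeta_series P zeta (fun k => c0 k * hermite_cos H k theta) (kappa_cos theta).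
Proof.
exact: (kappa_int_zeta_series hH hzeta hcvg moment_sqr_hermite_le
  (measurable_cosM theta) (fun t => cos_norm_le1 (theta * t))).
Qed.

Lemma kappa_sin_zeta_series theta :
  zeta_series P zeta (fun k => c0 k * hermite_sin H k theta) (kappa_sin theta).
Proof.
exact: (kappa_int_zeta_series hH hzeta hcvg moment_sqr_hermite_le
  (measurable_sinM theta) (fun t => sin_norm_le1 (theta * t))).
Qed.

Let c0_mul k (a b : R) : (c0 k * a) * (c0 k * b) =
  (\int[P1]_w (Y w ^+ k)) * (a * b / k`!%:R).
Proof.
rewrite -hm /c0.
have -> : (k`!%:R^-1 : R) = (Num.sqrt k`!%:R)^-1 * (Num.sqrt k`!%:R)^-1.
  by rewrite -invfM -expr2 sqr_sqrtr.
ring.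
Qed.

Let E0 theta phi : R := expR (- ((theta ^+ 2 + phi ^+ 2) / 2)).

Lemma kappa_cos_mean_mul theta phi : \int[P]_w (kappa_cos theta w * kappa_cos phi w) =
  E0 theta phi * \int[P1]_w cosh (theta * phi * Y w).
Proof.
have [_ c1] := zeta_series_mul hzeta (kappa_cos_zeta_series theta) (kappa_cos_zeta_series phi).
apply: (cvg_unique _ c1) => //.
have [_ c2] := mean_cosh P1 mY Y1 (theta * phi).
rewrite (_ : (fun n => _) = fun n => E0 theta phi * \sum_(k < n) (\int[P1]_w (Y w ^+ k)) *
     ((if odd k then 0 else (theta * phi) ^+ k) / k`!%:R)).
  exact: cvgMr.
apply/funext => n; rewrite mulr_sumr; apply: eq_bigr => k _.
rewrite c0_mul [hermite_cos _ _ _ * _](_ : _ = E0 theta phi * (if odd k then 0 else (theta * phi) ^+ k)).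
  ring.
have [-> _ _] := hermite_transform_mul hH k theta phi.
by case: (odd k); rewrite ?mulr0// mulrC.
Qed.

Lemma kappa_sin_mean_mul theta phi : \int[P]_w (kappa_sin theta w * kappa_sin phi w) =
  E0 theta phi * \int[P1]_w sinh (theta * phi * Y w).
Proof.
have [_ c1] := zeta_series_mul hzeta (kappa_sin_zeta_series theta) (kappa_sin_zeta_series phi).
apply: (cvg_unique _ c1) => //.
have [_ c2] := mean_sinh P1 mY Y1 (theta * phi).
rewrite (_ : (fun n => _) = fun n => E0 theta phi * \sum_(k < n) (\int[P1]_w (Y w ^+ k)) *
     ((if odd k then (theta * phi) ^+ k else 0) / k`!%:R)).
  exact: cvgMr.
apply/funext => n; rewrite mulr_sumr; apply: eq_bigr => k _.
rewrite c0_mul [hermite_sin _ _ _ * _](_ : _ = E0 theta phi * (if odd k then (theta * phi) ^+ k else 0)).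
  ring.
have [_ -> _] := hermite_transform_mul hH k theta phi.
by case: (odd k); rewrite ?mulr0// mulrC.
Qed.

Lemma kappa_cos_sin_mean_mul theta phi :
  \int[P]_w (kappa_cos theta w * kappa_sin phi w) = 0.
Proof.
have [_ c1] := zeta_series_mul hzeta (kappa_cos_zeta_series theta) (kappa_sin_zeta_series phi).
apply: (cvg_unique _ c1) => //.
rewrite (_ : (fun n => _) = cst 0); first exact: cvg_cst.
apply/funext => n; apply: big1 => k _.
by have [_ _ h] := hermite_transform_mul hH k theta phi; rewrite c0_mul h mul0r mulr0.
Qed.

End KappaCovariance.

(** * Even and odd parts, and independence of processes *)
Local Open Scope complex_scope.

Section AlmostEverywhere.
Context {R : realType} {d : measure_display} {T : measurableType d}.
Variable P : probability T R.
Notation mu := (@lebesgue_measure R).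

Lemma ae_eq_probability (E F : set T) : measurable E -> measurable F ->
  {ae P, forall w, E w <-> F w} -> P E = P F.
Proof.
move=> mE mF EF; rewrite -(setIT E) -(setIT F) -!integral_indic//.
apply: ae_eq_integral => //.
- by apply/measurable_EFinP; exact: measurable_indic.
- by apply/measurable_EFinP; exact: measurable_indic.
apply: filterS EF => w [EF FE] _; rewrite !indicE; congr ((_ : bool)%:R%:E).
by apply/idP/idP; rewrite !inE.
Qed.

(** By Tonelli, a null set in every fibre over [t] is null in almost every fibre
    over [w]. *)
Lemma ae_prod_lebesgue (G : set (T * measurableTypeR R)) : measurable G ->
  (forall t, {ae P, forall w, G (w, t)}) ->
  {ae P, forall w, {ae mu, forall t, G (w, t)}}.
Proof.
move=> mG Gt; pose f (p : T * measurableTypeR R) : \bar R := (\1_(~` G) p)%:E.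
have mN : measurable (~` G) by exact: measurableC.
have mf : measurable_fun setT f by apply/measurable_EFinP; exact: measurable_indic.
have f0 p : (0 <= f p)%E by rewrite lee_fin indicE.
have mF := @measurable_fun_fubini_tonelli_F _ _ _ _ _ mu f mf f0.
have I0 : (\int[P]_w \int[mu]_t f (w, t) = 0)%E.
  rewrite (@fubini_tonelli _ _ _ _ _ P mu f mf f0).
  apply: integral0_eq => t _; transitivity (\int[P]_w (cst 0 w : \bar R))%E.
    apply: ae_eq_integral => //.
      exact: (measurableT_comp mf (measurable_fun_pair _ _)).
    apply: filterS (Gt t) => w Gw _; rewrite /f /= indicE.
    by rewrite memNset//= => /(_ Gw).
  by rewrite integral0.
have F0 : ae_eq P setT (fun w => \int[mu]_t f (w, t))%E (cst 0).
  apply/(ae_eq_integral_abs P measurableT mF).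
  under eq_integral.
    move=> w _; rewrite gee0_abs; last exact: integral_ge0.
    over.
  exact: I0.
apply: filterS F0 => w /(_ I) /= w0.
have mfw : measurable_fun setT (fun t => f (w, t)).
  exact: (measurableT_comp mf (measurable_fun_pair _ _)).
have : ae_eq mu setT (fun t => f (w, t)) (cst 0).
  apply/(ae_eq_integral_abs mu measurableT mfw).
  by under eq_integral do rewrite gee0_abs//.
apply: filterS => t /(_ I); rewrite /f /= indicE => /eqP.
rewrite eqe pnatr_eq0 eqb0 => /negP nG; apply: contrapT => h; apply: nG.
by rewrite inE.
Qed.

End AlmostEverywhere.

Section FourierParts.
Context {R : realType}.
Notation mu := (@lebesgue_measure R).
Implicit Types (f : R -> R) (theta : R).

Lemma fourierE f theta : fourier f theta =
  (\int[mu]_t (cos (theta * t) * f t)) +i* (\int[mu]_t (sin (theta * t) * f t)).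
Proof.
rewrite /fourier /cintegral; congr (_ +i* _); apply: eq_Rintegral => t _ /=.
  by rewrite mulr0 subr0.
by rewrite mulr0 add0r.
Qed.

Lemma even_partN f t : even_part f (- t) = even_part f t.
Proof. by rewrite /even_part opprK addrC. Qed.

Lemma odd_partN f t : odd_part f (- t) = - odd_part f t.
Proof. by rewrite /odd_part opprK -mulNr opprB. Qed.

Section Integrable.
Variable f : R -> R.
Hypothesis iF : mu.-integrable setT (EFin \o f).

Lemma integrable_even_part : mu.-integrable setT (EFin \o even_part f).
Proof.
have := integrableRZ 2^-1 (integrableRD iF (integrable_oppr iF)).
by apply: eq_integrable => // t _; rewrite /= /even_part mulrC.
Qed.

Lemma integrable_odd_part : mu.-integrable setT (EFin \o odd_part f).
Proof.
have := integrableRZ 2^-1 (integrableRB iF (integrable_oppr iF)).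
by apply: eq_integrable => // t _; rewrite /= /odd_part mulrC.
Qed.

Let even_odd t : f t = even_part f t + odd_part f t.
Proof. by rewrite /even_part /odd_part; field. Qed.

Lemma fourier_even_part theta :
  fourier (even_part f) theta = (\int[mu]_t (cos (theta * t) * f t))%:C.
Proof.
have ie := integrable_even_part; have io := integrable_odd_part.
rewrite fourierE [X in _ +i* X]Rintegral_odd_eq0; last 2 first.
- exact: integrable_sinM.
- by move=> t; rewrite even_partN mulrN sinN mulNr.
congr (_ +i* _); under [RHS]eq_Rintegral do rewrite even_odd mulrDr.
rewrite RintegralD//; [|exact: integrable_cosM..].
rewrite [X in _ + X]Rintegral_odd_eq0 ?addr0//; first exact: integrable_cosM.
by move=> t; rewrite odd_partN mulrN [theta * - t]mulrN cosN.
Qed.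

Lemma fourier_odd_part theta :
  'i * fourier (odd_part f) theta = (- \int[mu]_t (sin (theta * t) * f t))%:C.
Proof.
have ie := integrable_even_part; have io := integrable_odd_part.
rewrite fourierE [X in X +i* _]Rintegral_odd_eq0; last 2 first.
- exact: integrable_cosM.
- by move=> t; rewrite odd_partN mulrN [theta * - t]mulrN cosN.
rewrite (_ : \int[mu]_t (sin (theta * t) * odd_part f t) =
  \int[mu]_t (sin (theta * t) * f t)); last first.
  under [RHS]eq_Rintegral do rewrite even_odd mulrDr.
  rewrite RintegralD//; [|exact: integrable_sinM..].
  rewrite [X in X + _]Rintegral_odd_eq0 ?add0r//; first exact: integrable_sinM.
  by move=> t; rewrite even_partN mulrN sinN mulNr.
apply/eqP; rewrite eq_complex /=; apply/andP; split; apply/eqP; ring.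
Qed.

End Integrable.
End FourierParts.

Section MaskedProcesses.
Context {R : realType} {d : measure_display} {T : measurableType d}.
Variables (P : probability T R) (zeta : nat -> T -> R).
Hypothesis hzeta : iid_standard_normal P zeta.

Definition ae_masked (M : pred nat) : set (set T) :=
  [set E | measurable E /\ exists2 C : set (seq_space R), measurable C &
     {ae P, forall w, E w <-> C (masked zeta M w)}].

Lemma ae_masked_sigma_algebra M : sigma_algebra setT (ae_masked M).
Proof.
split.
- split => //; exists set0 => //; exact: aeW.
- move=> E [mE [C mC EC]]; rewrite setTD; split; first exact: measurableC.
  exists (~` C); first exact: measurableC.
  by apply: filterS EC => w [h1 h2]; split => h x; apply: h; [exact: h2|exact: h1].
- move=> E hE; split; first by apply: bigcupT_measurable => n; have [] := hE n.
  have /choice[C hC] : forall n, exists C : set (seq_space R), measurable C /\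
      {ae P, forall w, E n w <-> C (masked zeta M w)}.
    by move=> n; have [_ [C]] := hE n; exists C.
  exists (\bigcup_n C n); first by apply: bigcupT_measurable => n; have [] := hC n.
  have /ae_foralln : forall n, {ae P, forall w, E n w <-> C n (masked zeta M w)}.
    by move=> n; have [] := hC n.
  apply: filterS => w h; split => -[n _ Hn]; exists n => //; exact/h.
Qed.

(** Almost sure equalities are compatible with the countable operations that
    generate the sigma-algebra of a process, even when its index set is
    uncountable. *)
Lemma masked_processes_independent (I J : Type) (X : I -> T -> R) (X' : J -> T -> R)
    (M M' : pred nat) (f : I -> seq_space R -> R) (f' : J -> seq_space R -> R) :
  (forall k, ~~ (M k && M' k)) ->
  (forall i, measurable_fun setT (X i)) -> (forall j, measurable_fun setT (X' j)) ->
  (forall i, measurable_fun setT (f i)) -> (forall j, measurable_fun setT (f' j)) ->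
  (forall i, {ae P, forall w, X i w = f i (masked zeta M w)}) ->
  (forall j, {ae P, forall w, X' j w = f' j (masked zeta M' w)}) ->
  independent_processes P X X'.
Proof.
move=> MM' mX mX' mf mf' Xf Xf' E F sE sF.
have key (K : Type) (Z : K -> T -> R) (L : pred nat) (g : K -> seq_space R -> R) :
    (forall i, measurable_fun setT (Z i)) -> (forall i, measurable_fun setT (g i)) ->
    (forall i, {ae P, forall w, Z i w = g i (masked zeta L w)}) ->
    sigma_of_process Z `<=` ae_masked L.
  move=> mZ mg Zg; apply: smallest_sub; first exact: ae_masked_sigma_algebra.
  move=> _ [i [B [mB ->]]]; split.
    by rewrite -[X in measurable X]setTI; exact: mZ.
  exists (g i @^-1` B); first by rewrite -[X in measurable X]setTI; exact: mg.
  by apply: filterS (Zg i) => w h; rewrite /preimage /= h.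
have [mE [C mC EC]] := key _ _ _ _ mX mf Xf _ sE.
have [mF [C' mC' FC]] := key _ _ _ _ mX' mf' Xf' _ sF.
have mM L D : measurable D -> measurable (masked zeta L @^-1` D).
  by move=> mD; rewrite -[X in measurable X]setTI; exact: measurable_masked hzeta L _ _ mD.
rewrite (ae_eq_probability mE (mM M C mC) EC) (ae_eq_probability mF (mM M' C' mC') FC).
rewrite -(masked_independent hzeta MM' mC mC').
apply: ae_eq_probability; [exact: measurableI|by apply: measurableI; exact: mM|].
apply: filterS2 EC FC => w [h1 h2] [h3 h4]; split => -[].
  by move=> /h1 ? /h3.
by move=> /h2 ? /h4.
Qed.

End MaskedProcesses.

(** * The parity symmetry of the process *)
Section Parity.
Context {R : realType} {d : measure_display} {T : measurableType d}.
Notation mu := (@lebesgue_measure R).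
Variables (m : nat -> R) (H : nat -> {poly R}) (P : probability T R).
Variable zeta : nat -> T -> R.
Hypotheses (hH : hermite_chebycheff H) (hzeta : iid_standard_normal P zeta).
Hypothesis hcvg :
  forall t, {ae P, forall w, cvgn (kappa_series m H zeta t w)}.

Notation ka := (kappa m H zeta).

Let mz k : measurable_fun setT (zeta k).
Proof. exact: measurable_zeta hzeta k. Qed.
#[local] Hint Resolve mz : core.

Definition coord (k : nat) (z : seq_space R) : R := z k.

(** The process as a function of the sequence of the normal variables:
    [ka t w] is [kappa_seq t] at the sequence of the [zeta k w]. *)
Notation kappa_seq := (kappa m H coord).

Let mcoord k : measurable_fun setT (coord k).
Proof. exact: measurable_coord. Qed.

Lemma kappaE d' (S : measurableType d') (z : nat -> S -> R) t w :
  kappa m H z t w = std_gauss t * limn (kappa_series m H z t w).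
Proof. by []. Qed.

Lemma std_gaussN (t : R) : std_gauss (- t) = std_gauss t.
Proof. by rewrite /std_gauss sqrrN. Qed.

Lemma kappa_seq_alternating t (z : seq_space R) :
  kappa_seq t (fun k => (-1) ^+ k * z k) = kappa_seq (- t) z.
Proof.
rewrite !kappaE std_gaussN.
have -> : kappa_series m H coord t (fun k => (-1) ^+ k * z k) =
    kappa_series m H coord (- t) z.
  apply/funext => n; rewrite /kappa_series /series /=; apply: eq_bigr => k _.
  by rewrite /coord (hermiteN hH); ring.
by [].
Qed.

Let even_index : pred nat := fun k => ~~ odd k.

Lemma kappa_seq_even t w : cvgn (kappa_series m H zeta t w) ->
  cvgn (kappa_series m H zeta (- t) w) ->
  kappa_seq t (masked zeta even_index w) = even_part (ka ^~ w) t.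
Proof.
move=> c1 c2; rewrite /even_part !kappaE std_gaussN -mulrDr -[RHS]mulrA.
congr (_ * _); apply/cvg_lim => //.
rewrite (_ : kappa_series _ _ _ _ _ = fun n => (kappa_series m H zeta t w n +
    kappa_series m H zeta (- t) w n) / 2).
  by apply: cvgMl; exact: cvgD.
apply/funext => n; rewrite /kappa_series /series /= -big_split /= mulr_suml.
apply: eq_bigr => k _; rewrite (hermiteN hH) /coord /masked /even_index -signr_odd.
by case: (odd k) => /=; rewrite ?expr1 ?expr0; field.
Qed.

Lemma kappa_seq_odd t w : cvgn (kappa_series m H zeta t w) ->
  cvgn (kappa_series m H zeta (- t) w) ->
  kappa_seq t (masked zeta odd w) = odd_part (ka ^~ w) t.
Proof.
move=> c1 c2; rewrite /odd_part !kappaE std_gaussN -mulrBr -[RHS]mulrA.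
congr (_ * _); apply/cvg_lim => //.
rewrite (_ : kappa_series _ _ _ _ _ = fun n => (kappa_series m H zeta t w n -
    kappa_series m H zeta (- t) w n) / 2).
  by apply: cvgMl; exact: cvgB.
apply/funext => n; rewrite /kappa_series /series /= -sumrB mulr_suml.
apply: eq_bigr => k _; rewrite (hermiteN hH) /coord /masked -signr_odd.
by case: (odd k) => /=; rewrite ?expr1 ?expr0; field.
Qed.

Lemma ae_kappa_series_cvg : {ae P, forall w, {ae mu, forall t : R,
  cvgn (kappa_series m H zeta t w) /\ cvgn (kappa_series m H zeta (- t) w)}}.
Proof.
pose G := [set p : T * measurableTypeR R | cvgn (kappa_series m H zeta p.2 p.1)] `&`
  [set p : T * measurableTypeR R | cvgn (kappa_series m H zeta (- p.2) p.1)].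
have mG : measurable G.
  apply: measurableI.
    apply: (@measurable_cvgn _ _ _ (fun n (p : T * measurableTypeR R) =>
      kappa_series m H zeta p.2 p.1 n)) => n.
    by apply: measurable_kappa_series => //; exact: measurable_snd.
  apply: (@measurable_cvgn _ _ _ (fun n (p : T * measurableTypeR R) =>
    kappa_series m H zeta (- p.2) p.1 n)) => n.
  apply: measurable_kappa_series => //; apply: measurable_funN; exact: measurable_snd.
have := ae_prod_lebesgue (P := P) mG; apply => t.
by apply: filterS2 (hcvg t) (hcvg (- t)) => w.
Qed.

Definition even_transform theta w : R := \int[mu]_t (cos (theta * t) * even_part (ka ^~ w) t).
Definition odd_transform theta w : R := \int[mu]_t (sin (theta * t) * odd_part (ka ^~ w) t).

Let measurable_parts (s : bool) : measurable_fun setT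
  (fun p : T * measurableTypeR R =>
     if s then even_part (ka ^~ p.1) p.2 else odd_part (ka ^~ p.1) p.2).
Proof.
have m1 : measurable_fun setT (fun p : T * measurableTypeR R => ka p.2 p.1).
  by apply: measurable_kappa => //; exact: measurable_snd.
have m2 : measurable_fun setT (fun p : T * measurableTypeR R => ka (- p.2) p.1).
  by apply: measurable_kappa => //; apply: measurable_funN; exact: measurable_snd.
by case: s; apply: measurable_funM => //; [exact: measurable_funD|exact: measurable_funB].
Qed.

Lemma measurable_even_transform theta : measurable_fun setT (even_transform theta).
Proof.
apply: (@measurable_Rintegral _ _ _ _ _ mu (fun p : T * measurableTypeR R =>
  cos (theta * p.2) * even_part (ka ^~ p.1) p.2)).
apply: measurable_funM; last exact: (measurable_parts true).
exact: (measurableT_comp (measurable_cosM theta) measurable_snd).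
Qed.

Lemma measurable_odd_transform theta : measurable_fun setT (odd_transform theta).
Proof.
apply: (@measurable_Rintegral _ _ _ _ _ mu (fun p : T * measurableTypeR R =>
  sin (theta * p.2) * odd_part (ka ^~ p.1) p.2)).
apply: measurable_funM; last exact: (measurable_parts false).
exact: (measurableT_comp (measurable_sinM theta) measurable_snd).
Qed.

(** Almost surely, for almost all [t] the series converges at [t] and [- t]; there
    the even part is the process built from the even variables alone. *)
Lemma even_transform_masked theta : {ae P, forall w, even_transform theta w =
  kappa_int m H coord (fun t => cos (theta * t)) (masked zeta even_index w)}.
Proof.
apply: filterS ae_kappa_series_cvg => w cw; apply: ae_eq_Rintegral.
- apply: measurable_funM; first exact: measurable_cosM.
  exact: (measurableT_comp (measurable_parts true) (measurable_fun_pair _ _)).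
- apply: measurable_funM; first exact: measurable_cosM.
  exact: measurable_kappa_w.
- by apply: (@filterS _ _ (ae_filter_ringOfSetsType mu) _ _ _ cw) => t [c1 c2]; rewrite kappa_seq_even.
Qed.

Lemma odd_transform_masked theta : {ae P, forall w, odd_transform theta w =
  kappa_int m H coord (fun t => sin (theta * t)) (masked zeta odd w)}.
Proof.
apply: filterS ae_kappa_series_cvg => w cw; apply: ae_eq_Rintegral.
- apply: measurable_funM; first exact: measurable_sinM.
  exact: (measurableT_comp (measurable_parts false) (measurable_fun_pair _ _)).
- apply: measurable_funM; first exact: measurable_sinM.
  exact: measurable_kappa_w.
- by apply: (@filterS _ _ (ae_filter_ringOfSetsType mu) _ _ _ cw) => t [c1 c2]; rewrite kappa_seq_odd.
Qed.

Lemma even_odd_transform_independent :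
  independent_processes P even_transform (fun theta w => - odd_transform theta w).
Proof.
apply: (@masked_processes_independent _ _ _ P zeta hzeta _ _ _ _ even_index odd
  (fun theta => kappa_int m H coord (fun t => cos (theta * t)))
  (fun theta z => - kappa_int m H coord (fun t => sin (theta * t)) z)).
- by move=> k; rewrite /even_index; case: (odd k).
- exact: measurable_even_transform.
- by move=> theta; apply: measurable_funN; exact: measurable_odd_transform.
- by move=> theta; apply: measurable_kappa_int => //; exact: measurable_cosM.
- move=> theta; apply: measurable_funN.
  by apply: measurable_kappa_int => //; exact: measurable_sinM.
- exact: even_transform_masked.
- by move=> theta; apply: filterS (odd_transform_masked theta) => w ->.
Qed.

Lemma kappa_int_cos_alternating theta (z : seq_space R) :
  kappa_int m H coord (fun t => cos (theta * t)) (fun k => (-1) ^+ k * z k) =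
  kappa_int m H coord (fun t => cos (theta * t)) z.
Proof.
rewrite /kappa_int -[RHS]Rintegral_oppr; last first.
  by apply: measurable_funM; [exact: measurable_cosM|exact: measurable_kappa_w].
by apply: eq_Rintegral => t _; rewrite kappa_seq_alternating mulrN cosN.
Qed.

Lemma kappa_int_sin_alternating theta (z : seq_space R) :
  kappa_int m H coord (fun t => sin (theta * t)) (fun k => (-1) ^+ k * z k) =
  \int[mu]_t (- 1 * (sin (theta * t) * kappa_seq t z)).
Proof.
rewrite /kappa_int -[RHS]Rintegral_oppr; last first.
  apply: measurable_funM => //; apply: measurable_funM; first exact: measurable_sinM.
  exact: measurable_kappa_w.
apply: eq_Rintegral => t _; rewrite kappa_seq_alternating [theta * - t]mulrN sinN.
ring.
Qed.

Hypothesis hint : {ae P, forall w, mu.-integrable setT (EFin \o (ka ^~ w))}.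

(** On the event that the path is integrable, the cosine transform only sees the
    even part and the sine transform the odd part. *)
Lemma transforms_ae : {ae P, forall w, forall theta,
  [/\ fourier (even_part (ka ^~ w)) theta = (even_transform theta w)%:C,
      'i * fourier (odd_part (ka ^~ w)) theta = (- odd_transform theta w)%:C,
      even_transform theta w = kappa_int m H zeta (fun t => cos (theta * t)) w &
      odd_transform theta w = kappa_int m H zeta (fun t => sin (theta * t)) w]}.
Proof.
apply: filterS hint => w iw theta.
have e1 := fourier_even_part iw theta; have e2 := fourier_odd_part iw theta.
have h1 : even_transform theta w = kappa_int m H zeta (fun t => cos (theta * t)) w.
  by move: e1; rewrite fourierE => -[].
have h2 : odd_transform theta w = kappa_int m H zeta (fun t => sin (theta * t)) w.
  apply: oppr_inj; move/(congr1 (@complex.Re R)) : e2; rewrite fourierE /= => <-.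
  by rewrite mul0r mul1r sub0r.
by rewrite h1 h2.
Qed.

(** Changing the signs of the odd coefficients turns [ka t] into [ka (- t)],
    hence conjugates the transform. *)
Lemma fourier_kappa_law : complex_fields_equal_in_law P
  (fun theta w => fourier (ka ^~ w) theta)
  (fun theta w => (even_transform theta w)%:C + 'i * (- odd_transform theta w)%:C).
Proof.
move=> n i A mA.
pose Fc theta := kappa_int m H coord (fun t => cos (theta * t)).
pose Fs theta := kappa_int m H coord (fun t => sin (theta * t)).
have mFc theta : measurable_fun setT (Fc theta).
  by apply: measurable_kappa_int => //; exact: measurable_cosM.
have mFs theta : measurable_fun setT (Fs theta).
  by apply: measurable_kappa_int => //; exact: measurable_sinM.
have mtuple d' (S : measurableType d') (f g : 'I_n -> S -> R) :
    (forall k, measurable_fun setT (f k)) -> (forall k, measurable_fun setT (g k)) ->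
    measurable [set z | A [tuple (f k z, g k z) | k < n]].
  move=> mf mg.
  have mt : measurable_fun setT (fun z => [tuple (f k z, g k z) | k < n]).
    apply/measurable_fun_tnthP => k.
    rewrite (_ : _ \o _ = fun z => (f k z, g k z)); first exact: measurable_fun_pair.
    by apply/funext => z; rewrite /= tnth_mktuple.
  by rewrite -[X in measurable X]setTI; exact: mt.
pose C := [set z : seq_space R | A [tuple (Fc (i k) z, Fs (i k) z) | k < n]].
have mC : measurable C by exact: (@mtuple _ (seq_space R)).
have -> : [set w | A [tuple (complex.Re (fourier (ka ^~ w) (i k)),
    complex.Im (fourier (ka ^~ w) (i k))) | k < n]] =
    (fun w => (fun k => zeta k w) : seq_space R) @^-1` C.
  apply/funext => w; rewrite /C /preimage /mkset; congr (A _).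
  by apply: eq_mktuple => k; rewrite fourierE.
rewrite -(alternating_law hzeta mC); apply: ae_eq_probability.
- have malt : measurable_fun setT (fun w => (fun k => (-1) ^+ k * zeta k w) : seq_space R).
    by apply: measurable_seq_space => k; exact: measurable_funM.
  by rewrite -[X in measurable X]setTI; exact: malt.
- have E (x y : R) : x%:C + 'i * y%:C = x +i* y.
    by apply/eqP; rewrite eq_complex /=; apply/andP; split; apply/eqP; ring.
  rewrite (_ : [set w | _] = [set w | A [tuple (even_transform (i k) w,
      - odd_transform (i k) w) | k < n]]); last first.
    apply/funext => w; rewrite /mkset; congr (A _).
    by apply: eq_mktuple => k; rewrite E.
  apply: (@mtuple _ T) => k; first exact: measurable_even_transform.
  by apply: measurable_funN; exact: measurable_odd_transform.
apply: filterS2 transforms_ae hint => w hw iw.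
rewrite /C /preimage /mkset.
set z1 := [tuple _ | k < n]; set z2 := (X in _ <-> A X).
suff -> : z1 = z2 by [].
apply: eq_mktuple => k; have [_ _ h1 h2] := hw (i k).
rewrite h1 h2 /Fc /Fs kappa_int_cos_alternating kappa_int_sin_alternating.
rewrite RintegralZl//; last exact: integrable_sinM.
rewrite -/(kappa_int m H coord (fun t => sin (i k * t)) (fun j => zeta j w)) mulN1r.
by congr (_, _); rewrite /=; ring.
Qed.

End Parity.

(** * Plancherel's identity *)
Section Plancherel.
Context {R : realType} {d : measure_display} {T : measurableType d}.
Notation mu := (@lebesgue_measure R).
Context {d1 : measure_display} {T1 : measurableType d1}.
Variables (P1 : probability T1 R) (Y : T1 -> R).
Hypotheses (mY : measurable_fun setT Y) (Y1 : forall w, `|Y w| < 1).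
Hypothesis iW : P1.-integrable setT (EFin \o (fun w => (Num.sqrt (1 - Y w ^+ 2))^-1)).
Variables (m : nat -> R) (H : nat -> {poly R}) (P : probability T R).
Variable zeta : nat -> T -> R.
Hypothesis hm : forall k, m k ^+ 2 = \int[P1]_w (Y w ^+ k).
Hypotheses (hH : hermite_chebycheff H) (hzeta : iid_standard_normal P zeta).
Hypothesis hcvg :
  forall t, {ae P, forall w, cvgn (kappa_series m H zeta t w)}.

Notation ka := (kappa m H zeta).

Let mz k : measurable_fun setT (zeta k).
Proof. exact: measurable_zeta hzeta k. Qed.
#[local] Hint Resolve mz : core.

Lemma binormal_pdf_diag (s x : R) : `|x| < 1 -> binormal_pdf s s x =
  (2 * pi * Num.sqrt (1 - x ^+ 2))^-1 * expR (- ((1 + x)^-1 * s ^+ 2)).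
Proof.
move=> x1; rewrite /binormal_pdf; congr (_ * expR _).
move: x1; rewrite ltr_norml => /andP[x1 x2].
have n1 : 1 + x != 0 by rewrite gt_eqF//; lra.
have n2 : 1 - x != 0 by rewrite gt_eqF//; lra.
have -> : 1 - x ^+ 2 = (1 - x) * (1 + x) by ring.
by field; rewrite n1 n2.
Qed.

Lemma integral_binormal_diag (x : R) : `|x| < 1 ->
  ((2 * pi)%:E * \int[mu]_s (binormal_pdf s s x)%:E = (Num.sqrt (pi / (1 - x)))%:E)%E.
Proof.
move=> x1; under eq_integral do rewrite binormal_pdf_diag// EFinM.
have [xl xr] : -1 < x /\ x < 1 by move: x1; rewrite ltr_norml => /andP[].
have p1 : 0 < 1 + x by lra.
have p2 : 0 < 1 - x by lra.
have pp : 0 < (2 * pi : R) by rewrite mulr_gt0// pi_gt0.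
have E2 : 1 - x ^+ 2 = (1 - x) * (1 + x) by ring.
have p3 : 0 < 1 - x ^+ 2 by rewrite E2 mulr_gt0.
have p4 : 0 < (1 + x)^-1 by rewrite invr_gt0.
rewrite ge0_integralZl//; last 2 first.
- exact: measurable_int (integrable_expRN_sqr p4).
- by rewrite lee_fin invr_ge0 mulr_ge0 ?sqrtr_ge0// ltW.
rewrite integral_expRN_sqr ?invr_gt0// invrK -!EFinM; congr EFin.
rewrite invfM mulrA mulrA divff ?gt_eqF// mul1r.
have -> : pi * (1 + x) = (1 - x ^+ 2) * (pi / (1 - x)).
  by rewrite E2; field; rewrite gt_eqF.
by rewrite sqrtrM ?(ltW p3)// mulKf// gt_eqF// sqrtr_gt0.
Qed.

Lemma measurable_binormal d' (S : measurableType d') (t s x : S -> R) :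
  measurable_fun setT t -> measurable_fun setT s -> measurable_fun setT x ->
  measurable_fun setT (fun z => binormal_pdf (t z) (s z) (x z)).
Proof.
move=> mt ms mx; have mx2 : measurable_fun setT (fun z => 1 - x z ^+ 2).
  by apply: measurable_funB => //; exact: measurable_funX.
have mS : measurable_fun setT (@Num.sqrt R).
  by apply: continuous_measurable_funT; exact: sqrt_continuous.
apply: measurable_funM.
  apply: (measurableT_comp measurable_invr); apply: measurable_funM => //.
  exact: (measurableT_comp mS).
apply: measurableT_comp => //; apply: measurable_funM.
  apply: measurable_funN; apply: measurable_funD; last exact: measurable_funX.
  apply: measurable_funB; first exact: measurable_funX.
  by do 3! apply: measurable_funM => //.
by apply: (measurableT_comp measurable_invr); exact: measurable_funM.
Qed.

Let hK := moment_sqr_hermite_le mY Y1 iW hm hH.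
Let ka_series t := kappa_zeta_series hzeta hcvg hK t.

Lemma kappa_plancherel :
  ((2 * pi)%:E * \int[P]_w \int[mu]_s (`|ka s w| ^+ 2)%:E =
   \int[P1]_w (Num.sqrt (pi / (1 - Y w)))%:E)%E.
Proof.
have pp : 0 < (2 * pi : R) by rewrite mulr_gt0// pi_gt0.
pose f (p : T * measurableTypeR R) : \bar R := (`|ka p.2 p.1| ^+ 2)%:E.
have mf : measurable_fun setT f.
  apply/measurable_EFinP; apply: measurable_funX; apply: measurableT_comp => //.
  by apply: measurable_kappa => //; exact: measurable_snd.
have f0 p : (0 <= f p)%E by rewrite lee_fin sqr_ge0.
pose g (p : T1 * measurableTypeR R) : \bar R := (binormal_pdf p.2 p.2 (Y p.1))%:E.
have mg : measurable_fun setT g.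
  apply/measurable_EFinP; apply: measurable_binormal; [exact: measurable_snd..|].
  exact: (measurableT_comp mY measurable_fst).
have g0 p : (0 <= g p)%E.
  rewrite lee_fin binormal_pdf_diag// mulr_ge0 ?expR_ge0//.
  by rewrite invr_ge0 mulr_ge0 ?sqrtr_ge0// ltW.
rewrite (@fubini_tonelli _ _ _ _ _ P mu f mf f0).
have -> : (\int[mu]_s \int[P]_w f (w, s) = \int[mu]_s \int[P1]_w g (w, s))%E.
  apply: eq_integral => s _; rewrite /f /g /=.
  have [ig gE] := kappa_mean_mul mY Y1 iW hm hH hzeta hcvg s s.
  rewrite (EFin_Rintegral ig) -gE -EFin_Rintegral; last first.
    have [i2 _] := zeta_series_mul hzeta (ka_series s) (ka_series s).
    exact: i2.
  by apply: eq_integral => w _; rewrite /= real_normK ?num_real// expr2.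
rewrite -(@fubini_tonelli _ _ _ _ _ P1 mu g mg g0) -ge0_integralZl//; last 3 first.
- exact: (@measurable_fun_fubini_tonelli_F _ _ _ _ _ mu g mg g0).
- by move=> w _; exact: integral_ge0.
- by rewrite lee_fin ltW.
by apply: eq_integral => w _; rewrite -integral_binormal_diag.
Qed.

Lemma cosh_sinh (x : R) : cosh x + sinh x = expR x.
Proof. by rewrite /cosh /sinh; field. Qed.

Notation kcos := (kappa_cos m H zeta).
Notation ksin := (kappa_sin m H zeta).

Lemma transform_plancherel :
  (\int[P]_w \int[mu]_theta (kcos theta w ^+ 2 + ksin theta w ^+ 2)%:E =
   \int[P1]_w (Num.sqrt (pi / (1 - Y w)))%:E)%E.
Proof.
have mtr (g : R -> R) : measurable_fun setT g ->
    measurable_fun setT (fun p : T * measurableTypeR R =>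
      kappa_int m H zeta (fun t => g (p.2 * t)) p.1).
  move=> mg; apply: (@measurable_kappa_Rintegral _ _ _ m H zeta mz _ _
    (@fst T (measurableTypeR R)) (fun q => g (q.1.2 * q.2))) => //.
  apply: (measurableT_comp mg); apply: measurable_funM; last exact: measurable_snd.
  exact: (measurableT_comp measurable_snd measurable_fst).
pose f (p : T * measurableTypeR R) : \bar R := (kcos p.2 p.1 ^+ 2 + ksin p.2 p.1 ^+ 2)%:E.
have mf : measurable_fun setT f.
  apply/measurable_EFinP; apply: measurable_funD; apply: measurable_funX.
    by apply: mtr; apply: continuous_measurable_funT; exact: continuous_cos.
  by apply: mtr; apply: continuous_measurable_funT; exact: continuous_sin.
have f0 p : (0 <= f p)%E by rewrite lee_fin addr_ge0 ?sqr_ge0.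
pose g (p : T1 * measurableTypeR R) : \bar R := (expR (- ((1 - Y p.1) * p.2 ^+ 2)))%:E.
have mg : measurable_fun setT g.
  apply/measurable_EFinP; apply: measurableT_comp => //; apply: measurable_funN.
  apply: measurable_funM; last by apply: measurable_funX; exact: measurable_snd.
  by apply: measurable_funB => //; exact: (measurableT_comp mY measurable_fst).
have g0 p : (0 <= g p)%E by rewrite lee_fin expR_ge0.
rewrite (@fubini_tonelli _ _ _ _ _ P mu f mf f0).
have -> : (\int[mu]_s \int[P]_w f (w, s) = \int[mu]_s \int[P1]_w g (w, s))%E.
  apply: eq_integral => s _; rewrite /f /g /=.
  have zc := kappa_cos_zeta_series mY Y1 iW hm hH hzeta hcvg s.
  have zs := kappa_sin_zeta_series mY Y1 iW hm hH hzeta hcvg s.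
  have [ic _] := zeta_series_sqr hzeta zc; have [is_ _] := zeta_series_sqr hzeta zs.
  rewrite (EFin_Rintegral (integrableRD ic is_)) RintegralD//.
  have := kappa_cos_mean_mul mY Y1 iW hm hH hzeta hcvg s s.
  under eq_Rintegral do rewrite -expr2; move=> ->.
  have := kappa_sin_mean_mul mY Y1 iW hm hH hzeta hcvg s s.
  under eq_Rintegral do rewrite -expr2; move=> ->.
  have [ich _] := mean_cosh P1 mY Y1 (s * s).
  have [ish _] := mean_sinh P1 mY Y1 (s * s).
  rewrite -mulrDr -RintegralD// -RintegralZl//; last exact: integrableRD.
  rewrite -EFin_Rintegral; last by apply: integrableRZ; exact: integrableRD.
  apply: eq_integral => w _; rewrite cosh_sinh -expRD; congr (expR _)%:E.
  by field.
rewrite -(@fubini_tonelli _ _ _ _ _ P1 mu g mg g0).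
apply: eq_integral => w _; rewrite /g /= integral_expRN_sqr// subr_gt0.
exact: le_lt_trans (ler_norm _) (Y1 w).
Qed.

End Plancherel.

Lemma ae_eq_expectation {R : realType} {d : measure_display} {T : measurableType d}
  (P : probability T R) (Y X : T -> R) (f : R -> R) :
  {ae P, forall w, Y w = X w} -> measurable_fun setT (fun w => f (Y w)) ->
  P.-integrable setT (EFin \o (fun w => f (X w))) ->
  'E_P[fun w => f (Y w)]%E = (\int[P]_w f (X w))%:E.
Proof.
move=> YX m1 i2; have m2 := measurable_int _ i2.
rewrite unlock -(EFin_Rintegral i2); apply: ae_eq_integral => //.
- exact/measurable_EFinP.
- by apply: filterS YX => w /= ->.
Qed.

Section Truncation.
Context {R : realType} {d1 : measure_display} {T1 : measurableType d1}.
Variables (P1 : probability T1 R) (Y : T1 -> R).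
Hypotheses (mY : measurable_fun setT Y) (Y1 : {ae P1, forall w, `|Y w| < 1}).

(** Almost surely equal to [Y], and pointwise in the disc where Mehler's series
    converges. *)
Definition truncate (w : T1) : R := Y w * \1_([set w | `|Y w| < 1]) w.

Let mD : measurable [set w | `|Y w| < 1].
Proof.
rewrite (_ : [set w | _] = ~` [set w | 1 <= `|Y w|]).
  by apply: measurableC; exact: measurable_norm_ge.
by apply/seteqP; split => w /=; rewrite ltNge => /negP.
Qed.

Lemma measurable_truncate : measurable_fun setT truncate.
Proof. by apply: measurable_funM => //; exact: measurable_indic. Qed.

Lemma truncate_lt1 w : `|truncate w| < 1.
Proof.
rewrite /truncate indicE; case: (boolP (w \in _)) => [|_]; last by rewrite mulr0 normr0.
by rewrite inE /= mulr1.
Qed.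

Lemma truncate_ae : {ae P1, forall w, Y w = truncate w}.
Proof. by apply: filterS Y1 => w Yw; rewrite /truncate indicE mem_set// mulr1. Qed.

Lemma truncate_integral_sqrt :
  (\int[P1]_w ((pi%:E / (1 - Y w)%:E) `^ 2^-1) =
   \int[P1]_w (Num.sqrt (pi / (1 - truncate w)))%:E)%E.
Proof.
pose E := [set w | Y w = 1].
have mE : measurable E.
  by rewrite -[X in measurable X]setTI; exact: (mY measurableT (measurable_set1 1)).
pose F w := ((\1_E w)%:E * +oo + ((pi * (1 - Y w)^-1) `^ 2^-1)%:E)%E.
have -> : (\int[P1]_w ((pi%:E / (1 - Y w)%:E) `^ 2^-1) = \int[P1]_w F w)%E.
  apply: eq_integral => w _; rewrite /F indicE.
  have [Yw|Yw] := eqVneq (Y w) 1.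
    rewrite mem_set// mul1e Yw subrr inve0 gt0_muley ?lte_fin ?pi_gt0//.
    by rewrite poweRyr ?invr_eq0// addye.
  rewrite memNset; last by move/eqP; rewrite (negbTE Yw).
  by rewrite mul0e add0e inver subr_eq0 eq_sym (negbTE Yw) -EFinM poweR_EFin.
have mpow : measurable_fun setT (fun x : R => x `^ 2^-1) by exact: measurable_powR.
have mS : measurable_fun setT (@Num.sqrt R).
  by apply: continuous_measurable_funT; exact: sqrt_continuous.
apply: ae_eq_integral => //.
- apply: emeasurable_funD.
    by apply: emeasurable_funM => //; apply/measurable_EFinP; exact: measurable_indic.
  apply/measurable_EFinP; apply: (measurableT_comp mpow); apply: measurable_funM => //.
  by apply: (measurableT_comp measurable_invr); exact: measurable_funB.
- apply/measurable_EFinP; apply: (measurableT_comp mS); apply: measurable_funM => //.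
  apply: (measurableT_comp measurable_invr); apply: measurable_funB => //.
  exact: measurable_truncate.
- apply: filterS2 truncate_ae Y1 => w Yw lt1 _; rewrite /F -Yw.
  have Yw1 : Y w < 1 by exact: le_lt_trans (ler_norm _) lt1.
  rewrite indicE memNset; last by move=> E1; move: Yw1; rewrite E1 ltxx.
  rewrite mul0e add0e powR12_sqrt// mulr_ge0 ?pi_ge0// invr_ge0 subr_ge0 ltW//.
Qed.

End Truncation.

Section Boundedness.
Context {R : realType} {d : measure_display} {T : measurableType d}.
Variables (m : nat -> R) (H : nat -> {poly R}) (P : probability T R).
Variable zeta : nat -> T -> R.
Hypothesis hzeta : iid_standard_normal P zeta.
Hypothesis hcvg0 : {ae P, forall w, cvgn (kappa_series m H zeta 0 w)}.

(** The convergence of the series at the origin forces its variances to be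
    summable. *)
Lemma sum_moment_hermite_sqr0_bounded :
  exists B, forall n, \sum_(k < n) m k ^+ 2 * hermite_sqr H 0 k <= B.
Proof.
pose c k := m k * (Num.sqrt k`!%:R)^-1 * (H k).[0].
have [] := @scaled_normal_ae_cvg_bounded _ _ _ P (zeta_sum zeta c)
  (fun n => Num.sqrt (sum_sqr c n)).
- exact: measurable_zeta_sum hzeta c.
- by move=> n; exact: sqrtr_ge0.
- exact: zeta_sum_scaled_normal hzeta c.
- apply: filterS hcvg0 => w; rewrite (_ : kappa_series _ _ _ _ _ = zeta_sum zeta c ^~ w)//.
  by apply/funext => n; rewrite /kappa_series /series /= big_mkord.
move=> B sB; exists (B ^+ 2) => n.
rewrite (_ : \sum_(k < n) _ = sum_sqr c n).
  rewrite -(sqr_sqrtr (sum_sqr_ge0 c n)) ler_pXn2r ?nnegrE ?sqrtr_ge0//.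
  exact: le_trans (sqrtr_ge0 _) (sB n).
apply: eq_bigr => k _; rewrite /c /hermite_sqr.
have -> : (k`!%:R^-1 : R) = (Num.sqrt k`!%:R)^-1 * (Num.sqrt k`!%:R)^-1.
  by rewrite -invfM -expr2 sqr_sqrtr.
ring.
Qed.

End Boundedness.

(** * The Fourier transform of the Gaussian process *)
Theorem proposition11 (R : realType) (nu : {measure set R -> \bar R})
  (d1 : measure_display) (T1 : measurableType d1) (P1 : probability T1 R)
  (Y : {RV P1 >-> R})
  (hY : law_of_product_of_points P1 Y (pgfl_nu nu))
  (d2 : measure_display) (T2 : measurableType d2) (P2 : probability T2 R)
  (Yhalf : {RV P2 >-> R})
  (hYhalf : law_of_product_of_points P2 Yhalf
              (fun f => (pgfl_nu nu f `^ 2^-1)%E))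
  (H : nat -> {poly R}) (hH : hermite_chebycheff H)
  (d : measure_display) (T : measurableType d) (P : probability T R)
  (zeta : nat -> T -> R) (hzeta : iid_standard_normal P zeta)
  (hcvg : forall t : R,
     {ae P, forall w, cvgn (kappa_series (moment P2 Yhalf) H zeta t w)}) :
  let ka : R -> T -> R := kappa (moment P2 Yhalf) H zeta in
  let kahat : R -> T -> R[i] := fun theta w => fourier (ka^~ w) theta in
  let Uc : R -> T -> R[i] :=
    fun theta w => fourier (even_part (ka^~ w)) theta in
  let Vc : R -> T -> R[i] :=
    fun theta w => 'i%C * fourier (odd_part (ka^~ w)) theta in
  let U : R -> T -> R := fun theta w => complex.Re (Uc theta w) in
  let V : R -> T -> R := fun theta w => complex.Re (Vc theta w) in
  let EsqrtY : \bar R :=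
    (\int[P1]_w ((pi%:E / (1 - Y w)%:E) `^ 2^-1))%E in
  (gaussian_process P ka /\
   forall t s, covariance P (ka t) (ka s)
               = 'E_P1[fun w => binormal_pdf t s (Y w)]%E) /\
  [/\ {ae P, forall w,
        lebesgue_measure.-integrable [set: R] (fun t => (ka t w)%:E)},
      complex_gaussian_field P kahat
    & forall theta phi,
        ccovariance P (kahat theta) (kahat phi)
          = cintegral P (fun w => kahat theta w * (kahat phi w)^*%C) /\
        cintegral P (fun w => kahat theta w * (kahat phi w)^*%C)
          = (expR (- ((theta ^+ 2 + phi ^+ 2) / 2)) *
             fine ('E_P1[fun w => (expR (theta * phi * Y w))%R])%E)%:C] /\
  [/\ {ae P, forall w, forall theta, Uc theta w = (U theta w)%:C /\
                                     Vc theta w = (V theta w)%:C},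
      gaussian_process P U /\ gaussian_process P V,
      independent_processes P U V,
      complex_fields_equal_in_law P kahat
        (fun theta w => (U theta w)%:C + 'i%C * (V theta w)%:C)
    & forall theta phi,
        covariance P (U theta) (U phi)
          = ((expR (- ((theta ^+ 2 + phi ^+ 2) / 2)))%:E *
             'E_P1[fun w => (cosh (theta * phi * Y w))%R])%E /\
        covariance P (V theta) (V phi)
          = ((expR (- ((theta ^+ 2 + phi ^+ 2) / 2)))%:E *
             'E_P1[fun w => (sinh (theta * phi * Y w))%R])%E] /\
  (* the transform is unnormalized, hence the factor 2 pi in Plancherel *)
  ((EsqrtY < +oo)%E ->
   ((2 * pi)%:E *
      \int[P]_w \int[lebesgue_measure]_s (`|ka s w| ^+ 2)%:E
    = \int[P]_w \int[lebesgue_measure]_theta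
        (Normc.normc (kahat theta w) ^+ 2)%:E)%E /\
   (\int[P]_w \int[lebesgue_measure]_theta
        (Normc.normc (kahat theta w) ^+ 2)%:E = EsqrtY)%E).
Proof.
move: hcvg; set m := moment P2 Yhalf => {}hcvg ka kahat Uc Vc U V EsqrtY.
have Yle1 := product_of_points_le1 hY.
have mY0 : measurable_fun setT (Y : T1 -> R) by [].
have mE k : m k ^+ 2 = \int[P1]_w (Y w ^+ k).
  by rewrite /m (moment_half_sqr hY hYhalf).
have [B hB] := sum_moment_hermite_sqr0_bounded hzeta (hcvg 0).
have {}hB n : \sum_(k < n) (\int[P1]_w (Y w ^+ k)) * hermite_sqr H 0 k <= B.
  by under eq_bigr do rewrite -mE; exact: hB.
have Ylt1 := ae_norm_lt1 hH mY0 Yle1 hB.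
have iW := integrable_inv_sqrt hH mY0 Yle1 hB.
(* the version [X] of [Y] makes the series identities hold pointwise *)
pose X := truncate Y; have mX : measurable_fun setT X := measurable_truncate mY0.
have X1 : forall w, `|X w| < 1 := truncate_lt1 Y.
have YX : {ae P1, forall w, Y w = X w} := truncate_ae Ylt1.
have {}iW : P1.-integrable setT (EFin \o (fun w => (Num.sqrt (1 - X w ^+ 2))^-1)).
  apply: ae_eq_integrable iW; [exact: measurable_inv_sqrt..|].
  by apply: filterS YX => w ->.
have hm k : m k ^+ 2 = \int[P1]_w (X w ^+ k).
  rewrite mE; apply: ae_eq_Rintegral; [exact: measurable_funX..|].
  by apply: filterS YX => w ->.
have hK := moment_sqr_hermite_le mX X1 iW hm hH.
have zka t : zeta_series P zeta (kappa_coef m H t) (ka t) :=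
  kappa_zeta_series hzeta hcvg hK t.
have zcos theta := kappa_cos_zeta_series mX X1 iW hm hH hzeta hcvg theta.
have zsin theta := kappa_sin_zeta_series mX X1 iW hm hH hzeta hcvg theta.
have hint := kappa_ae_integrable hH hzeta hcvg hK.
have htr := transforms_ae hint.
have kahatE theta w : kahat theta w =
    kappa_cos m H zeta theta w +i* kappa_sin m H zeta theta w.
  exact: fourierE.
have UE theta w : U theta w = even_transform m H zeta theta w.
  by rewrite /U /Uc fourierE.
have VE theta w : V theta w = - odd_transform m H zeta theta w.
  by rewrite /V /Vc fourierE /= mul0r mul1r sub0r.
have mU theta : measurable_fun setT (U theta).
  rewrite (_ : U theta = even_transform m H zeta theta); last exact/funext.
  exact: (measurable_even_transform m H hzeta).
have mV theta : measurable_fun setT (V theta).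
  rewrite (_ : V theta = fun w => - odd_transform m H zeta theta w); last exact/funext.
  by apply: measurable_funN; exact: (measurable_odd_transform m H hzeta).
have zU theta : zeta_series P zeta
    (fun k => m k * (Num.sqrt k`!%:R)^-1 * hermite_cos H k theta) (U theta).
  apply: (zeta_series_ae hzeta (zcos theta) (mU theta)).
  by apply: filterS htr => w /(_ theta)[_ _ h _]; rewrite UE h.
have zV theta : zeta_series P zeta
    (fun k => -1 * (m k * (Num.sqrt k`!%:R)^-1 * hermite_sin H k theta)) (V theta).
  apply: (zeta_series_ae hzeta (zeta_seriesZ hzeta (-1) (zsin theta)) (mV theta)).
  by apply: filterS htr => w /(_ theta)[_ _ _ h]; rewrite VE h mulN1r.
have mulU theta phi : \int[P]_w (U theta w * U phi w) =
    \int[P]_w (kappa_cos m H zeta theta w * kappa_cos m H zeta phi w).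
  have [iu _] := zeta_series_mul hzeta (zU theta) (zU phi).
  have [ic _] := zeta_series_mul hzeta (zcos theta) (zcos phi).
  apply: ae_eq_Rintegral.
  - by apply/measurable_EFinP; exact: measurable_int iu.
  - by apply/measurable_EFinP; exact: measurable_int ic.
  apply: filterS htr => w h; rewrite !UE.
  by have [_ _ -> _] := h theta; have [_ _ -> _] := h phi.
have mulV theta phi : \int[P]_w (V theta w * V phi w) =
    \int[P]_w (kappa_sin m H zeta theta w * kappa_sin m H zeta phi w).
  have [iu _] := zeta_series_mul hzeta (zV theta) (zV phi).
  have [ic _] := zeta_series_mul hzeta (zsin theta) (zsin phi).
  apply: ae_eq_Rintegral.
  - by apply/measurable_EFinP; exact: measurable_int iu.
  - by apply/measurable_EFinP; exact: measurable_int ic.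
  apply: filterS htr => w h; rewrite !VE mulrNN.
  by have [_ _ _ ->] := h theta; have [_ _ _ ->] := h phi.
have mcosh a : measurable_fun setT (fun w => cosh (a * Y w)).
  by do ![apply: measurable_funM => // | apply: measurable_funD => //
    | apply: measurableT_comp => // | apply: measurable_funN => //].
have msinh a : measurable_fun setT (fun w => sinh (a * Y w)).
  by do ![apply: measurable_funM => // | apply: measurable_funB => //
    | apply: measurableT_comp => // | apply: measurable_funN => //].
have mexp a : measurable_fun setT (fun w => expR (a * Y w)).
  by do ![apply: measurable_funM => // | apply: measurableT_comp => //].
split; [split|split; [split|split; [split|]]].
- by apply: (zeta_series_gaussian_process hzeta) => t; eexists; exact: zka.
- move=> t s; have [iB BE] := kappa_mean_mul mX X1 iW hm hH hzeta hcvg t s.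
  rewrite (zeta_series_covariance hzeta (zka t) (zka s)) BE.
  rewrite (@ae_eq_expectation _ _ _ P1 Y X (binormal_pdf t s) YX)//.
  exact: measurable_binormal.
- exact: hint.
- apply: (zeta_series_gaussian_process hzeta) => -[theta []] /=.
    exists (fun k => m k * (Num.sqrt k`!%:R)^-1 * hermite_cos H k theta).
    rewrite [X in zeta_series _ _ _ X](_ : _ = kappa_cos m H zeta theta); first exact: zcos.
    by apply/funext => w; exact: (congr1 (@complex.Re R) (kahatE theta w)).
  exists (fun k => m k * (Num.sqrt k`!%:R)^-1 * hermite_sin H k theta).
  rewrite [X in zeta_series _ _ _ X](_ : _ = kappa_sin m H zeta theta); first exact: zsin.
  by apply/funext => w; exact: (congr1 (@complex.Im R) (kahatE theta w)).
- move=> theta phi.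
  have m0 psi : cintegral P (kahat psi) = 0.
    rewrite /cintegral; under eq_Rintegral do rewrite kahatE /=.
    under [X in _ +i* X]eq_Rintegral do rewrite kahatE /=.
    have [_ ->] := zeta_series_mean hzeta (zcos psi).
    by have [_ ->] := zeta_series_mean hzeta (zsin psi).
  split.
    rewrite /ccovariance !m0; congr cintegral; apply/funext => w.
    by rewrite !subr0.
  have [icc _] := zeta_series_mul hzeta (zcos theta) (zcos phi).
  have [iss _] := zeta_series_mul hzeta (zsin theta) (zsin phi).
  have [isc _] := zeta_series_mul hzeta (zsin theta) (zcos phi).
  have [ics _] := zeta_series_mul hzeta (zcos theta) (zsin phi).
  have -> : cintegral P (fun w => kahat theta w * (kahat phi w)^*%C) =
      (\int[P]_w (kappa_cos m H zeta theta w * kappa_cos m H zeta phi w +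
         kappa_sin m H zeta theta w * kappa_sin m H zeta phi w)) +i*
      (\int[P]_w (kappa_sin m H zeta theta w * kappa_cos m H zeta phi w -
         kappa_cos m H zeta theta w * kappa_sin m H zeta phi w)).
    rewrite /cintegral; congr (_ +i* _); apply: eq_Rintegral => w _;
      rewrite !kahatE /=; ring.
  rewrite RintegralD// RintegralB//.
  rewrite (kappa_cos_mean_mul mX X1 iW hm hH hzeta hcvg).
  rewrite (kappa_sin_mean_mul mX X1 iW hm hH hzeta hcvg).
  under [X in X - _]eq_Rintegral do rewrite mulrC.
  rewrite !(kappa_cos_sin_mean_mul mX X1 iW hm hH hzeta hcvg) subrr.
  have [iex _] := mean_expR P1 mX X1 (theta * phi).
  have [ich _] := mean_cosh P1 mX X1 (theta * phi).
  have [ish _] := mean_sinh P1 mX X1 (theta * phi).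
  rewrite (@ae_eq_expectation _ _ _ P1 Y X
    (fun y => expR (theta * phi * y)) YX)//=.
  congr (_ +i* _); rewrite -mulrDr -RintegralD//; congr (_ * _).
  by apply: eq_Rintegral => w _; rewrite cosh_sinh.
- apply: filterS htr => w h theta; have [h1 h2 _ _] := h theta.
  by rewrite UE VE.
- split.
    by apply: (zeta_series_gaussian_process hzeta) => t; eexists; exact: zU.
  by apply: (zeta_series_gaussian_process hzeta) => t; eexists; exact: zV.
- have -> : U = even_transform m H zeta by apply/funext => theta; exact/funext.
  have -> : V = (fun theta w => - odd_transform m H zeta theta w).
    by apply/funext => theta; exact/funext.
  exact: (even_odd_transform_independent hH hzeta hcvg).
- have -> : U = even_transform m H zeta by apply/funext => theta; exact/funext.
  have -> : V = (fun theta w => - odd_transform m H zeta theta w).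
    by apply/funext => theta; exact/funext.
  exact: (fourier_kappa_law hH hzeta hint).
- move=> theta phi.
  have [ich _] := mean_cosh P1 mX X1 (theta * phi).
  have [ish _] := mean_sinh P1 mX X1 (theta * phi).
  rewrite (zeta_series_covariance hzeta (zU theta) (zU phi)).
  rewrite (zeta_series_covariance hzeta (zV theta) (zV phi)) mulU mulV.
  rewrite (kappa_cos_mean_mul mX X1 iW hm hH hzeta hcvg).
  rewrite (kappa_sin_mean_mul mX X1 iW hm hH hzeta hcvg).
  rewrite (@ae_eq_expectation _ _ _ P1 Y X
    (fun y => cosh (theta * phi * y)) YX)//.
  by rewrite (@ae_eq_expectation _ _ _ P1 Y X
    (fun y => sinh (theta * phi * y)) YX)// !EFinM.
- move=> _.
  have EE : EsqrtY = (\int[P1]_w (Num.sqrt (pi / (1 - X w)))%:E)%E.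
    exact: truncate_integral_sqrt.
  have hat : (\int[P]_w \int[lebesgue_measure]_theta
      (Normc.normc (kahat theta w) ^+ 2)%:E = EsqrtY)%E.
    rewrite EE -(transform_plancherel mX X1 iW hm hH hzeta hcvg).
    apply: eq_integral => w _; apply: eq_integral => theta _; congr EFin.
    by rewrite kahatE /= sqr_sqrtr// addr_ge0 ?sqr_ge0.
  split => //; rewrite hat EE.
  exact: (kappa_plancherel mX X1 iW hm hH hzeta hcvg).
Qed.
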